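(* Let $n\in\{1,2,3\}$ and $k\in\{1,\dots,n\}$. Consider the hyperbolic-parabolic coupled system $$\begin{cases} u^{p_0}_{tt}-b^2\Delta u^{p_0}+\gamma_1\nabla\theta=0,\\ \theta_t-\kappa\Delta\theta+\gamma_2\,\mathrm{div}\,u^{p_0}_t=0,\\ u^{p_0}(0,x)=u^{p_0}_0(x),\ u^{p_0}_t(0,x)=u^{p_0}_1(x),\ \theta(0,x)=\theta_0(x),\end{cases}\qquad (t,x)\in\mathbb{R}_+\times\mathbb{R}^n,$$ with $\mathrm{rot}\,u^{p_0}=0$, and suppose that the initial data satisfy $u_0^{k,p_0},u_1^{k,p_0},\theta_0\in L^2\cap L^1$ for $k=1,\dots,n$. Then the $k$-th component $u^{k,p_0}$ of $u^{p_0}$ satisfies $$\mathcal{A}_n(t)\,|\mathbb{A}|\ \lesssim\ \|u^{k,p_0}(t,\cdot)\|_{L^2}\ \lesssim\ \mathcal{A}_n(t)\,\big\|\big(u_0^{k,p_0},u_1^{k,p_0},\theta_0\big)\big\|_{(L^2\cap L^1)^3}$$ for $t\gg1$, where $$\mathbb{A}^2:=|P_{u_1^{k,p_0}}|^2+|P_{\theta_0}|^2 .$$ In particular, if $|\mathbb{A}|\neq0$, then $\|u^{k,p_0}(t,\cdot)\|_{L^2}\simeq\mathcal{A}_n(t)$ for all $t\gg1$.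
   Context: Parameters: $b>0$, $\kappa>0$ and $\gamma_1,\gamma_2\in\mathbb{R}$ with $\gamma_1\gamma_2>0$. The unknowns are $u^{p_0}=(u^{1,p_0},\dots,u^{n,p_0}):\mathbb{R}_+\times\mathbb{R}^n\to\mathbb{R}^n$ and $\theta:\mathbb{R}_+\times\mathbb{R}^n\to\mathbb{R}$; the data are real-valued, and for $n=2,3$ the vector fields $u_0^{p_0},u_1^{p_0}$ (hence $u^{p_0}$) are rotation-free (for $n=1$ this condition is empty). The solution is the one obtained through the partial Fourier transform in $x$: for each $\xi$, $(\widehat{u}^{p_0},\widehat\theta)(t,\xi)$ solves the linear ODE system $\widehat u^{p_0}_{tt}+b^2|\xi|^2\widehat u^{p_0}+i\gamma_1\xi\widehat\theta=0$, $\widehat\theta_t+\kappa|\xi|^2\widehat\theta+i\gamma_2\,\xi\cdot\widehat u^{p_0}_t=0$ with the transformed initial data. Notation: $P_f:=\int_{\mathbb{R}^n}f(x)\,\mathrm{d}x$; $\|f\|_{L^2\cap L^1}=\|f\|_{L^2}+\|f\|_{L^1}$, and the norm of a tuple is the sum of the norms of its entries; $$\mathcal{A}_n(t):=\begin{cases}\sqrt t & n=1,\\ \sqrt{\ln t}& n=2,\\ t^{-1/4}& n=3.\end{cases}$$ $f\lesssim g$ means $f\le Cg$ with a constant $C>0$ independent of $t$ and of the initial data (it may depend on $n,b,\kappa,\gamma_1,\gamma_2$); $f\simeq g$ means $f\lesssim g$ and $g\lesssim f$ (in the last sentence of the claim, constants may depend on the data). ''For $t\gg1$'' means for all sufficiently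 large $t$; for the lower bound the threshold may depend on the initial data. *)

(* Defs.v *)
From HB Require Import structures.
From mathcomp Require Import all_boot all_order all_algebra complex.
From mathcomp Require Import all_classical all_reals all_analysis.

Set Implicit Arguments.
Unset Strict Implicit.
Unset Printing Implicit Defensive.

Import Order.TTheory GRing.Theory Num.Theory.
Import numFieldNormedType.Exports.

Local Open Scope classical_set_scope.
Local Open Scope ring_scope.
Local Open Scope complex_scope.

(* Points of R^n are n-tuples, with the product sigma-algebra. *)
Notation Rn R n := (n.-tuple (measurableTypeR R)).

Section lebesgue_Rn.
Context {R : realType}.

Definition cons_Rn n (p : measurableTypeR R * Rn R n) : Rn R n.+1 :=
  [tuple of p.1 :: p.2].

Definition uncons_Rn n (x : Rn R n.+1) : measurableTypeR R * Rn R n :=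
  (thead x, [tuple of behead x]).

Lemma measurable_cons_Rn n : measurable_fun setT (@cons_Rn n).
Proof. exact: measurable_cons. Qed.

Lemma measurable_uncons_Rn n : measurable_fun setT (@uncons_Rn n).
Proof.
apply/measurable_fun_pair; last exact: measurable_behead.
exact: measurable_tnth.
Qed.

Lemma cons_RnK n : cancel (@cons_Rn n) (@uncons_Rn n).
Proof. by move=> [a x]; rewrite /uncons_Rn; congr pair; exact/val_inj. Qed.

Variables (n : nat) (mu : {sigma_finite_measure set (Rn R n) -> \bar R}).

Definition cons_measure : set (Rn R n.+1) -> \bar R :=
  pushforward (@lebesgue_measure R \x mu)%E (@cons_Rn n).

Let cons_measure0 : cons_measure set0 = 0%E.
Proof. by rewrite /cons_measure /pushforward preimage_set0 measure0. Qed.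

Let cons_measure_ge0 A : (0 <= cons_measure A)%E.
Proof. by rewrite /cons_measure /pushforward measure_ge0. Qed.

Let cons_measure_sigma_additive : semi_sigma_additive cons_measure.
Proof.
have mf A : measurable A -> measurable (@cons_Rn n @^-1` A).
  by move=> mA; rewrite -[X in measurable X]setTI; exact: measurable_cons_Rn.
move=> F mF tF mUF; rewrite /cons_measure /pushforward preimage_bigcup.
apply: measure_semi_sigma_additive.
- by move=> k; exact: mf.
- apply/trivIsetP => /= i j _ _ ij; rewrite -preimage_setI.
  by move/trivIsetP : tF => /(_ _ _ _ _ ij) ->//; rewrite preimage_set0.
- by rewrite -preimage_bigcup; exact: mf.
Qed.

HB.instance Definition _ := isMeasure.Build _ _ _ cons_measure
  cons_measure0 cons_measure_ge0 cons_measure_sigma_additive.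

Let cons_measure_sigma_finite : sigma_finite setT cons_measure.
Proof.
have /sigma_finiteP[F [TF ndF Foo]] := sigma_finiteT (@lebesgue_measure R).
have /sigma_finiteP[G [TG ndG Goo]] := sigma_finiteT mu.
exists (fun k => @uncons_Rn n @^-1` (F k `*` G k)).
  rewrite -preimage_bigcup -(preimage_setT (@uncons_Rn n)); congr preimage.
  rewrite -setXTT TF TG; apply/seteqP; split=> -[x y] /=.
    move=> [[i _ Fix] [j _ Gjy]]; exists (maxn i j) => //; split.
      by move: x Fix; exact/subsetPset/ndF/leq_maxl.
    by move: y Gjy; exact/subsetPset/ndG/leq_maxr.
  by move=> [k _ [? ?]]; split; exists k.
move=> k; have [mF Fkoo] := Foo k; have [mG Gkoo] := Goo k; split.
  rewrite -[X in measurable X]setTI; apply: measurable_uncons_Rn => //.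
  exact: measurableX.
rewrite /cons_measure /pushforward -comp_preimage.
rewrite (_ : _ \o _ = id); last by apply/funext => p /=; rewrite cons_RnK.
by rewrite preimage_id product_measure1E// lte_mul_pinfty// ge0_fin_numE.
Qed.

HB.instance Definition _ := Measure_isSigmaFinite.Build _ _ _ cons_measure
  cons_measure_sigma_finite.

End lebesgue_Rn.

(* Lebesgue measure on R^n as an iterated product of the measure of R. *)
Fixpoint lebesgue_Rn (R : realType) n :
    {sigma_finite_measure set (Rn R n) -> \bar R} :=
  match n with
  | 0 => \d_([tuple] : Rn R 0)
  | n'.+1 => cons_measure (lebesgue_Rn R n')
  end.

Lemma lebesgue_RnS (R : realType) n (A : set (measurableTypeR R))
    (B : set (Rn R n)) : measurable A -> measurable B ->
  lebesgue_Rn R n.+1 (@uncons_Rn R n @^-1` (A `*` B)) =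
  (lebesgue_measure A * lebesgue_Rn R n B)%E.
Proof.
move=> mA mB; rewrite -product_measure1E//= /cons_measure /pushforward.
rewrite -comp_preimage (_ : _ \o _ = id) ?preimage_id//.
by apply/funext => p /=; rewrite cons_RnK.
Qed.

Section plane_waves.
Context {R : realType} (n : nat).
Local Notation leb := (lebesgue_Rn R n).
Local Notation E := (Rn R n).

Definition dotp (x y : E) : R := \sum_(j < n) tnth x j * tnth y j.

Definition enorm (x : E) : R := Num.sqrt (dotp x x).

Definition L12 (f : E -> R) : Prop := f \in Lfun leb 1 /\ f \in Lfun leb 2%:E.

Definition L2norm (f : E -> R) : \bar R := 'N[leb]_2%:E[EFin \o f].

Definition L12norm (f : E -> R) : \bar R :=
  (L2norm f + 'N[leb]_1[EFin \o f])%E.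

Definition moment (f : E -> R) : R := \int[leb]_x f x.

(* f^(xi) = \int f(x) e^{- i x.xi} dx *)
Definition fourier (f : E -> R) (xi : E) : R[i] :=
  (\int[leb]_x (f x * cos (dotp x xi)))
    -i* (\int[leb]_x (f x * sin (dotp x xi))).

Definition ball_cut (f : E -> R) (m : nat) (x : E) : R :=
  if enorm x <= m%:R then f x else 0.

(* g is the Fourier-Plancherel transform of f in L^2, i.e. the L^2-limit of the
   Fourier integrals of f over the balls |x| <= m (which lie in L^1). *)
Definition is_fourier_L2 (f : E -> R) (g : E -> R[i]) : Prop :=
  [/\ f \in Lfun leb 2%:E,
      measurable_fun setT (fun xi => complex.Re (g xi) : R),
      measurable_fun setT (fun xi => complex.Im (g xi) : R) &
      (fun m : nat => \int[leb]_xi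
          (complex.Re (g xi - fourier (ball_cut f m) xi) ^+ 2
           + complex.Im (g xi - fourier (ball_cut f m) xi) ^+ 2)%:E)%E
        @ \oo --> 0%E].

Fixpoint iter_partial (s : seq 'I_n) (phi : 'rV[R]_n -> R) : 'rV[R]_n -> R :=
  if s is j :: s' then 'D_(delta_mx 0 j) (iter_partial s' phi) else phi.

Definition test_function (phi : 'rV[R]_n -> R) : Prop :=
  (forall (s : seq 'I_n) x, differentiable (iter_partial s phi) x) /\
  (exists M : R, forall x, M < `|x| -> phi x = 0).

Definition rV_of_Rn (x : E) : 'rV[R]_n := \row_j tnth x j.

(* rot w = 0 in the sense of distributions: d_i w_j = d_j w_i for all i, j;
   void for n = 1 *)
Definition rotation_free (w : 'I_n -> E -> R) : Prop :=
  forall (i j : 'I_n) (phi : 'rV[R]_n -> R), test_function phi ->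
    \int[leb]_x (w j x * 'D_(delta_mx 0 i) phi (rV_of_Rn x)) =
    \int[leb]_x (w i x * 'D_(delta_mx 0 j) phi (rV_of_Rn x)).

Record admissible_data (u0 u1 : 'I_n -> E -> R) (theta0 : E -> R) : Prop := {
  data_u0 : forall k, L12 (u0 k) ;
  data_u1 : forall k, L12 (u1 k) ;
  data_theta0 : L12 theta0 ;
  data_rot_u0 : rotation_free u0 ;
  data_rot_u1 : rotation_free u1 }.

Definition is_cderive (f : R -> R[i]) (t : R) (l : R[i]) : Prop :=
  is_derive t 1 (fun s => complex.Re (f s)) (complex.Re l) /\
  is_derive t 1 (fun s => complex.Im (f s)) (complex.Im l).

Definition continuous_Rplus (f : R -> R[i]) : Prop :=
  {within `[0, +oo[, continuous (fun s => complex.Re (f s))} /\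
  {within `[0, +oo[, continuous (fun s => complex.Im (f s))}.

(* (uh, th) solves at frequency xi, on t > 0,
     uh_tt + b^2 |xi|^2 uh + i gamma1 xi th = 0,
     th_t + kappa |xi|^2 th + i gamma2 xi . uh_t = 0,
   where vh = uh_t; uh, uh_t, th are continuous up to t = 0 and take there the
   initial values uh0, uh1, th0. *)
Definition fourier_ode (b kappa gamma1 gamma2 : R) (xi : E)
    (uh0 uh1 : 'I_n -> R[i]) (th0 : R[i])
    (uh : R -> 'I_n -> R[i]) (th : R -> R[i]) : Prop :=
  exists vh : R -> 'I_n -> R[i],
  [/\ forall j, [/\ continuous_Rplus (uh ^~ j), continuous_Rplus (vh ^~ j),
                    uh 0 j = uh0 j & vh 0 j = uh1 j],
      continuous_Rplus th, th 0 = th0,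
      forall (t : R) j, 0 < t ->
        is_cderive (uh ^~ j) t (vh t j) /\
        is_cderive (vh ^~ j) t
          (- (b ^+ 2 * enorm xi ^+ 2)%:C * uh t j
           - 'i%C * (gamma1 * tnth xi j)%:C * th t) &
      forall t : R, 0 < t ->
        is_cderive th t
          (- (kappa * enorm xi ^+ 2)%:C * th t
           - 'i%C * gamma2%:C * \sum_(j < n) (tnth xi j)%:C * vh t j)].

(* The values of uh, th at each xi are fixed by the pointwise Fourier integrals
   of the L^1 data; u t j, theta t are then determined up to null sets. *)
Definition fourier_solution (b kappa gamma1 gamma2 : R)
    (u0 u1 : 'I_n -> E -> R) (theta0 : E -> R)
    (u : R -> 'I_n -> E -> R) (theta : R -> E -> R) : Prop :=
  exists (uh : R -> 'I_n -> E -> R[i]) (th : R -> E -> R[i]),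
  [/\ forall xi, fourier_ode b kappa gamma1 gamma2 xi
        (fun j => fourier (u0 j) xi) (fun j => fourier (u1 j) xi)
        (fourier theta0 xi) (fun t j => uh t j xi) (fun t => th t xi),
      forall t j, 0 <= t -> is_fourier_L2 (u t j) (uh t j) &
      forall t, 0 <= t -> is_fourier_L2 (theta t) (th t)].

(* only meant for n = 1, 2, 3 *)
Definition growth (t : R) : R :=
  match n with
  | 1 => Num.sqrt t
  | 2 => Num.sqrt (ln t)
  | 3 => t `^ (- 4%:R^-1)
  | _ => 0
  end.

Definition AA (u1k theta0 : E -> R) : R :=
  Num.sqrt (`|moment u1k| ^+ 2 + `|moment theta0| ^+ 2).

End plane_waves.

(* Main.v *)
(* In Fourier variables rot u = 0 means that u^ is parallel to xi, and this
   persists in time; so w = u^_k, v = w' and G = i gamma1 xi_k theta^ solve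
     w' = v,  v' = - b^2 r^2 w - G,  G' = - kappa r^2 G + gamma r^2 v,
   with r = |xi| and gamma = gamma1 gamma2.

   Upper bound: the energy v^2 + b^2 r^2 w^2 + G^2 / (gamma r^2) decays like
   exp (- c t r^2 / (1 + r^2)) by a Lyapunov functional, and |w| grows at most
   linearly in t.  For r <= 1 both facts give
     |w|^2 <= C (|u0^|^2 + |u1^|^2 + |theta0^|^2) sum_(2^j <= t) s_j exp (- c s_j r^2)
   with s_j = 2^j t; the Fourier transforms of the data are bounded by L^1 norms,
   and the Gaussian integrals s_j^(1 - n/2) add up to the square of the growth
   rate.  For r >= 1 the decay is exponential and L^2 norms of the data suffice.

   Lower bound: where r^2 t is small, dissipation is negligible and w is close to
     - G(0) (1 - cos (beta r t)) / (beta r)^2 + v(0) sin (beta r t) / (beta r),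
   beta^2 = b^2 + gamma.  Near xi = 0 the data are close to their moments, so the
   real part of w carries P_u1 and its imaginary part P_theta0.  On the part of a
   cone around the diagonal where beta r t lies in one of the about sqrt t windows
   2 pi j + [pi / 2, 3 pi / 4] one gets |w| >= c |A| / r, and integrating over
   these shells gives the growth rate.

   Plancherel's theorem is needed in the form ||f^||^2 <= (2 pi)^n ||f||^2 and, up
   to a constant, conversely; it is proved for bounded functions of bounded support
   by induction on n, the case n = 1 resting on the Poisson kernel. *)

Require Import Defs.
From mathcomp Require Import all_boot all_order all_algebra complex.
From mathcomp Require Import all_classical all_reals all_analysis.
From mathcomp Require Import measurable_realfun ring lra.

Set Implicit Arguments.
Unset Strict Implicit.
Unset Printing Implicit Defensive.

Import Order.TTheory GRing.Theory Num.Theory.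
Import numFieldNormedType.Exports.

Local Open Scope classical_set_scope.
Local Open Scope ring_scope.

(** * Plancherel's theorem *)

(** No polar coordinates are used. With r = |xi|, the pointwise bound min(t^2, r^-2) exp(-c t r^2)
    is traded for a sum of Gaussians, whose integrals factor over the coordinates; from below, the
    integral of r^-2 is replaced by a sum over shells of a cone, whose volumes follow from scaling.
    The growth rates then come from elementary sums: above, a geometric sum led by its last term (n
    = 1), equal terms (n = 2), a geometric sum led by its first term (n = 3); below, the first shell
    alone, a harmonic sum, equal terms.

    The two moments are arbitrary and might cancel each other. They do not, because the factor i in
    the coupling i gamma1 xi_k theta^ separates them. One phase window serves both parts of w: there
    sin >= 1/2 preserves the velocity term, and cos <= 0 gives 1 - cos >= 1 in the temperature term.

    Plancherel's identity is exact for bounded functions of bounded support. Beyond them constant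
    factors are given away through (a + b)^2 <= 2 a^2 + 2 b^2, which remains meaningful when
    integrals are infinite. *)

Section real_integrals.
Context d (T : measurableType d) (R : realType) (mu : {measure set T -> \bar R}).
Implicit Types f g h : T -> R.

Lemma integrable_dominated f g : measurable_fun setT f ->
  mu.-integrable setT (EFin \o g) -> (forall x, `|f x| <= g x) ->
  mu.-integrable setT (EFin \o f).
Proof.
move=> mf ig fg; apply: le_integrable ig => //; first exact/measurable_EFinP.
move=> x _ /=; rewrite lee_fin; apply: le_trans (fg x) _; exact: ler_norm.
Qed.

Lemma integrable_scale (k : R) f : mu.-integrable setT (EFin \o f) ->
  mu.-integrable setT (EFin \o (fun x => k * f x)).
Proof. exact: integrableZl. Qed.

Lemma EFin_Rintegral f : mu.-integrable setT (EFin \o f) ->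
  (\int[mu]_x f x)%:E = (\int[mu]_x (f x)%:E)%E.
Proof. by move=> fi; rewrite /Rintegral fineK//; exact: integrable_fin_num. Qed.

Lemma cvg_Rintegral (f_ : nat -> T -> R) f g :
  (forall n, measurable_fun setT (f_ n)) -> measurable_fun setT f ->
  (forall x, f_ ^~ x @ \oo --> f x) ->
  mu.-integrable setT (EFin \o g) -> (forall n x, `|f_ n x| <= g x) ->
  (fun n => \int[mu]_x f_ n x) @ \oo --> \int[mu]_x f x.
Proof.
move=> mf_ mf f_f ig fg.
have [||||if_ _ +] := @dominated_convergence _ _ _ mu setT measurableT
  (fun n => EFin \o f_ n) (EFin \o f) (EFin \o g) _ _ _ ig.
- by move=> n; exact/measurable_EFinP.
- exact/measurable_EFinP.
- by apply: aeW => x _; apply: cvg_EFin; [exact: nearW|exact: f_f].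
- by apply: aeW => x n _ /=; rewrite lee_fin.
move=> cv.
apply: fine_cvg; rewrite fineK//; exact: integrable_fin_num.
Qed.

Lemma le_Rintegral_dom f g : measurable_fun setT f ->
  mu.-integrable setT (EFin \o g) -> (forall x, `|f x| <= g x) ->
  `|\int[mu]_x f x| <= \int[mu]_x g x.
Proof.
move=> mf ig fg; have jf := integrable_dominated mf ig fg.
apply: le_trans (le_normr_Rintegral _ jf) _ => //.
apply: le_Rintegral => //.
by move: (integrable_norm jf).
Qed.

End real_integrals.

(** Tonelli's theorem gives measurability for the positive and the negative part; subtracting in the
    extended reals covers sections that are not integrable. *)
Lemma measurable_Rintegral d1 d2 (T1 : measurableType d1) (T2 : measurableType d2)
    (R : realType) (m2 : {sigma_finite_measure set T2 -> \bar R}) (F : T1 * T2 -> R) :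
  measurable_fun setT F -> measurable_fun setT (fun x => \int[m2]_y F (x, y)).
Proof.
move=> mF; apply: measurableT_comp => //.
rewrite (_ : (fun x => _) = fun x => \int[m2]_y ((EFin \o F)^\+ (x, y)) -
    \int[m2]_y ((EFin \o F)^\- (x, y)))%E; last first.
  apply/funext => x; rewrite integralE.
  by congr (_ - _)%E; apply: eq_integral => y _; rewrite !(funeposE, funenegE).
apply: emeasurable_funB.
- apply: (measurable_fun_fubini_tonelli_F (m2 := m2) ((EFin \o F)^\+)%E) => //.
  by apply: measurable_funepos; exact/measurable_EFinP.
- apply: (measurable_fun_fubini_tonelli_F (m2 := m2) ((EFin \o F)^\-)%E) => //.
  by apply: measurable_funeneg; exact/measurable_EFinP.
Qed.

Section product_integrals.
Context d1 d2 (T1 : measurableType d1) (T2 : measurableType d2) (R : realType).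
Variable m1 : {sigma_finite_measure set T1 -> \bar R}.
Variable m2 : {sigma_finite_measure set T2 -> \bar R}.
Variables (F : T1 * T2 -> R) (a : T1 -> R) (b : T2 -> R).
Hypothesis mF : measurable_fun setT F.
Hypothesis ia : m1.-integrable setT (EFin \o a).
Hypothesis ib : m2.-integrable setT (EFin \o b).
Hypothesis Fab : forall x y, `|F (x, y)| <= a x * b y.

Lemma measurable_section1 x : measurable_fun setT (fun y => F (x, y)).
Proof. exact: measurableT_comp. Qed.

Lemma measurable_section2 y : measurable_fun setT (fun x => F (x, y)).
Proof. exact: measurableT_comp. Qed.

Lemma integrable_section1 x : m2.-integrable setT (EFin \o (fun y => F (x, y))).
Proof.
apply: (integrable_dominated (g := fun y => a x * b y)) => //.
- exact: measurable_section1.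
- exact: (integrableZl measurableT (a x) ib).
Qed.

Lemma integrable_section2 y : m1.-integrable setT (EFin \o (fun x => F (x, y))).
Proof.
apply: (integrable_dominated (g := fun x => a x * b y)) => //.
- exact: measurable_section2.
- rewrite (_ : (fun x => _) = (fun x => b y * a x)).
    exact: (integrableZl measurableT (b y) ia).
  by apply/funext => x; rewrite mulrC.
Qed.

Lemma integrable_product : (m1 \x m2)%E.-integrable setT (EFin \o F).
Proof.
apply/integrable12ltyP; first exact/measurable_EFinP.
apply: (@le_lt_trans _ _ (\int[m1]_x `|a x|%:E * \int[m2]_y `|b y|%:E)%E).
  rewrite -ge0_integralZr//; last first.
    by apply: integral_ge0 => y _; rewrite lee_fin.
    by apply/measurable_EFinP/measurableT_comp => //; apply/measurable_EFinP; case/integrableP: ia.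
  apply: ge0_le_integral => //.
  - by move=> x _; apply: integral_ge0.
  - apply: (@measurable_fun_fubini_tonelli_F _ _ _ _ _ m2 (fun z => `|(F z)%:E|%E)) => //.
    by apply: measurableT_comp => //; exact/measurable_EFinP.
  - apply: emeasurable_funM => //.
    by apply/measurable_EFinP/measurableT_comp => //; apply/measurable_EFinP; case/integrableP: ia.
  - move=> x _; rewrite -ge0_integralZl//; last first.
      by apply/measurable_EFinP/measurableT_comp => //; apply/measurable_EFinP; case/integrableP: ib.
    apply: ge0_le_integral => //.
    + by apply: measurableT_comp => //; apply/measurable_EFinP; exact: measurable_section1.
    + apply: emeasurable_funM => //.
      by apply/measurable_EFinP/measurableT_comp => //; apply/measurable_EFinP; case/integrableP: ib.
    + move=> y _; rewrite -EFinM -normrM lee_fin.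
      by apply: le_trans (Fab x y) _; exact: ler_norm.
apply: lte_mul_pinfty.
- by apply: integral_ge0 => y _; rewrite lee_fin.
- by rewrite ge0_fin_numE; [case/integrableP: ia|apply: integral_ge0 => y _; rewrite lee_fin].
- by case/integrableP: ib.
Qed.

(** The product majorant makes every section integrable, not just almost every one, so the inner
    integrals are genuine real numbers at each point. *)
Lemma Rintegral_Fubini :
  \int[m1]_x \int[m2]_y F (x, y) = \int[m2]_y \int[m1]_x F (x, y).
Proof.
congr fine.
rewrite (eq_integral (fun x => \int[m2]_y (F (x, y))%:E)%E); last first.
  by move=> x _; rewrite EFin_Rintegral//; exact: integrable_section1.
rewrite [RHS](eq_integral (fun y => \int[m1]_x (F (x, y))%:E)%E); last first.
  by move=> y _; rewrite EFin_Rintegral//; exact: integrable_section2.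
exact: (@Fubini _ _ _ _ _ m1 m2 _ integrable_product).
Qed.

Lemma Rintegral_product :
  \int[(m1 \x m2)%E]_z F z = \int[m1]_x \int[m2]_y F (x, y).
Proof.
congr fine.
rewrite [RHS](eq_integral (fun x => \int[m2]_y (F (x, y))%:E)%E); last first.
  by move=> x _; rewrite EFin_Rintegral//; exact: integrable_section1.
by rewrite (@integral12_prod_meas1 _ _ _ _ _ m1 m2 _ integrable_product).
Qed.

End product_integrals.

Lemma is_derive_continuous {R : realType} (f : R -> R) (x l : R) {H : is_derive x 1 f l} :
  {for x, continuous f}.
Proof. by apply: differentiable_continuous; apply/derivable1_diffP; case: H. Qed.

(** * Affine substitution and explicit integrals on the line *)

Section lebesgue_line.
Context {R : realType}.
Local Notation mu := (@lebesgue_measure R).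

(** By uniqueness of Lebesgue measure: [a] times its image under the affine map gives half-open
    intervals their length. *)
Lemma lebesgue_measure_affine (a b : R) (A : set (measurableTypeR R)) : 0 < a -> measurable A ->
  mu ((fun x => a * x + b) @^-1` A) = (a^-1%:E * mu A)%E.
Proof.
move=> a0 mA; pose phi (x : measurableTypeR R) : measurableTypeR R := a * x + b.
have mphi : measurable_fun setT phi.
  by apply: measurable_funD => //; exact: measurable_funM.
pose nu := [the measure _ _ of mscale (NngNum (ltW a0)) (measure_function_pushforward__canonical__measure_function_Measure mu mphi)].
rewrite (_ : mu A = nu A); last first.
  apply: lebesgue_measure_unique mA => _ [[x y] /= _ <-].
  rewrite /nu /= /mscale /= /pushforward.
  rewrite (_ : phi @^-1` _ = `](x - b) / a, (y - b) / a]%classic); last first.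
    apply/seteqP; split => z /=; rewrite /phi !in_itv /= ltr_pdivrMr// ler_pdivlMr//.
      by rewrite ltrBlDr lerBrDr mulrC.
    by rewrite ltrBlDr lerBrDr mulrC.
  rewrite !lebesgue_measure_itv /= !lte_fin.
  rewrite ltr_pM2r ?invr_gt0// ltrD2r; case: ifPn => xy; last by rewrite mule0.
  by rewrite -!EFinB -EFinM; congr EFin; field; rewrite gt_eqF.
by rewrite /nu /= /mscale /= muleA -EFinM mulVf ?gt_eqF// mul1e.
Qed.

Lemma ge0_integral_affine (a b : R) (f : measurableTypeR R -> \bar R) : 0 < a ->
  measurable_fun setT f -> (forall x, 0 <= f x)%E ->
  (\int[mu]_x f (a * x + b)%R = (a^-1)%:E * \int[mu]_x f x)%E.
Proof.
move=> a0 mf f0; pose phi (x : measurableTypeR R) : measurableTypeR R := a * x + b.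
have mphi : measurable_fun setT phi.
  by apply: measurable_funD => //; exact: measurable_funM.
have := @ge0_integral_pushforward _ _ _ _ R phi mphi mu setT f measurableT mf (fun x _ => f0 x).
rewrite preimage_setT => /= <-.
have ai : 0 <= a^-1 by rewrite invr_ge0 ltW.
rewrite -(@ge0_integral_mscale _ _ _ mu setT measurableT (NngNum ai) f)//.
apply: eq_measure_integral => //= A mA _.
by rewrite /pushforward lebesgue_measure_affine.
Qed.

Lemma Rintegral_affine (a b : R) (f : measurableTypeR R -> R) : 0 < a ->
  mu.-integrable setT (EFin \o f) ->
  \int[mu]_x f (a * x + b) = a^-1 * \int[mu]_x f x.
Proof.
move=> a0 fi; have /measurable_EFinP mf := measurable_int _ fi.
rewrite /Rintegral integralE.
transitivity (fine (\int[mu]_x (EFin \o f)^\+ (a * x + b)%R -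
  \int[mu]_x (EFin \o f)^\- (a * x + b)%R)%E).
  by congr (fine (_ - _)%E); apply: eq_integral => x _; rewrite !(funeposE, funenegE).
rewrite !ge0_integral_affine//; last 2 first.
- exact/measurable_funeneg/measurable_EFinP.
- exact/measurable_funepos/measurable_EFinP.
rewrite [in RHS]integralE.
have [p [n [-> ->]]] : exists p n : R, (\int[mu]_x (EFin \o f)^\+ x = p%:E)%E /\
   (\int[mu]_x (EFin \o f)^\- x = n%:E)%E.
  exists (fine (\int[mu]_x (EFin \o f)^\+ x)%E), (fine (\int[mu]_x (EFin \o f)^\- x)%E).
  by split; rewrite fineK//; apply: integrable_fin_num => //; [exact: integrable_funepos|exact: integrable_funeneg].
by rewrite /= mulrBr.
Qed.

Lemma ge0_integral_fold (f : R -> \bar R) : measurable_fun setT f ->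
  (forall x, 0 <= f x)%E ->
  (\int[mu]_x f x = \int[mu]_(x in `[0%R, +oo[) (f x + f (- x)%R))%E.
Proof.
move=> mf f0.
have mfN : measurable_fun setT (fun x : R => f (- x)).
  by apply: measurableT_comp => //; exact: oppr_measurable.
rewrite ge0_integralD//; last 2 first.
- exact: measurable_funS mf.
- exact: measurable_funS mfN.
rewrite (@ge0_integration_by_substitution0 _ (fun x : R => f (- x)%R))//.
under [X in (_ + X)%E]eq_integral do rewrite opprK.
rewrite -(setUv `[0%R, +oo[%classic) ge0_integral_setU//; last 2 first.
- by rewrite setUv.
- by apply/disj_setPCl.
congr (_ + _)%E; rewrite setCitvr.
  by apply: integral_itv_bndo_bndc; exact: measurable_funS mf.
by apply: measurableC; exact: measurable_itv.
Qed.

(** The damping factor lives on a half-line because the power spectrum of a real function is even;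
    its cosine transform is the Poisson kernel. *)
Definition onesided_exp (e x : R) : R := if 0 <= x then expR (- (e * x)) else 0.

Lemma onesided_exp_ge0 e x : 0 <= onesided_exp e x.
Proof. by rewrite /onesided_exp; case: ifP => // _; exact: expR_ge0. Qed.

Lemma measurable_onesided_exp e : measurable_fun setT (onesided_exp e).
Proof.
apply: measurable_fun_if => //.
- by apply: measurable_fun_ler.
- by apply: measurable_funTS; apply: measurableT_comp => //; apply: measurableT_comp => //; exact: measurable_funM.
Qed.

(** The summand 1 makes the integrand nonnegative, as the improper fundamental theorem of calculus
    used here requires; it is subtracted again in [Rintegral_onesided_exp_cos]. *)
Lemma integral_onesided_exp1Dcos (e z : R) : 0 < e ->
  (\int[mu]_x (onesided_exp e x * (1 + cos (z * x)))%:E = (e^-1 + e / (e ^+ 2 + z ^+ 2))%:E)%E.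
Proof.
move=> e0; have ez0 : e ^+ 2 + z ^+ 2 != 0.
  by rewrite gt_eqF// ltr_wpDr ?sqr_ge0// exprn_gt0.
transitivity (\int[mu]_(x in `[0%R, +oo[) (expR (- (e * x)) * (1 + cos (z * x)))%:E)%E.
  rewrite [RHS]integral_mkcond; apply: eq_integral => x _.
  rewrite /onesided_exp patchE mem_setE in_itv /= andbT.
  by case: ifP => // _; rewrite mul0r.
(* An antiderivative that tends to 0 at infinity, so that the integral is - F 0. *)
pose F (x : R) : R := - expR (- (e * x)) * e^-1 + expR (- (e * x)) *
   (z * sin (z * x) - e * cos (z * x)) / (e ^+ 2 + z ^+ 2).
have dF (x : R) : is_derive x 1 F (expR (- (e * x)) * (1 + cos (z * x))).
  apply: is_derive_eq; rewrite /GRing.scale /=; field.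
  by rewrite ez0 gt_eqF.
have cF : continuous F.
  by move=> x; apply: differentiable_continuous; apply/derivable1_diffP; case: (dF x).
rewrite (@ge0_continuous_FTC2y _ (fun x => expR (- (e * x)) * (1 + cos (z * x))) F 0 0)//.
- rewrite -EFinB; congr EFin; rewrite /F !mulr0 oppr0 expR0 sin0 cos0 mulr0; field.
  by rewrite ez0 gt_eqF.
- apply: continuous_subspaceT => x.
  by apply: is_derive_continuous.
- have c0 : (expR (- (e * x)) @[x --> +oo]) --> (0 : R).
    apply: (cvg_comp (fun x => e * x) (fun y => expR (- y))); last exact: cvgr_expR.
    exact: gt0_cvgMry.
  pose K : R := e^-1 + (`|z| + e) / (e ^+ 2 + z ^+ 2).
  have cK : (K * expR (- (e * x)) @[x --> +oo]) --> (0 : R).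
    by rewrite -(mulr0 K); apply: cvgM => //; exact: cvg_cst.
  apply: norm_cvg0; apply: squeeze_cvgr (cvg_cst 0) cK.
  apply: nearW => x; rewrite normr_ge0 /=.
  have -> : F x = expR (- (e * x)) * (- e^-1 + (z * sin (z * x) - e * cos (z * x)) / (e ^+ 2 + z ^+ 2)).
    by rewrite /F; ring.
  rewrite normrM ger0_norm ?expR_ge0// mulrC ler_wpM2r ?expR_ge0//.
  apply: le_trans (ler_normD _ _) _; apply: lerD.
    by rewrite normrN ger0_norm// invr_ge0 ltW.
  have p0 : 0 < e ^+ 2 + z ^+ 2 by rewrite ltr_wpDr ?sqr_ge0// exprn_gt0.
  rewrite normrM normfV (gtr0_norm p0) ler_pM2r ?invr_gt0//.
  apply: le_trans (ler_normB _ _) _; rewrite !normrM (gtr0_norm e0); apply: lerD.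
    by rewrite ler_piMr// sin_max.
  by rewrite ler_piMr ?cos_max// ltW.
- by apply: cvg_at_right_filter; exact: cF.
- by move=> x _; rewrite derive1E; apply: derive_val.
Qed.

Lemma measurable_cosM (z : R) : measurable_fun setT (fun x : R => cos (z * x)).
Proof.
apply: measurableT_comp; last exact: measurable_funM.
by apply: continuous_measurable_fun; exact: continuous_cos.
Qed.

Lemma integrable_onesided_exp (e : R) : 0 < e -> mu.-integrable setT (EFin \o onesided_exp e).
Proof.
move=> e0; apply/integrableP; split.
  by apply/measurable_EFinP; exact: measurable_onesided_exp.
apply: (@le_lt_trans _ _ (\int[mu]_x (onesided_exp e x * (1 + cos (0 * x)))%:E)%E); last first.
  by rewrite integral_onesided_exp1Dcos// ltry.
apply: ge0_le_integral => //.
- by apply/measurable_EFinP; apply: measurableT_comp => //; exact: measurable_onesided_exp.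
- apply/measurable_EFinP; apply: measurable_funM; first exact: measurable_onesided_exp.
  by apply: measurable_funD => //; exact: measurable_cosM.
- move=> x _ /=; rewrite lee_fin mul0r cos0 ger0_norm ?onesided_exp_ge0//.
  by have := onesided_exp_ge0 e x; lra.
Qed.

Lemma integrable_onesided_expM (e : R) (f : R -> R) : 0 < e -> measurable_fun setT f ->
  (forall x, `|f x| <= 2) -> mu.-integrable setT (EFin \o (fun x => onesided_exp e x * f x)).
Proof.
move=> e0 mf f2; apply: (@integrable_dominated _ (measurableTypeR R) R mu _ (fun x => 2 * onesided_exp e x)).
- by apply: measurable_funM => //; exact: measurable_onesided_exp.
- exact: (integrableZl measurableT 2 (integrable_onesided_exp e0)).
- move=> x; rewrite normrM (ger0_norm (onesided_exp_ge0 _ _)) mulrC.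
  by rewrite ler_wpM2r// onesided_exp_ge0.
Qed.

Lemma Rintegral_onesided_exp_cos (e z : R) : 0 < e ->
  \int[mu]_x (onesided_exp e x * cos (z * x)) = e / (e ^+ 2 + z ^+ 2).
Proof.
move=> e0.
have i1D y : mu.-integrable setT (EFin \o (fun x => onesided_exp e x * (1 + cos (y * x)))).
  apply: integrable_onesided_expM => //.
    by apply: measurable_funD => //; exact: measurable_cosM.
  by move=> x; apply: le_trans (ler_normD _ _) _; rewrite normr1; have := cos_max (y * x); lra.
have v1D y : \int[mu]_x (onesided_exp e x * (1 + cos (y * x))) = e^-1 + e / (e ^+ 2 + y ^+ 2).
  by rewrite /Rintegral integral_onesided_exp1Dcos.
(* At frequency 0 the factor 1 + cos equals 2, so half of that case is the integral of
   [onesided_exp] itself. *)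
transitivity (\int[mu]_x (onesided_exp e x * (1 + cos (z * x)) -
   2^-1 * (onesided_exp e x * (1 + cos (0 * x))))).
  by apply: eq_Rintegral => x _; rewrite mul0r cos0; field.
rewrite RintegralB//; last exact: (integrableZl measurableT 2^-1 (i1D 0)).
rewrite RintegralZl// !v1D; field.
rewrite gt_eqF/=; last by rewrite ltr_wpDr ?sqr_ge0// exprn_gt0.
by rewrite gt_eqF.
Qed.

(** The Poisson kernel e / (e^2 + y^2) after the substitution y = e z, up to its mass pi. *)
Definition cauchy_kernel (z : R) : R := (1 + z ^+ 2)^-1.

Lemma cauchy_kernel_ge0 z : 0 <= cauchy_kernel z.
Proof. by rewrite invr_ge0 addr_ge0// sqr_ge0. Qed.

Lemma measurable_cauchy_kernel : measurable_fun setT cauchy_kernel.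
Proof.
by apply: continuous_measurable_fun; exact: continuous_oneDsqrV.
Qed.

Lemma integral_cauchy_kernel : (\int[mu]_z (cauchy_kernel z)%:E)%E = (pi : R)%:E.
Proof.
rewrite ge0_integral_fold//; last 2 first.
- by apply/measurable_EFinP; exact: measurable_cauchy_kernel.
- by move=> x; rewrite lee_fin cauchy_kernel_ge0.
transitivity (\int[mu]_(x in `[0%R, +oo[) ((2:R)%:E * (oneDsqr x)^-1%:E))%E.
  apply: eq_integral => x _; rewrite -EFinD -EFinM; congr EFin.
  by rewrite /cauchy_kernel sqrrN /oneDsqr mulr2n mulrDl mul1r.
rewrite ge0_integralZl//; last first.
  apply/measurable_EFinP; apply: measurable_funTS.
  by apply: continuous_measurable_fun; exact: continuous_oneDsqrV.
by rewrite integral0y_oneDsqr -EFinM; congr EFin; field.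
Qed.

Lemma integrable_cauchy_kernel : mu.-integrable setT (EFin \o cauchy_kernel).
Proof.
apply/integrableP; split; first by apply/measurable_EFinP; exact: measurable_cauchy_kernel.
rewrite (_ : integral _ _ _ = \int[mu]_z (cauchy_kernel z)%:E)%E.
  by rewrite integral_cauchy_kernel ltry.
by apply: eq_integral => x _ /=; rewrite ger0_norm// cauchy_kernel_ge0.
Qed.

Lemma integrable_affine (a b : R) (f : R -> R) : 0 < a ->
  mu.-integrable setT (EFin \o f) -> mu.-integrable setT (EFin \o (fun x => f (a * x + b))).
Proof.
move=> a0 fi; have /measurable_EFinP mf := measurable_int _ fi.
apply/integrableP; split.
  apply/measurable_EFinP; apply: measurableT_comp => //.
  by apply: measurable_funD => //; exact: measurable_funM.
have := @ge0_integral_affine a b (fun x => `|(f x)%:E|)%E a0 => /= ->//.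
- by apply: lte_mul_pinfty; rewrite ?lee_fin ?invr_ge0 ?ltW//; case/integrableP: fi.
- by apply/measurable_EFinP; exact: measurableT_comp.
Qed.

Definition band (M x : R) : R := if `|x| <= M then 1 else 0.

Lemma band_ge0 M x : 0 <= band M x. Proof. by rewrite /band; case: ifP. Qed.

Lemma measurable_band M : measurable_fun setT (band M).
Proof.
apply: measurable_fun_if => //; exact: measurable_fun_ler.
Qed.

Lemma integrable_band M : mu.-integrable setT (EFin \o band M).
Proof.
rewrite (_ : band M = \1_(`[- M, M]%classic)); last first.
  by apply/funext => x; rewrite indicE /band mem_setE in_itv /= ler_norml; case: ifP.
exact: integrable_indic_itv.
Qed.

End lebesgue_line.

(** * Continuity of the autocorrelation at shift 0 *)

Section autocorrelation.
Context {R : realType}.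
Local Notation mu := (@lebesgue_measure R).

Lemma le_integrable_band (f : R -> R) (C M : R) : measurable_fun setT f ->
  (forall x, `|f x| <= C * band M x) -> mu.-integrable setT (EFin \o f).
Proof.
move=> mf fC; apply: (@integrable_dominated _ (measurableTypeR R) R mu _ (fun x => C * band M x)) => //.
exact: (integrableZl measurableT C (integrable_band M)).
Qed.

Lemma band1 (M x : R) : `|x| <= M -> band M x = 1.
Proof. by rewrite /band => ->. Qed.

Lemma band0 (M x : R) : M < `|x| -> band M x = 0.
Proof. by rewrite /band ltNge; case: ifP. Qed.

Lemma ler_band (C M x : R) : 0 < C -> C * band M x <= C.
Proof. by move=> C0; rewrite /band; case: ifP => _; rewrite ?mulr1 ?mulr0// ltW. Qed.

(** Clipping to [-C, C] moves [y] closer to every point of that interval. It gives the continuous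
    approximants below the sup bound of the function they approximate. *)
Lemma ler_norm_clip (a C y : R) : `|a| <= C ->
  `|a - Num.max (- C) (Num.min C y)| <= `|a - y|.
Proof.
rewrite ler_norml => /andP[h1 h2].
have C0 : - C <= C by apply: le_trans h1 _.
have [yC|Cy] := leP y C; last first.
  rewrite max_r// ler0_norm ?subr_le0// ler0_norm ?subr_le0; last exact: le_trans (ltW Cy).
  by rewrite lerN2 lerD2l lerN2 ltW.
have [Cy|yC'] := leP y (- C); last by rewrite lexx.
rewrite ger0_norm ?subr_ge0// ger0_norm ?subr_ge0; last exact: le_trans h1.
by rewrite lerD2l lerN2.
Qed.

(** Density of continuous functions in L^1, followed by clipping. The interval exceeds the support
    by 1 so that translations by at most 1 stay inside it. *)
Lemma continuous_approx (f : R -> R) (C M e : R) : 0 < e -> 0 < C -> measurable_fun setT f ->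
  (forall x, `|f x| <= C * band M x) ->
  exists g : R -> R, [/\ continuous g, forall x, `|g x| <= C &
    \int[mu]_x (`|f x - g x| * band (M + 1) x) < e].
Proof.
move=> e0 C0 mf fC; pose E := `[- (M + 1), M + 1]%classic : set R.
have muE : (mu E < +oo)%E.
  by rewrite lebesgue_measure_itv /=; case: ifP => // _; rewrite -EFinB ltry.
have [|g_ [cg ig /fine_cvgP[_ /cvgrPdist_lt/(_ e e0)[k _ /(_ k (leqnn k))]]]] :=
    @approximation_continuous_integrable R E f (measurable_itv _) muE.
  apply: integrableS (le_integrable_band mf fC) => //; exact: measurable_itv.
rewrite /= sub0r normrN => gk.
pose g x := Num.max (- C) (Num.min C (g_ k x)).
have cg' : continuous g.
  move=> x; apply: (@continuous_max R R (cst (- C)) (fun x => Num.min C (g_ k x))).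
    exact: cst_continuous.
  by apply: (@continuous_min R R (cst C) (g_ k)); [exact: cst_continuous|exact: cg].
exists g; split => //.
  by move=> x; rewrite ler_norml /g le_max lexx ge_max ge_min lexx; lra.
apply: le_lt_trans gk; rewrite ger0_norm; last first.
  by apply: fine_ge0; apply: integral_ge0 => x _; rewrite lee_fin.
rewrite [leRHS](_ : _ = \int[mu]_(x in E) `|f x - g_ k x|)//.
rewrite [leRHS]Rintegral_mkcond.
have mg_ := continuous_measurable_fun (cg k).
have iE : mu.-integrable setT (EFin \o (fun x => `|f x - g_ k x|) \_ E).
  rewrite -restrict_EFin; apply/integrable_restrict => //; first exact: measurable_itv.
  rewrite setTI; apply: integrable_norm.
  have iEf : mu.-integrable E (EFin \o f).
    by apply: integrableS (le_integrable_band mf fC) => //; exact: measurable_itv.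
  have mE : measurable (E : set (measurableTypeR R)) by exact: measurable_itv.
  exact: (integrableB mE iEf (ig k)).
apply: le_Rintegral => //.
  apply: (@integrable_dominated _ (measurableTypeR R) R mu _ _ _ iE).
    apply: measurable_funM; last exact: measurable_band.
    by apply: measurableT_comp => //; apply: measurable_funB => //; exact: continuous_measurable_fun.
  move=> x; rewrite /band patchE mem_setE in_itv /= -ler_norml.
  case: ifP => xM; last by rewrite mulr0 normr0.
  rewrite mulr1 normr_id; apply: ler_norm_clip.
  by apply: le_trans (fC x) _; exact: ler_band.
move=> x _; rewrite /band patchE mem_setE in_itv /= -ler_norml.
case: ifP => xM; last by rewrite mulr0.
rewrite mulr1 /g; apply: ler_norm_clip.
by apply: le_trans (fC x) _; exact: ler_band.
Qed.

(** As [f] is only measurable, [f (x + h n)] need not converge pointwise. A continuous [g] replaces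
    the shifted factor, dominated convergence applies to [g], and each replacement costs at most [C]
    times the L^1 error. *)
Lemma cvg_autocorrelation (f : R -> R) (C M : R) (h : nat -> R) : 0 < C -> measurable_fun setT f ->
  (forall x, `|f x| <= C * band M x) -> h @ \oo --> (0 : R) ->
  (fun n => \int[mu]_x (f x * f (x + h n))) @ \oo --> \int[mu]_x (f x * f x).
Proof.
move=> C0 mf fC h0; apply/cvgrPdist_lt => e e0.
have e1 : 0 < e / (3 * C) by rewrite divr_gt0// mulr_gt0.
have [g [cg gC fg]] := continuous_approx e1 C0 mf fC.
set D := (fun x => `|f x - g x| * band (M + 1) x) in fg.
have mg := continuous_measurable_fun cg.
have fC' x : `|f x| <= C by apply: le_trans (fC x) _; exact: ler_band.
have f0 x : M < `|x| -> f x = 0.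
  by move=> Mx; apply/eqP; rewrite -normr_le0 (le_trans (fC x))// band0// mulr0.
have mfg : measurable_fun setT (fun x => `|f x - g x|).
  by apply: measurableT_comp => //; apply: measurable_funB.
have iD : mu.-integrable setT (EFin \o D).
  apply: (@le_integrable_band _ (2 * C) (M + 1)).
    by apply: measurable_funM => //; exact: measurable_band.
  move=> x; rewrite normrM normr_id (ger0_norm (band_ge0 _ _)) ler_wpM2r ?band_ge0//.
  by apply: le_trans (ler_normB _ _) _; rewrite mulr_natl mulr2n lerD.
have mshift (k : R -> R) n : measurable_fun setT k -> measurable_fun setT (fun x : R => k (x + h n)).
  by move=> mk; apply: measurableT_comp => //; exact: measurable_funD.
have cI : (fun n => \int[mu]_x (f x * g (x + h n))) @ \oo --> \int[mu]_x (f x * g x).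
  apply: (@cvg_Rintegral _ (measurableTypeR R) R mu _ _ (fun x => C * C * band M x)).
  - by move=> n; apply: measurable_funM => //; exact: mshift.
  - exact: measurable_funM.
  - move=> x; apply: cvgM; first exact: cvg_cst.
    apply: (cvg_comp (fun n => x + h n) g); last exact: cg.
    have : (fun n => x + h n) @ \oo --> (x + 0 : R) by apply: cvgD => //; exact: cvg_cst.
    by rewrite addr0.
  - exact: (integrableZl measurableT (C * C) (integrable_band M)).
  - move=> n x; rewrite normrM mulrAC; apply: ler_pM => //.
near=> n.
have hn : `|h n| <= 1.
  near: n; move/cvgrPdist_le : h0 => /(_ 1 ltr01).
  by apply: filterS => n; rewrite sub0r normrN.
have cn : `|\int[mu]_x (f x * g x) - \int[mu]_x (f x * g (x + h n))| < e / 3.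
  by near: n; move/cvgrPdist_lt : cI; apply; rewrite divr_gt0.
have if1 (k : R -> R) : measurable_fun setT k -> (forall x, `|k x| <= C) ->
    mu.-integrable setT (EFin \o (fun x => f x * k x)).
  move=> mk kC; apply: (@le_integrable_band _ (C * C) M); first exact: measurable_funM.
  by move=> x; rewrite normrM mulrAC; exact: ler_pM.
have i1 : `|\int[mu]_x (f x * f x) - \int[mu]_x (f x * g x)| <= C * \int[mu]_x D x.
  rewrite -RintegralB//; [|exact: if1|exact: if1].
  rewrite -RintegralZl//; apply: le_Rintegral_dom.
  - by apply: measurable_funB; exact: measurable_funM.
  - exact: (integrableZl measurableT C iD).
  - move=> x; rewrite -mulrBr normrM /D.
    have [xM|Mx] := leP `|x| M.
      by rewrite band1 ?(le_trans xM) ?lerDl// mulr1 ler_wpM2r.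
    rewrite (f0 _ Mx) normr0 mul0r; apply: mulr_ge0; first exact: ltW.
    by apply: mulr_ge0 => //; exact: band_ge0.
have i2 : `|\int[mu]_x (f x * g (x + h n)) - \int[mu]_x (f x * f (x + h n))| <= C * \int[mu]_x D x.
  rewrite -RintegralB//; [|by apply: if1 => //; exact: mshift|by apply: if1 => //; exact: mshift].
  (* Translation invariance reduces the error of the shifted pair to that of the unshifted one. *)
  have -> : \int[mu]_x D x = \int[mu]_x D (1 * x + h n).
    by rewrite Rintegral_affine// invr1 mul1r.
  have iDs := integrable_affine (h n) ltr01 iD.
  rewrite -RintegralZl//; apply: le_Rintegral_dom.
  - by apply: measurable_funB; apply: measurable_funM => //; exact: mshift.
  - exact: (integrableZl measurableT C iDs).
  - move=> x; rewrite -mulrBr normrM /D mul1r.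
    have [xM|Mx] := leP `|x| M.
      by rewrite band1 ?(le_trans (ler_normD _ _)) ?lerD// mulr1 distrC ler_wpM2r.
    rewrite (f0 _ Mx) normr0 mul0r; apply: mulr_ge0; first exact: ltW.
    by apply: mulr_ge0 => //; exact: band_ge0.
have cD : C * \int[mu]_x D x < e / 3.
  move: fg; rewrite -(ltr_pM2l C0) => /lt_le_trans; apply.
  by rewrite le_eqVlt; apply/orP; left; apply/eqP; field; rewrite gt_eqF.
set A := \int[mu]_x (f x * f x) in i1 *; set B := \int[mu]_x (f x * g x) in i1 cn *.
set A' := \int[mu]_x (f x * f (x + h n)) in i2 *.
set B' := \int[mu]_x (f x * g (x + h n)) in cn i2 *.
have -> : A - A' = (A - B) + (B - B') + (B' - A') by ring.
apply: le_lt_trans (ler_normD _ _) _; apply: le_lt_trans (lerD (ler_normD _ _) (lexx _)) _.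
lra.
Unshelve. all: by end_near. Qed.

End autocorrelation.

(** * Plancherel on the line by Abel summation *)

Section plancherel_line.
Context {R : realType}.
Local Notation mu := (@lebesgue_measure R).
Variables (f : R -> R) (C M : R).
Hypothesis C0 : 0 < C.
Hypothesis mf : measurable_fun setT f.
Hypothesis fC : forall x, `|f x| <= C * band M x.

Let cosf xi := \int[mu]_x (f x * cos (x * xi)).
Let sinf xi := \int[mu]_x (f x * sin (x * xi)).
Let power xi := cosf xi ^+ 2 + sinf xi ^+ 2.
Let K := \int[mu]_x (C * band M x).

Let iK : mu.-integrable setT (EFin \o (fun x => C * band M x)).
Proof. exact: (integrable_scale C (integrable_band M)). Qed.

Let mcos d (T : measurableType d) (g : T -> R) : measurable_fun setT g ->
  measurable_fun setT (cos \o g).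
Proof. by move=> mg; apply: measurableT_comp => //; apply: continuous_measurable_fun; exact: continuous_cos. Qed.

Let msin d (T : measurableType d) (g : T -> R) : measurable_fun setT g ->
  measurable_fun setT (sin \o g).
Proof. by move=> mg; apply: measurableT_comp => //; apply: continuous_measurable_fun; exact: continuous_sin. Qed.

Let mcosf : measurable_fun setT cosf.
Proof.
apply: (@measurable_Rintegral _ _ (measurableTypeR R) (measurableTypeR R) R mu (fun z => f z.2 * cos (z.2 * z.1))).
apply: measurable_funM; first exact: measurableT_comp.
by apply: (mcos (g := fun z : measurableTypeR R * measurableTypeR R => z.2 * z.1)); exact: measurable_funM.
Qed.

Let msinf : measurable_fun setT sinf.
Proof.
apply: (@measurable_Rintegral _ _ (measurableTypeR R) (measurableTypeR R) R mu (fun z => f z.2 * sin (z.2 * z.1))).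
apply: measurable_funM; first exact: measurableT_comp.
by apply: (msin (g := fun z : measurableTypeR R * measurableTypeR R => z.2 * z.1)); exact: measurable_funM.
Qed.

Let mpower : measurable_fun setT power.
Proof. by apply: measurable_funD; apply: measurable_funX. Qed.

Let dom_fM (g : R -> R) : (forall x, `|g x| <= 1) -> forall x, `|f x * g x| <= C * band M x.
Proof. by move=> g1 x; rewrite normrM -[leRHS]mulr1 ler_pM. Qed.

Let if_ (g : R -> R) : measurable_fun setT g -> (forall x, `|g x| <= 1) ->
  mu.-integrable setT (EFin \o (fun x => f x * g x)).
Proof.
move=> mg g1; apply: (@integrable_dominated _ (measurableTypeR R) R mu _ _ _ iK).
  exact: measurable_funM.
exact: dom_fM.
Qed.

Let mcosR (z : R) : measurable_fun setT (fun x : R => cos (x * z)).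
Proof. by apply: (mcos (g := fun x : R => x * z)); exact: measurable_funM. Qed.

Let msinR (z : R) : measurable_fun setT (fun x : R => sin (x * z)).
Proof. by apply: (msin (g := fun x : R => x * z)); exact: measurable_funM. Qed.

(** The real part of e^(i x xi) f^(xi), the contribution of frequency xi to f at x; paired with f it
    gives |f^(xi)|^2. *)
Let Hf (xi x : R) := \int[mu]_y (f y * cos ((x - y) * xi)).

Let HfE xi x : Hf xi x = cos (x * xi) * cosf xi + sin (x * xi) * sinf xi.
Proof.
rewrite /Hf -RintegralZl//; last by apply: if_; [exact: mcosR|move=> ?; exact: cos_max].
rewrite -RintegralZl//; last by apply: if_; [exact: msinR|move=> ?; exact: sin_max].
rewrite -RintegralD//; last 2 first.
- apply: integrable_scale; apply: if_; [exact: mcosR|move=> ?; exact: cos_max].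
- apply: integrable_scale; apply: if_; [exact: msinR|move=> ?; exact: sin_max].
by apply: eq_Rintegral => y _; rewrite mulrBl cosB; ring.
Qed.

Let HfK xi x : `|Hf xi x| <= K.
Proof.
apply: le_Rintegral_dom => //.
  apply: measurable_funM => //.
  apply: (mcos (g := fun y : R => (x - y) * xi)).
  by apply: measurable_funM => //; apply: measurable_funB.
by apply: dom_fM => y; exact: cos_max.
Qed.

Let powerE xi : power xi = \int[mu]_x (f x * Hf xi x).
Proof.
transitivity (\int[mu]_x (cosf xi * (f x * cos (x * xi)) + sinf xi * (f x * sin (x * xi)))).
  have ic : mu.-integrable setT (EFin \o (fun x => f x * cos (x * xi))).
    by apply: if_; [exact: mcosR|move=> ?; exact: cos_max].
  have is' : mu.-integrable setT (EFin \o (fun x => f x * sin (x * xi))).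
    by apply: if_; [exact: msinR|move=> ?; exact: sin_max].
  rewrite RintegralD//; last 2 first.
  - exact: integrable_scale.
  - exact: integrable_scale.
  by rewrite RintegralZl// RintegralZl.
by apply: eq_Rintegral => y _; rewrite HfE; ring.
Qed.

Let power_ge0 xi : 0 <= power xi.
Proof. by rewrite addr_ge0 ?sqr_ge0. Qed.

Let K0 : 0 <= K.
Proof. by apply: le_trans (HfK 0 0). Qed.

Let power_le xi : power xi <= K * K.
Proof.
apply: le_trans (ler_norm _) _; rewrite powerE.
have -> : K * K = \int[mu]_x (K * (C * band M x)) by rewrite RintegralZl.
apply: le_Rintegral_dom => //; last first.
- by move=> x; rewrite normrM mulrC ler_pM//.
- exact: integrable_scale.
apply: measurable_funM => //.
rewrite (_ : Hf xi = fun x => cos (x * xi) * cosf xi + sin (x * xi) * sinf xi); last first.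
  by apply/funext => x; rewrite HfE.
apply: measurable_funD; apply: measurable_funM => //; [exact: mcosR|exact: msinR].
Qed.

(** Fubini in xi and y brings out the cosine transform of the damping factor, which is the Poisson
    kernel; rescaling it and exchanging x and z leaves a Poisson mean of the autocorrelation of
    f. *)
Let damped_power (e : R) : 0 < e ->
  \int[mu]_xi (onesided_exp e xi * power xi) =
  \int[mu]_z (cauchy_kernel z * \int[mu]_x (f x * f (x + e * z))).
Proof.
move=> e0.
have iw := integrable_onesided_exp e0.
have mw := measurable_onesided_exp e.
transitivity (\int[mu]_xi \int[mu]_x (onesided_exp e xi * (f x * Hf xi x))).
  apply: eq_Rintegral => xi _; rewrite powerE -RintegralZl//.
  apply: (@integrable_dominated _ (measurableTypeR R) R mu _ (fun x => K * (C * band M x))).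
  - apply: measurable_funM => //.
    rewrite (_ : Hf xi = fun x => cos (x * xi) * cosf xi + sin (x * xi) * sinf xi); last first.
      by apply/funext => x; rewrite HfE.
    apply: measurable_funD; apply: measurable_funM => //; [exact: mcosR|exact: msinR].
  - exact: integrable_scale.
  - by move=> x; rewrite normrM mulrC ler_pM//.
have m1 : measurable_fun setT (fun z : measurableTypeR R * measurableTypeR R => onesided_exp e z.1 * (f z.2 * Hf z.1 z.2)).
  apply: measurable_funM; first exact: measurableT_comp.
  apply: measurable_funM; first exact: measurableT_comp.
  rewrite (_ : (fun x => _) = fun z => cos (z.2 * z.1) * cosf z.1 + sin (z.2 * z.1) * sinf z.1); last first.
    by apply/funext => x; rewrite HfE.
  apply: measurable_funD; apply: measurable_funM => //.
  - by apply: (mcos (g := fun z : measurableTypeR R * measurableTypeR R => z.2 * z.1)); exact: measurable_funM.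
  - exact: measurableT_comp.
  - by apply: (msin (g := fun z : measurableTypeR R * measurableTypeR R => z.2 * z.1)); exact: measurable_funM.
  - exact: measurableT_comp.
have i1 : mu.-integrable setT (EFin \o (fun xi => K * onesided_exp e xi)) by exact: integrable_scale.
rewrite (@Rintegral_Fubini _ _ (measurableTypeR R) (measurableTypeR R) R mu mu _ _ _ m1 i1 iK); last first.
  move=> x y /=; rewrite normrM (ger0_norm (onesided_exp_ge0 _ _)) normrM.
  have -> : K * onesided_exp e x * (C * band M y) = onesided_exp e x * (C * band M y * K) by ring.
  by apply: ler_wpM2l; [exact: onesided_exp_ge0|exact: ler_pM].
transitivity (\int[mu]_x (f x * \int[mu]_z (cauchy_kernel z * f (x + e * z)))).
  apply: eq_Rintegral => x _ /=.
  transitivity (\int[mu]_xi (f x * \int[mu]_y (onesided_exp e xi * (f y * cos ((x - y) * xi))))).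
    apply: eq_Rintegral => xi _; rewrite RintegralZl//; first by rewrite -/(Hf _ _); ring.
    apply: if_; last by move=> ?; exact: cos_max.
    apply: (mcos (g := fun y : R => (x - y) * xi)).
    by apply: measurable_funM => //; apply: measurable_funB.
  have m2 : measurable_fun setT (fun z : measurableTypeR R * measurableTypeR R => onesided_exp e z.1 * (f z.2 * cos ((x - z.2) * z.1))).
    apply: measurable_funM; first exact: measurableT_comp.
    apply: measurable_funM; first exact: measurableT_comp.
    apply: (mcos (g := fun z : measurableTypeR R * measurableTypeR R => (x - z.2) * z.1)); apply: measurable_funM => //.
    exact: measurable_funB.
  have d2 (xi y : R) : `|onesided_exp e xi * (f y * cos ((x - y) * xi))| <= onesided_exp e xi * (C * band M y).
    rewrite normrM (ger0_norm (onesided_exp_ge0 _ _)) ler_wpM2l ?onesided_exp_ge0//.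
    by apply: (dom_fM (g := fun y => cos ((x - y) * xi))) => ?; exact: cos_max.
  rewrite RintegralZl//; last first.
    apply: (@integrable_dominated _ (measurableTypeR R) R mu _ (fun xi => K * onesided_exp e xi)) => //.
      exact: (measurable_Rintegral mu m2).
    move=> xi; rewrite RintegralZl//; last first.
      apply: if_; last by move=> ?; exact: cos_max.
      apply: (mcos (g := fun y : R => (x - y) * xi)).
      by apply: measurable_funM => //; apply: measurable_funB.
    by rewrite normrM (ger0_norm (onesided_exp_ge0 _ _)) mulrC ler_wpM2r ?onesided_exp_ge0//; exact: HfK.
  congr (_ * _).
  rewrite (@Rintegral_Fubini _ _ (measurableTypeR R) (measurableTypeR R) R mu mu _ _ _ m2 iw iK)//.
  (* The Poisson kernel centred at x; the substitution y = x + e z removes e from the kernel and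
     puts it into the shift. *)
  pose g (y : R) : R := f y * (e / (e ^+ 2 + (x - y) ^+ 2)).
  have ge0 y : 0 < e ^+ 2 + (x - y) ^+ 2 by rewrite ltr_wpDr ?sqr_ge0// exprn_gt0.
  transitivity (\int[mu]_y g y).
    apply: eq_Rintegral => y _ /=; rewrite /g -Rintegral_onesided_exp_cos// -RintegralZl//.
      by apply: eq_Rintegral => xi _; ring.
    apply: integrable_onesided_expM => //.
      exact: measurable_cosM.
    by move=> ?; rewrite (le_trans (cos_max _))// ler1n.
  have ig : mu.-integrable setT (EFin \o g).
    apply: (@integrable_dominated _ (measurableTypeR R) R mu _ (fun y => e^-1 * (C * band M y))).
    - apply: measurable_funM => //; apply: measurable_funM => //.
      apply: continuous_measurable_fun => y; apply: (@cvgV R R (nbhs y)).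
        by rewrite gt_eqF.
      by apply: (@is_derive_continuous R (fun y => e ^+ 2 + (x - y) ^+ 2)).
    - exact: integrable_scale.
    - move=> y; rewrite /g normrM mulrC ler_pM//.
      rewrite gtr0_norm ?divr_gt0// ler_pdivrMr// mulrC ler_pdivlMr// -expr2.
      by rewrite lerDl sqr_ge0.
  have := @Rintegral_affine R e x g e0 ig.
  move/(congr1 ( *%R e)); rewrite mulVKf ?gt_eqF// => <-.
  rewrite -RintegralZl//; last exact: integrable_affine.
  apply: eq_Rintegral => z _; rewrite /g /cauchy_kernel [e * z + x]addrC.
  have h : 1 + z ^+ 2 != 0 by rewrite gt_eqF// ltr_wpDr ?sqr_ge0.
  field; rewrite h /=.
  rewrite (_ : x + - (x + e * z) = - (e * z)); last by ring.
  by rewrite sqrrN exprMn -[X in X + _]mulr1 -mulrDr mulf_neq0// sqrf_eq0 gt_eqF.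
transitivity (\int[mu]_x \int[mu]_z (f x * (cauchy_kernel z * f (x + e * z)))).
  apply: eq_Rintegral => x _; rewrite RintegralZl//.
  apply: (@integrable_dominated _ (measurableTypeR R) R mu _ (fun y => C * cauchy_kernel y)).
  - apply: measurable_funM; first exact: measurable_cauchy_kernel.
    by apply: measurableT_comp => //; apply: measurable_funD => //; exact: measurable_funM.
  - exact: (integrableZl measurableT C integrable_cauchy_kernel).
  - move=> z; rewrite normrM mulrC (ger0_norm (cauchy_kernel_ge0 _)) ler_wpM2r ?cauchy_kernel_ge0//.
    by apply: le_trans (fC _) _; exact: ler_band.
have ic := (integrableZl measurableT C integrable_cauchy_kernel).
have m3 : measurable_fun setT (fun z : measurableTypeR R * measurableTypeR R => f z.1 * (cauchy_kernel z.2 * f (z.1 + e * z.2))).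
  apply: measurable_funM; first exact: measurableT_comp.
  apply: measurable_funM; first by apply: measurableT_comp => //; exact: measurable_cauchy_kernel.
  by apply: measurableT_comp => //; apply: measurable_funD => //; exact: measurable_funM.
rewrite (@Rintegral_Fubini _ _ (measurableTypeR R) (measurableTypeR R) R mu mu _ _ (fun y => C * cauchy_kernel y) m3 iK ic); last first.
  move=> x z /=; rewrite normrM ler_pM// normrM mulrC (ger0_norm (cauchy_kernel_ge0 _)) ler_wpM2r ?cauchy_kernel_ge0//.
  by apply: le_trans (fC _) _; exact: ler_band.
apply: eq_Rintegral => z _ /=; rewrite -RintegralZl//.
  by apply: eq_Rintegral => x _; ring.
apply: (@integrable_dominated _ (measurableTypeR R) R mu _ (fun y => C * (C * band M y))).
- apply: measurable_funM => //.
  by apply: measurableT_comp => //; exact: measurable_funD.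
- exact: integrable_scale.
- move=> x; rewrite normrM mulrC ler_pM//.
  by apply: le_trans (fC _) _; exact: ler_band.
Qed.

(** As the damping e tends to 0, the left side of [damped_power] increases to the undamped integral,
    while the right side tends, by dominated convergence, to the autocorrelation at shift 0 times
    the mass pi of the kernel. Half of the frequencies account for half of 2 pi. *)
Lemma plancherel_line : (\int[mu]_(xi in `[0%R, +oo[) (power xi)%:E = pi%:E * \int[mu]_x (f x ^+ 2)%:E)%E.
Proof.
pose e_ n : R := n.+1%:R^-1.
have e_0 n : 0 < e_ n by rewrite invr_gt0.
have iff : mu.-integrable setT (EFin \o (fun x => f x * f x)).
  apply: (@integrable_dominated _ (measurableTypeR R) R mu _ (fun y => C * (C * band M y))).
  - exact: measurable_funM.
  - exact: integrable_scale.
  - move=> x; rewrite normrM mulrC ler_pM//.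
    by apply: le_trans (fC _) _; exact: ler_band.
have lim1 : (fun n => \int[mu]_xi (onesided_exp (e_ n) xi * power xi)) @ \oo -->
    pi * \int[mu]_x (f x * f x).
  rewrite (_ : (fun n => _) = fun n => \int[mu]_z (cauchy_kernel z * \int[mu]_x (f x * f (x + e_ n * z)))); last first.
    by apply/funext => n; rewrite damped_power.
  rewrite (_ : pi * _ = \int[mu]_z (cauchy_kernel z * \int[mu]_x (f x * f x))); last first.
    rewrite RintegralZr//; last exact: integrable_cauchy_kernel.
    by congr (_ * _); rewrite /Rintegral integral_cauchy_kernel.
  have A_le (h : R) : `|\int[mu]_x (f x * f (x + h))| <= C * K.
    rewrite -RintegralZl//; apply: le_Rintegral_dom.
    - apply: measurable_funM => //.
      by apply: measurableT_comp => //; exact: measurable_funD.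
    - exact: integrable_scale.
    - move=> x; rewrite normrM mulrC ler_pM//.
      by apply: le_trans (fC _) _; exact: ler_band.
  apply: (@cvg_Rintegral _ (measurableTypeR R) R mu _ _ (fun z => C * K * cauchy_kernel z)).
  - move=> n; apply: measurable_funM; first exact: measurable_cauchy_kernel.
    apply: (@measurable_Rintegral _ _ (measurableTypeR R) (measurableTypeR R) R mu (fun z => f z.2 * f (z.2 + e_ n * z.1))).
    apply: measurable_funM; first exact: measurableT_comp.
    by apply: measurableT_comp => //; apply: measurable_funD => //; exact: measurable_funM.
  - by apply: measurable_funM => //; exact: measurable_cauchy_kernel.
  - move=> z; apply: cvgM; first exact: cvg_cst.
    apply: (cvg_autocorrelation C0 mf fC).
    rewrite -(mul0r z); apply: cvgM; last exact: cvg_cst.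
    exact: cvg_harmonic.
  - exact: (integrableZl measurableT (C * K) integrable_cauchy_kernel).
  - move=> n z; rewrite normrM mulrC (ger0_norm (cauchy_kernel_ge0 _)) ler_wpM2r ?cauchy_kernel_ge0//.
pose g' n (xi : R) : \bar R := (expR (- (e_ n * xi)) * power xi)%:E.
have mD : measurable (`[0%R, +oo[%classic : set (measurableTypeR R)) by exact: measurable_itv.
have lim2 : (\int[mu]_(xi in `[0%R, +oo[) g' n xi)%E @[n --> \oo] --> (\int[mu]_(xi in `[0%R, +oo[) (power xi)%:E)%E.
  rewrite (_ : integral _ _ _ = \int[mu]_(xi in `[0%R, +oo[) limn (g' ^~ xi))%E; last first.
    apply: eq_integral => xi _; apply/esym/cvg_lim => //; apply: cvg_EFin; first exact: nearW.
    rewrite /g' /= -[X in _ --> X]mul1r; apply: cvgM; last exact: cvg_cst.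
    rewrite -expR0; apply: (cvg_comp (fun n => - (e_ n * xi)) expR); last exact: continuous_expR.
    rewrite -oppr0 -(mul0r xi); apply: cvgN; apply: cvgM; last exact: cvg_cst.
    exact: cvg_harmonic.
  apply: cvg_monotone_convergence => //.
  - move=> n; apply/measurable_EFinP; apply: measurable_funTS; apply: measurable_funM => //.
    by apply: measurableT_comp => //; apply: measurableT_comp => //; exact: measurable_funM.
  - by move=> n xi _; rewrite lee_fin mulr_ge0// expR_ge0.
  - move=> xi; rewrite /= in_itv /= andbT => xi0 m n mn; rewrite lee_fin ler_wpM2r// ler_expR lerN2 ler_wpM2r//.
    by rewrite lef_pV2 ?posrE// ler_nat.
have E n : (\int[mu]_(xi in `[0%R, +oo[) g' n xi)%E = (\int[mu]_xi (onesided_exp (e_ n) xi * power xi))%:E.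
  rewrite EFin_Rintegral; last first.
    apply: (@integrable_dominated _ (measurableTypeR R) R mu _ (fun xi => K * K * onesided_exp (e_ n) xi)).
    - by apply: measurable_funM => //; exact: measurable_onesided_exp.
    - exact: (integrableZl measurableT (K * K) (integrable_onesided_exp (e_0 n))).
    - move=> xi; rewrite normrM (ger0_norm (onesided_exp_ge0 _ _)) mulrC ler_wpM2r ?onesided_exp_ge0//.
      by rewrite ger0_norm// power_le.
  rewrite [LHS]integral_mkcond; apply: eq_integral => xi _.
  rewrite patchE mem_setE in_itv /= andbT /onesided_exp /g'.
  by case: ifP => // _; rewrite mul0r.
transitivity (pi * \int[mu]_x (f x * f x))%:E; last first.
  by rewrite EFinM EFin_Rintegral//; congr (_ * _)%E; apply: eq_integral => x _; rewrite expr2.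
apply: (cvg_unique _ lim2) => //=.
rewrite (_ : (fun n => _) = fun n => (\int[mu]_xi (onesided_exp (e_ n) xi * power xi))%:E); last first.
  by apply/funext => n; exact: E.
by apply: cvg_EFin; [exact: nearW|exact: lim1].
Qed.

End plancherel_line.

Section trigonometric_measurability.
Context d (T : measurableType d) (R : realType).

Lemma measurable_cos_comp (g : T -> R) : measurable_fun setT g ->
  measurable_fun setT (fun x => cos (g x)).
Proof.
move=> mg; apply: (@measurableT_comp _ _ _ _ _ _ (@cos R)) => //.
by apply: continuous_measurable_fun; exact: continuous_cos.
Qed.

Lemma measurable_sin_comp (g : T -> R) : measurable_fun setT g ->
  measurable_fun setT (fun x => sin (g x)).
Proof.
move=> mg; apply: (@measurableT_comp _ _ _ _ _ _ (@sin R)) => //.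
by apply: continuous_measurable_fun; exact: continuous_sin.
Qed.

Lemma measurable_expR_comp (g : T -> R) : measurable_fun setT g ->
  measurable_fun setT (fun x => expR (g x)).
Proof. by move=> mg; apply: (@measurableT_comp _ _ _ _ _ _ (@expR R)). Qed.

Lemma measurable_dotp n (u v : T -> Rn R n) : measurable_fun setT u -> measurable_fun setT v ->
  measurable_fun setT (fun x => dotp (u x) (v x)).
Proof.
move=> mu mv; apply: measurable_sum => i.
apply: measurable_funM.
- by apply: (measurableT_comp (measurable_tnth i)).
- by apply: (measurableT_comp (measurable_tnth i)).
Qed.

End trigonometric_measurability.

(** * Slicing of R^n and the induction on the dimension in Plancherel's theorem *)

Section Rn_integrals.
Context {R : realType}.
Local Notation mu := (@lebesgue_measure R).
Local Notation leb n := (lebesgue_Rn R n).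

Lemma dotp_cons n (x a : R) (y z : Rn R n) :
  dotp (cons_Rn (x, y)) (cons_Rn (a, z)) = x * a + dotp y z.
Proof.
rewrite /dotp big_ord_recl /=; congr (_ + _); apply: eq_bigr => i _.
by rewrite !tnthS.
Qed.

Lemma integral_Rn0 (F : Rn R 0 -> \bar R) : measurable_fun setT F ->
  (\int[leb 0]_x F x = F [tuple])%E.
Proof. by move=> mF; rewrite integral_dirac// diracT mul1e. Qed.

Lemma ge0_integral_RnS n (F : Rn R n.+1 -> \bar R) : measurable_fun setT F ->
  (forall x, 0 <= F x)%E ->
  (\int[leb n.+1]_x F x = \int[mu]_x \int[leb n]_y F (cons_Rn (x, y)))%E.
Proof.
move=> mF F0.
rewrite (@ge0_integral_pushforward _ _ _ _ R _ (@measurable_cons_Rn R n) (mu \x leb n)%E setT F)//.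
rewrite preimage_setT fubini_tonelli1//; last by move=> z; exact: F0.
by apply: measurableT_comp => //; exact: measurable_cons_Rn.
Qed.

Lemma ge0_integral_RnS2 n (F : Rn R n.+1 -> \bar R) : measurable_fun setT F ->
  (forall x, 0 <= F x)%E ->
  (\int[leb n.+1]_x F x = \int[leb n]_y \int[mu]_x F (cons_Rn (x, y)))%E.
Proof.
move=> mF F0; rewrite ge0_integral_RnS//.
apply: (@fubini_tonelli _ _ _ _ _ mu (leb n) (F \o @cons_Rn R n)).
- by apply: measurableT_comp => //; exact: measurable_cons_Rn.
- by move=> z; exact: F0.
Qed.

Lemma Rintegral_RnS n (F : Rn R n.+1 -> R) (a : R -> R) (b : Rn R n -> R) :
  measurable_fun setT F -> mu.-integrable setT (EFin \o a) -> (leb n).-integrable setT (EFin \o b) ->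
  (forall x y, `|F (cons_Rn (x, y))| <= a x * b y) ->
  \int[leb n.+1]_x F x = \int[leb n]_y \int[mu]_x F (cons_Rn (x, y)).
Proof.
move=> mF ia ib Fab.
have mFc : measurable_fun setT (F \o @cons_Rn R n).
  by apply: measurableT_comp => //; exact: measurable_cons_Rn.
rewrite -(@Rintegral_Fubini _ _ _ _ R mu (leb n) (F \o @cons_Rn R n) _ _ mFc ia ib)//.
rewrite -(@Rintegral_product _ _ _ _ R mu (leb n) (F \o @cons_Rn R n) _ _ mFc ia ib)//.
congr fine.
rewrite (@integral_pushforward _ _ _ _ R _ (@measurable_cons_Rn R n) (mu \x leb n)%E setT (EFin \o F))//.
  exact/measurable_EFinP.
exact: (@integrable_product _ _ _ _ R mu (leb n) (F \o @cons_Rn R n) _ _ mFc ia ib).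
Qed.

(** The cube, not the ball: its indicator is a product over the coordinates, as the product
    majorants of Fubini's theorem require. *)
Definition bandn n (M : R) (x : Rn R n) : R := \prod_(i < n) band M (tnth x i).

Lemma bandn_cons n M x (y : Rn R n) : bandn M (cons_Rn (x, y)) = band M x * bandn M y.
Proof.
rewrite /bandn big_ord_recl; congr (_ * _); apply: eq_bigr => i _.
by rewrite tnthS.
Qed.

Lemma bandn_ge0 n M (x : Rn R n) : 0 <= bandn M x.
Proof. by apply: prodr_ge0 => i _; exact: band_ge0. Qed.

Lemma bandn_le1 n M (x : Rn R n) : bandn M x <= 1.
Proof.
apply: prodr_ile1 => i _; rewrite band_ge0 /=.
by rewrite /band; case: ifP.
Qed.

Lemma measurable_bandn n M : measurable_fun setT (@bandn n M).
Proof.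
apply: measurable_prod => i _.
by apply: (measurableT_comp (@measurable_band R M)); exact: measurable_tnth.
Qed.

Lemma integrable_bandn n M : (leb n).-integrable setT (EFin \o @bandn n M).
Proof.
elim: n => [|n IHn].
  apply/integrableP; split; first by apply/measurable_EFinP; exact: measurable_bandn.
  rewrite integral_Rn0 ?ltry//; apply: measurableT_comp => //.
  by apply/measurable_EFinP; exact: measurable_bandn.
apply/integrableP; split; first by apply/measurable_EFinP; exact: measurable_bandn.
have mb : measurable_fun setT ((fun z => band M z.1 * bandn M z.2) : measurableTypeR R * Rn R n -> R).
  apply: measurable_funM.
    by apply: (measurableT_comp (@measurable_band R M)).
  by apply: (measurableT_comp (@measurable_bandn n M)).
have : (mu \x leb n)%E.-integrable setT (EFin \o ((fun z => band M z.1 * bandn M z.2) : measurableTypeR R * Rn R n -> R)).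
  apply: (@integrable_product _ _ _ _ R mu (leb n) _ _ _ mb (integrable_band M) IHn).
  by move=> x y; rewrite ger0_norm// mulr_ge0// ?band_ge0// bandn_ge0.
have /measurable_EFinP mb' := mb.
move=> /(integrable12ltyP mu (leb n) mb'); apply: le_lt_trans.
rewrite ge0_integral_RnS//; last first.
  by apply: measurableT_comp => //; apply/measurable_EFinP; exact: measurable_bandn.
by under eq_integral do under eq_integral do rewrite /= bandn_cons.
Qed.

Lemma integrable_bandnM n (f : Rn R n -> R) (C M : R) : measurable_fun setT f ->
  (forall x, `|f x| <= C * bandn M x) -> (leb n).-integrable setT (EFin \o f).
Proof.
move=> mf fC; apply: (integrable_dominated mf _ fC).
exact: (integrable_scale C (integrable_bandn n M)).
Qed.

(** In real terms f^ = [cosT f] - i [sinT f], so that [power f] is |f^|^2. *)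
Definition cosT n (f : Rn R n -> R) (xi : Rn R n) := \int[leb n]_x (f x * cos (dotp x xi)).
Definition sinT n (f : Rn R n -> R) (xi : Rn R n) := \int[leb n]_x (f x * sin (dotp x xi)).
Definition power n (f : Rn R n -> R) (xi : Rn R n) := cosT f xi ^+ 2 + sinT f xi ^+ 2.

Lemma power_ge0 n (f : Rn R n -> R) xi : 0 <= power f xi.
Proof. by rewrite addr_ge0 ?sqr_ge0. Qed.

Lemma measurable_cosT n (f : Rn R n -> R) : measurable_fun setT f -> measurable_fun setT (cosT f).
Proof.
move=> mf; apply: (@measurable_Rintegral _ _ _ _ R (leb n) (fun z : Rn R n * Rn R n => f z.2 * cos (dotp z.2 z.1))).
apply: measurable_funM; first exact: (measurableT_comp mf).
by apply: measurable_cos_comp; exact: measurable_dotp.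
Qed.

Lemma measurable_sinT n (f : Rn R n -> R) : measurable_fun setT f -> measurable_fun setT (sinT f).
Proof.
move=> mf; apply: (@measurable_Rintegral _ _ _ _ R (leb n) (fun z : Rn R n * Rn R n => f z.2 * sin (dotp z.2 z.1))).
apply: measurable_funM; first exact: (measurableT_comp mf).
by apply: measurable_sin_comp; exact: measurable_dotp.
Qed.

Lemma measurable_power n (f : Rn R n -> R) : measurable_fun setT f -> measurable_fun setT (power f).
Proof.
move=> mf; apply: measurable_funD; apply: measurable_funX; [exact: measurable_cosT|exact: measurable_sinT].
Qed.

Section plancherel_step.
Variables (n : nat) (f : Rn R n.+1 -> R) (C M : R).
Hypothesis C0 : 0 < C.
Hypothesis mf : measurable_fun setT f.
Hypothesis fC : forall x, `|f x| <= C * bandn M x.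
Hypothesis IHn : forall (g : Rn R n -> R) (D N : R), 0 < D -> measurable_fun setT g ->
  (forall x, `|g x| <= D * bandn N x) ->
  (\int[leb n]_xi (power g xi)%:E = ((2 * pi) ^+ n)%:E * \int[leb n]_x (g x ^+ 2)%:E)%E.

(** A - i B is the transform in the first variable. For a fixed frequency [a] both are bounded
    functions of bounded support in the remaining variables, so the induction hypothesis applies to
    them. *)
Let A (a : R) (y : Rn R n) := \int[mu]_x (f (cons_Rn (x, y)) * cos (x * a)).
Let B (a : R) (y : Rn R n) := \int[mu]_x (f (cons_Rn (x, y)) * sin (x * a)).

Let mfc : measurable_fun setT (f \o @cons_Rn R n).
Proof. by apply: (measurableT_comp mf); exact: measurable_cons_Rn. Qed.

Let mf_cons d (T : measurableType d) (u : T -> measurableTypeR R) (v : T -> Rn R n) :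
  measurable_fun setT u -> measurable_fun setT v ->
  measurable_fun setT (fun w => f (cons_Rn (u w, v w))).
Proof. by move=> mu_ mv; apply: (measurableT_comp mf); exact: measurable_cons. Qed.

Let mfx y : measurable_fun setT (fun x : R => f (cons_Rn (x, y))).
Proof. by apply: (measurableT_comp mfc). Qed.

Let fCc x y : `|f (cons_Rn (x, y))| <= band M x * (C * bandn M y).
Proof. by apply: le_trans (fC _) _; rewrite bandn_cons mulrCA. Qed.

Let fCx x y : `|f (cons_Rn (x, y))| <= C * band M x.
Proof.
apply: le_trans (fCc x y) _; rewrite mulrCA ler_wpM2l ?(ltW C0)// ler_piMr ?band_ge0//.
exact: bandn_le1.
Qed.

Let mAB (g : R -> R) : (forall d (T : measurableType d) (h : T -> R), measurable_fun setT h -> measurable_fun setT (fun x => g (h x))) ->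
  measurable_fun setT (fun z : measurableTypeR R * Rn R n => \int[mu]_x (f (cons_Rn (x, z.2)) * g (x * z.1))).
Proof.
move=> mg.
apply: (@measurable_Rintegral _ _ _ _ R mu (fun w : (measurableTypeR R * Rn R n) * measurableTypeR R => f (cons_Rn (w.2, w.1.2)) * g (w.2 * w.1.1))).
apply: measurable_funM.
  apply: mf_cons => //.
  by apply: (measurableT_comp measurable_snd); exact: measurable_fst.
apply: mg; apply: measurable_funM => //.
by apply: (measurableT_comp measurable_fst); exact: measurable_fst.
Qed.

Let mA : measurable_fun setT (fun z : measurableTypeR R * Rn R n => A z.1 z.2).
Proof. by apply: mAB => d T h mh; exact: measurable_cos_comp. Qed.

Let mB : measurable_fun setT (fun z : measurableTypeR R * Rn R n => B z.1 z.2).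
Proof. by apply: mAB => d T h mh; exact: measurable_sin_comp. Qed.

(** The summand 1 makes [D] positive, as the induction hypothesis demands. *)
Let D := C * (1 + \int[mu]_x band M x).

Let D0 : 0 < D.
Proof. by rewrite mulr_gt0// ltr_pwDl// Rintegral_ge0// => x _; exact: band_ge0. Qed.

Let AB_le (g : R -> R) y : (forall x, `|g x| <= 1) -> measurable_fun setT g ->
  `|\int[mu]_x (f (cons_Rn (x, y)) * g x)| <= D * bandn M y.
Proof.
move=> g1 mg; apply: (@le_trans _ _ (\int[mu]_x (C * bandn M y * band M x))).
  apply: le_Rintegral_dom.
  - by apply: (@measurable_funM _ (measurableTypeR R)); [exact: mfx|exact: mg].
  - exact: (integrable_scale _ (integrable_band M)).
  - move=> x; rewrite normrM mulrC -[leRHS]mul1r; apply: ler_pM => //.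
    by rewrite mulrC; exact: fCc.
rewrite RintegralZl//; last exact: integrable_band.
rewrite /D mulrAC ler_wpM2r ?bandn_ge0// ler_wpM2l ?(ltW C0)//.
by rewrite lerDr.
Qed.

Let mcosx a : measurable_fun setT (fun x : R => cos (x * a)).
Proof. by apply: measurable_cos_comp; exact: measurable_funM. Qed.

Let msinx a : measurable_fun setT (fun x : R => sin (x * a)).
Proof. by apply: measurable_sin_comp; exact: measurable_funM. Qed.

Let A_le a y : `|A a y| <= D * bandn M y.
Proof. by apply: AB_le => // x; exact: cos_max. Qed.

Let B_le a y : `|B a y| <= D * bandn M y.
Proof. by apply: AB_le => // x; exact: sin_max. Qed.

Let mAa a : measurable_fun setT (A a).
Proof. exact: (measurable_section1 mA a). Qed.

Let mBa a : measurable_fun setT (B a).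
Proof. exact: (measurable_section1 mB a). Qed.

Let itrig (h : Rn R n -> R) (g : R -> R) z : (forall d (T : measurableType d) (h : T -> R), measurable_fun setT h -> measurable_fun setT (fun x => g (h x))) ->
  (forall x, `|g x| <= 1) ->
  measurable_fun setT h -> (forall y, `|h y| <= D * bandn M y) ->
  (leb n).-integrable setT (EFin \o (fun y => h y * g (dotp y z))).
Proof.
move=> mg g1 mh hD; apply: (@integrable_bandnM _ _ D M).
  by apply: measurable_funM => //; apply: mg; exact: measurable_dotp.
by move=> y; rewrite normrM -[leRHS]mulr1 ler_pM.
Qed.

Let ifx y (g : R -> R) : (forall x, `|g x| <= 1) -> measurable_fun setT g ->
  mu.-integrable setT (EFin \o (fun x => f (cons_Rn (x, y)) * g x)).
Proof.
move=> g1 mg; apply: (@integrable_dominated _ (measurableTypeR R) R mu _ (fun x => C * band M x)).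
- by apply: (@measurable_funM _ (measurableTypeR R)); [exact: mfx|exact: mg].
- exact: (integrable_scale _ (integrable_band M)).
- by move=> x; rewrite normrM -[leRHS]mulr1 ler_pM.
Qed.

Let dom_trig (g : R -> R) : (forall x, `|g x| <= 1) ->
  forall x y w, `|f (cons_Rn (x, y)) * g w| <= band M x * (C * bandn M y).
Proof. by move=> g1 x y w; rewrite normrM -[leRHS]mulr1 ler_pM. Qed.

Let iCb : (leb n).-integrable setT (EFin \o (fun y => C * bandn M y)).
Proof. exact: (integrable_scale C (integrable_bandn n M)). Qed.

Let mcosd d (T : measurableType d) (h : T -> R) : measurable_fun setT h -> measurable_fun setT (fun x => cos (h x)).
Proof. exact: measurable_cos_comp. Qed.

Let msind d (T : measurableType d) (h : T -> R) : measurable_fun setT h -> measurable_fun setT (fun x => sin (h x)).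
Proof. exact: measurable_sin_comp. Qed.

(** The addition formula for the cosine: at (a, z) the transform of f is that of [A a] - i [B a] at
    z. *)
Let cosT_cons a z : cosT f (cons_Rn (a, z)) = cosT (A a) z - sinT (B a) z.
Proof.
rewrite /cosT (@Rintegral_RnS _ _ (band M) (fun y => C * bandn M y))//; last 3 first.
- apply: measurable_funM => //; apply: measurable_cos_comp; exact: measurable_dotp.
- exact: integrable_band.
- by move=> x y; apply: dom_trig; exact: cos_max.
rewrite -RintegralB//; last 2 first.
- by apply: itrig => //; exact: cos_max.
- by apply: itrig => //; exact: sin_max.
apply: eq_Rintegral => y _.
rewrite /A /B -!RintegralZr//; last 2 first.
- by apply: ifx => // x; exact: sin_max.
- by apply: ifx => // x; exact: cos_max.
rewrite -RintegralB//; last 2 first.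
- under eq_fun do rewrite mulrC; apply: integrable_scale.
  by apply: ifx => // x; exact: cos_max.
- under eq_fun do rewrite mulrC; apply: integrable_scale.
  by apply: ifx => // x; exact: sin_max.
by apply: eq_Rintegral => x _; rewrite dotp_cons cosD; ring.
Qed.

Let sinT_cons a z : sinT f (cons_Rn (a, z)) = cosT (B a) z + sinT (A a) z.
Proof.
rewrite /sinT (@Rintegral_RnS _ _ (band M) (fun y => C * bandn M y))//; last 3 first.
- apply: measurable_funM => //; apply: measurable_sin_comp; exact: measurable_dotp.
- exact: integrable_band.
- by move=> x y; apply: dom_trig; exact: sin_max.
rewrite -RintegralD//; last 2 first.
- by apply: itrig => //; exact: cos_max.
- by apply: itrig => //; exact: sin_max.
apply: eq_Rintegral => y _.
rewrite /A /B -!RintegralZr//; last 2 first.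
- by apply: ifx => // x; exact: cos_max.
- by apply: ifx => // x; exact: sin_max.
rewrite -RintegralD//; last 2 first.
- under eq_fun do rewrite mulrC; apply: integrable_scale.
  by apply: ifx => // x; exact: sin_max.
- under eq_fun do rewrite mulrC; apply: integrable_scale.
  by apply: ifx => // x; exact: cos_max.
by apply: eq_Rintegral => x _; rewrite dotp_cons sinD; ring.
Qed.

Let AN a : A (- a) = A a.
Proof. by apply/funext => y; apply: eq_Rintegral => x _; rewrite mulrN cosN. Qed.

Let BN a : B (- a) = \- B a.
Proof.
apply/funext => y; rewrite /B -[RHS]mulN1r -RintegralZl//; last first.
  by apply: ifx => // x; exact: sin_max.
by apply: eq_Rintegral => x _; rewrite mulrN sinN; ring.
Qed.

Let cosT_BN a z : cosT (\- B a) z = - cosT (B a) z.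
Proof.
rewrite /cosT -mulN1r -RintegralZl//; last by apply: itrig => //; exact: cos_max.
by apply: eq_Rintegral => y _ /=; ring.
Qed.

Let sinT_BN a z : sinT (\- B a) z = - sinT (B a) z.
Proof.
rewrite /sinT -mulN1r -RintegralZl//; last by apply: itrig => //; exact: sin_max.
by apply: eq_Rintegral => y _ /=; ring.
Qed.

(* the parallelogram identity for the partial transform A - i B and its
   reflection A + i B *)
Let power_cons a z : power f (cons_Rn (a, z)) + power f (cons_Rn (- a, z)) =
  2 * (power (A a) z + power (B a) z).
Proof.
rewrite /power !cosT_cons !sinT_cons AN BN cosT_BN sinT_BN.
move: (cosT (A a) z) (sinT (A a) z) (cosT (B a) z) (sinT (B a) z) => c s c' s'.
by ring.
Qed.

Let mpf : measurable_fun setT (fun w : measurableTypeR R * Rn R n => power f (cons_Rn (w.1, w.2))).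
Proof.
apply: (measurableT_comp (measurable_power mf)).
by apply: measurable_cons; [exact: measurable_fst|exact: measurable_snd].
Qed.

Let G (a : R) : \bar R := (\int[leb n]_z (power f (cons_Rn (a, z)))%:E)%E.

Let mG : measurable_fun setT G.
Proof.
apply: (measurable_fun_fubini_tonelli_F (m2 := leb n) (fun w : measurableTypeR R * Rn R n => (power f (cons_Rn (w.1, w.2)))%:E)) => //.
- exact/measurable_EFinP.
- by move=> w; rewrite lee_fin power_ge0.
Qed.

Let AB2 (a : R) (y : Rn R n) := A a y ^+ 2 + B a y ^+ 2.

Let AB2_ge0 a y : 0 <= AB2 a y.
Proof. by rewrite addr_ge0 ?sqr_ge0. Qed.

(** [power_cons] integrated over z, with the induction hypothesis applied to [A a] and to [B a]. *)
Let G_fold a : (G a + G (- a)%R = (2 * (2 * pi) ^+ n)%:E * \int[leb n]_y (AB2 a y)%:E)%E.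
Proof.
have mpa b : measurable_fun setT (fun z : Rn R n => (power f (cons_Rn (b, z)))%:E).
  by apply/measurable_EFinP; exact: (measurable_section1 mpf b).
rewrite /G -ge0_integralD//; try by move=> z _; rewrite lee_fin power_ge0.
under eq_integral do rewrite -EFinD power_cons EFinM.
rewrite ge0_integralZl//; last 2 first.
- apply/measurable_EFinP; apply: measurable_funD; exact: measurable_power.
- by move=> z _; rewrite lee_fin addr_ge0 ?power_ge0.
under eq_integral do rewrite EFinD.
rewrite ge0_integralD//; try by [move=> z _; rewrite lee_fin power_ge0|apply/measurable_EFinP; exact: measurable_power].
rewrite (IHn D0 (mAa a) (A_le a)) (IHn D0 (mBa a) (B_le a)).
rewrite -ge0_muleDr; try by apply: integral_ge0 => y _; rewrite lee_fin sqr_ge0.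
rewrite -ge0_integralD//; try by [move=> y _; rewrite lee_fin sqr_ge0|apply/measurable_EFinP; exact: measurable_funX].
by rewrite muleA -EFinM.
Qed.

(** Folding the first frequency onto the half-line removes the mixed terms of A and B; exchanging
    the integrals then leaves, for each y, the half-line identity [plancherel_line]. The constants
    combine as 2 (2 pi)^n pi. *)
Lemma plancherel_step :
  (\int[leb n.+1]_xi (power f xi)%:E = ((2 * pi) ^+ n.+1)%:E * \int[leb n.+1]_x (f x ^+ 2)%:E)%E.
Proof.
rewrite ge0_integral_RnS; last 2 first.
- by apply/measurable_EFinP; exact: measurable_power.
- by move=> x; rewrite lee_fin power_ge0.
transitivity (\int[mu]_a G a)%E; first by [].
have G0 a : (0 <= G a)%E by apply: integral_ge0 => z _; rewrite lee_fin power_ge0.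
rewrite ge0_integral_fold//.
under eq_integral do rewrite G_fold.
have mAB2 : measurable_fun setT (fun z : measurableTypeR R * Rn R n => AB2 z.1 z.2).
  by apply: measurable_funD; apply: measurable_funX.
rewrite ge0_integralZl//; last 3 first.
- apply: measurable_funTS.
  apply: (measurable_fun_fubini_tonelli_F (m2 := leb n) (fun w : measurableTypeR R * Rn R n => (AB2 w.1 w.2)%:E)) => //.
  + exact/measurable_EFinP.
  + by move=> w; rewrite lee_fin.
- by move=> a _; apply: integral_ge0 => y _; rewrite lee_fin.
- by rewrite lee_fin mulr_ge0// exprn_ge0// mulr_ge0// pi_ge0.
rewrite (_ : (2 * pi) ^+ n.+1 = 2 * (2 * pi) ^+ n * pi :> R); last by rewrite exprSr; ring.
rewrite [in RHS]EFinM -muleA; congr (_ * _)%E.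
(* Extension by 0 to negative frequencies, so that Tonelli's theorem can be used on the whole
   product. *)
pose H (w : measurableTypeR R * Rn R n) := if 0 <= w.1 then AB2 w.1 w.2 else 0.
have mH : measurable_fun setT H.
  apply: measurable_fun_if => //.
  - by apply: measurable_fun_ler => //; exact: measurable_fst.
  - exact: measurable_funTS.
transitivity (\int[mu]_a \int[leb n]_y (H (a, y))%:E)%E.
  rewrite [LHS]integral_mkcond; apply: eq_integral => a _.
  rewrite patchE mem_setE in_itv /= andbT /H /=; case: ifP => // _.
  by rewrite integral0.
have H0 w : 0 <= H w by rewrite /H; case: ifP.
rewrite (@fubini_tonelli _ _ _ _ _ mu (leb n) (EFin \o H)); last 2 first.
- exact/measurable_EFinP.
- by move=> w; rewrite lee_fin.
rewrite ge0_integral_RnS2; last 2 first.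
- by apply/measurable_EFinP; exact: measurable_funX.
- by move=> w; rewrite lee_fin sqr_ge0.
rewrite -ge0_integralZl//; last 3 first.
- apply: (measurable_fun_fubini_tonelli_G (m1 := mu) (fun w : measurableTypeR R * Rn R n => (f (cons_Rn (w.1, w.2)) ^+ 2)%:E)).
  + by apply/measurable_EFinP; apply: measurable_funX; apply: mf_cons.
  + by move=> w; rewrite lee_fin sqr_ge0.
- by move=> y _; apply: integral_ge0 => x _; rewrite lee_fin sqr_ge0.
- by rewrite lee_fin pi_ge0.
apply: eq_integral => y _.
have <- := @plancherel_line R _ C M C0 (mfx y) (fun x => fCx x y).
rewrite [RHS]integral_mkcond; apply: eq_integral => a _.
by rewrite patchE mem_setE in_itv /= andbT /H /=; case: ifP.
Qed.

End plancherel_step.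

Lemma plancherel_band n (f : Rn R n -> R) (C M : R) : 0 < C -> measurable_fun setT f ->
  (forall x, `|f x| <= C * bandn M x) ->
  (\int[leb n]_xi (power f xi)%:E = ((2 * pi) ^+ n)%:E * \int[leb n]_x (f x ^+ 2)%:E)%E.
Proof.
elim: n f C M => [|n IHn] f C M C0 mf fC; last exact: (plancherel_step C0 mf fC IHn).
rewrite expr0 mul1e.
rewrite integral_Rn0; last by apply/measurable_EFinP; exact: measurable_power.
rewrite integral_Rn0; last by apply/measurable_EFinP; exact: measurable_funX.
congr EFin; rewrite /power /cosT /sinT /Rintegral.
have d0 x y : @dotp R 0 x y = 0 by rewrite /dotp big_ord0.
rewrite !integral_Rn0 ?d0 /=.
- by rewrite cos0 sin0 mulr1 mulr0 expr0n addr0.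
- by apply/measurable_EFinP; under eq_fun do rewrite d0; exact: measurable_funM.
- by apply/measurable_EFinP; under eq_fun do rewrite d0; exact: measurable_funM.
Qed.

End Rn_integrals.

Lemma lee_cvg0D {R : realType} (x y : \bar R) (e_ : nat -> \bar R) :
  (forall m, x <= y + e_ m)%E -> e_ @ \oo --> 0%E -> (x <= y)%E.
Proof.
move=> xy e0.
have yD : (y \is a fin_num \/ y = +oo \/ y = -oo)%E by case: y {xy} => [r||]; [left|right;left|right;right].
have [-> | yoo] := eqVneq y +oo%E; first by rewrite leey.
have : (fun m => y + e_ m)%E @ \oo --> (y + 0)%E by apply: cvgeD => //; [rewrite fin_num_adde_defl|exact: cvg_cst].
by rewrite adde0; apply: cvge_ge; exact: nearW.
Qed.

(** * Plancherel up to constants for integrable functions *)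

Section plancherel.
Context {R : realType} (n : nat).
Local Notation leb := (lebesgue_Rn R n).
Implicit Types f g h : Rn R n -> R.

(** The integrated form of (a + b)^2 <= 2 a^2 + 2 b^2. It stands in for the triangle inequality in
    L^2, with integrals that may be infinite. *)
Lemma le_integral_sqr_split f g h : measurable_fun setT f -> measurable_fun setT g ->
  measurable_fun setT h -> (forall x, 0 <= f x <= 2 * g x + 2 * h x) ->
  (forall x, 0 <= g x) -> (forall x, 0 <= h x) ->
  (\int[leb]_x (f x)%:E <= 2%:E * \int[leb]_x (g x)%:E + 2%:E * \int[leb]_x (h x)%:E)%E.
Proof.
move=> mf mg mh fgh g0 h0.
have e2 (k : Rn R n -> R) : measurable_fun setT k -> (forall x, 0 <= k x) ->
    (2%:E * \int[leb]_x (k x)%:E = \int[leb]_x (2 * k x)%:E)%E.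
  move=> mk k0; rewrite -ge0_integralZl//; first exact/measurable_EFinP.
  by move=> x _; rewrite lee_fin.
rewrite !e2// -ge0_integralD//; last 4 first.
- by move=> x _; rewrite lee_fin mulr_ge0.
- by apply/measurable_EFinP; exact: measurable_funM.
- by move=> x _; rewrite lee_fin mulr_ge0.
- by apply/measurable_EFinP; exact: measurable_funM.
apply: ge0_le_integral => //.
- by move=> x _; rewrite lee_fin; case/andP: (fgh x).
- exact/measurable_EFinP.
- apply/measurable_EFinP; apply: measurable_funD; exact: measurable_funM.
- by move=> x _; rewrite -EFinD lee_fin; case/andP: (fgh x).
Qed.

Lemma integrable_trig f (u : Rn R n -> R) : (leb).-integrable setT (EFin \o f) ->
  measurable_fun setT u -> (forall x, `|u x| <= 1) ->
  leb.-integrable setT (EFin \o (fun x => f x * u x)).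
Proof.
move=> fi mu u1; have /measurable_EFinP mf := measurable_int _ fi.
apply: (integrable_dominated (g := fun x => `|f x|)).
- exact: measurable_funM.
- exact: (integrable_norm fi).
- by move=> x; rewrite normrM -[leRHS]mulr1 ler_pM.
Qed.

Lemma measurable_cosdot (xi : Rn R n) : measurable_fun setT (fun x => cos (dotp x xi)).
Proof. by apply: measurable_cos_comp; exact: measurable_dotp. Qed.

Lemma measurable_sindot (xi : Rn R n) : measurable_fun setT (fun x => sin (dotp x xi)).
Proof. by apply: measurable_sin_comp; exact: measurable_dotp. Qed.

Lemma powerB f g xi : leb.-integrable setT (EFin \o f) -> leb.-integrable setT (EFin \o g) ->
  power (fun x => f x - g x) xi = (cosT f xi - cosT g xi) ^+ 2 + (sinT f xi - sinT g xi) ^+ 2.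
Proof.
move=> fi gi; rewrite /power; congr (_ ^+ 2 + _ ^+ 2).
  rewrite /cosT -RintegralB//; last 2 first.
  - by apply: integrable_trig => // [|x]; [exact: measurable_cosdot|exact: cos_max].
  - by apply: integrable_trig => // [|x]; [exact: measurable_cosdot|exact: cos_max].
  by apply: eq_Rintegral => x _; ring.
rewrite /sinT -RintegralB//; last 2 first.
- by apply: integrable_trig => // [|x]; [exact: measurable_sindot|exact: sin_max].
- by apply: integrable_trig => // [|x]; [exact: measurable_sindot|exact: sin_max].
by apply: eq_Rintegral => x _; ring.
Qed.

Definition truncation (m : nat) f (x : Rn R n) : R :=
  if `|f x| <= m%:R then f x * bandn m%:R x else 0.

Lemma measurable_truncation m f : measurable_fun setT f -> measurable_fun setT (truncation m f).
Proof.
move=> mf; apply: measurable_fun_if => //.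
- by apply: measurable_fun_ler => //; exact: measurableT_comp.
- by apply: measurable_funTS; apply: measurable_funM => //; exact: measurable_bandn.
Qed.

(** The constant is m + 1 instead of m in order to be positive at m = 0, as [plancherel_band]
    demands. *)
Lemma truncation_le_band m f x : `|truncation m f x| <= m.+1%:R * bandn m%:R x.
Proof.
rewrite /truncation; case: ifP => fm; last by rewrite normr0 mulr_ge0// bandn_ge0.
rewrite normrM (ger0_norm (bandn_ge0 _ _)) ler_wpM2r ?bandn_ge0//.
by apply: le_trans fm _; rewrite ler_nat.
Qed.

Lemma truncation_le m f x : `|truncation m f x| <= `|f x|.
Proof.
rewrite /truncation; case: ifP => fm; last by rewrite normr0.
by rewrite normrM (ger0_norm (bandn_ge0 _ _)) ler_piMr// bandn_le1.
Qed.

Lemma truncation_near f x : \forall m \near \oo, truncation m f x = f x.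
Proof.
pose M := `|f x| + \sum_(i < n) `|tnth x i|.
near=> m.
have Mm : M <= m%:R by near: m; exact: nbhs_infty_ger.
rewrite /truncation ifT; last first.
  by apply: le_trans Mm; rewrite lerDl sumr_ge0.
rewrite /bandn big1 ?mulr1// => i _; apply: band1; apply: le_trans Mm.
rewrite /M (bigD1 i)//= addrCA lerDl addr_ge0// sumr_ge0//.
Unshelve. all: by end_near. Qed.

Lemma cvg_truncation f x : (fun m => truncation m f x) @ \oo --> f x.
Proof.
apply: cvg_near_cst; exact: truncation_near.
Qed.

Lemma cvg_cosT_truncation f xi : leb.-integrable setT (EFin \o f) ->
  (fun m => cosT (truncation m f) xi) @ \oo --> cosT f xi.
Proof.
move=> fi; have /measurable_EFinP mf := measurable_int _ fi.
apply: (cvg_Rintegral (g := fun x => `|f x|)).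
- by move=> m; apply: measurable_funM; [exact: measurable_truncation|exact: measurable_cosdot].
- by apply: measurable_funM => //; exact: measurable_cosdot.
- by move=> x; apply: cvgM; [exact: cvg_truncation|exact: cvg_cst].
- exact: (integrable_norm fi).
- by move=> m x; rewrite normrM -[leRHS]mulr1 ler_pM ?truncation_le ?cos_max.
Qed.

Lemma cvg_sinT_truncation f xi : leb.-integrable setT (EFin \o f) ->
  (fun m => sinT (truncation m f) xi) @ \oo --> sinT f xi.
Proof.
move=> fi; have /measurable_EFinP mf := measurable_int _ fi.
apply: (cvg_Rintegral (g := fun x => `|f x|)).
- by move=> m; apply: measurable_funM; [exact: measurable_truncation|exact: measurable_sindot].
- by apply: measurable_funM => //; exact: measurable_sindot.
- by move=> x; apply: cvgM; [exact: cvg_truncation|exact: cvg_cst].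
- exact: (integrable_norm fi).
- by move=> m x; rewrite normrM -[leRHS]mulr1 ler_pM ?truncation_le ?sin_max.
Qed.

Lemma plancherel_truncation m f : measurable_fun setT f ->
  (\int[leb]_xi (power (truncation m f) xi)%:E =
   ((2 * pi) ^+ n)%:E * \int[leb]_x (truncation m f x ^+ 2)%:E)%E.
Proof.
move=> mf; apply: (plancherel_band (C := m.+1%:R) (M := m%:R)) => //.
  exact: measurable_truncation.
exact: truncation_le_band.
Qed.

Lemma twopiXn_ge0 : 0 <= (2 * pi : R) ^+ n.
Proof. by rewrite exprn_ge0// mulr_ge0// pi_ge0. Qed.

Lemma twopiXn_gt0 : 0 < (2 * pi : R) ^+ n.
Proof. by rewrite exprn_gt0// mulr_gt0// pi_gt0. Qed.

(** Fatou's lemma along the truncations: their transforms converge pointwise because f is in L^1,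
    and their L^2 norms stay below that of f, which may be infinite. *)
Lemma bessel f : leb.-integrable setT (EFin \o f) ->
  (\int[leb]_xi (power f xi)%:E <= ((2 * pi) ^+ n)%:E * \int[leb]_x (f x ^+ 2)%:E)%E.
Proof.
move=> fi; have /measurable_EFinP mf := measurable_int _ fi.
have mtr m := measurable_truncation m mf.
rewrite (_ : integral _ _ _ = \int[leb]_xi limn_einf (fun m => (power (truncation m f) xi)%:E))%E; last first.
  apply: eq_integral => xi _.
  have /cvg_limn_einf_sup[-> _]// : (fun m => (power (truncation m f) xi)%:E) @ \oo --> (power f xi)%:E.
  apply: cvg_EFin; first exact: nearW.
  apply: cvgD; rewrite expr2; under eq_fun do rewrite expr2.
    by apply: cvgM; exact: cvg_cosT_truncation.
  by apply: cvgM; exact: cvg_sinT_truncation.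
apply: le_trans (@fatou _ _ _ leb setT measurableT (fun m xi => (power (truncation m f) xi)%:E) _ _) _.
- by move=> m; apply/measurable_EFinP; exact: measurable_power.
- by move=> m x _; rewrite lee_fin power_ge0.
rewrite limn_einf_lim; apply: lime_le; first exact: is_cvg_einfs.
apply: nearW => m; apply: (@le_trans _ _ (\int[leb]_x (power (truncation m f) x)%:E)%E).
  by apply: ereal_inf_lbound; exists m => /=.
rewrite plancherel_truncation//.
apply: lee_wpmul2l; first by rewrite lee_fin twopiXn_ge0.
apply: ge0_le_integral => //.
- by move=> x _; rewrite lee_fin sqr_ge0.
- by apply/measurable_EFinP; exact: measurable_funX.
- by apply/measurable_EFinP; exact: measurable_funX.
- by move=> x _; rewrite lee_fin -[leLHS]real_normK ?num_real// -[leRHS]real_normK ?num_real// ler_pXn2r ?nnegrE ?truncation_le.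
Qed.

Lemma cvg_truncation_sqr f : measurable_fun setT f -> leb.-integrable setT (EFin \o (fun x => f x ^+ 2)) ->
  (fun m => \int[leb]_x ((f x - truncation m f x) ^+ 2)%:E)%E @ \oo --> 0%E.
Proof.
move=> mf f2i.
have [||||_ _ +] := @dominated_convergence _ _ _ leb setT measurableT
  (fun m x => ((f x - truncation m f x) ^+ 2)%:E) (cst 0%E) (EFin \o (fun x => f x ^+ 2)) _ _ _ f2i.
- by move=> m; apply/measurable_EFinP; apply: measurable_funX; apply: measurable_funB => //; exact: measurable_truncation.
- by [].
- apply: aeW => x _; apply: cvg_near_cst; near=> m.
  by rewrite (near (truncation_near f x) m)// subrr expr0n.
- apply: aeW => x m _ /=; rewrite lee_fin ger0_norm ?sqr_ge0//.
  rewrite /truncation; case: ifP => _; last by rewrite subr0.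
  rewrite -{1}[f x]mulr1 -mulrBr exprMn ler_piMr ?sqr_ge0//.
  by rewrite expr_le1// ?subr_ge0 ?bandn_le1// lerBlDr lerDl bandn_ge0.
by rewrite integral0.
Unshelve. all: by end_near. Qed.

Lemma sqrr_le2 (a b : R) : a ^+ 2 <= 2 * b ^+ 2 + 2 * (a - b) ^+ 2.
Proof. by have := sqr_ge0 (a - 2 * b); nra. Qed.

(* The truncations are close to f in L^2, hence their transforms are close to
   that of f by Bessel's inequality. *)
Lemma plancherel_lower f : leb.-integrable setT (EFin \o f) ->
  leb.-integrable setT (EFin \o (fun x => f x ^+ 2)) ->
  (((2 * pi) ^+ n)%:E * \int[leb]_x (f x ^+ 2)%:E <= 4%:E * \int[leb]_xi (power f xi)%:E)%E.
Proof.
move=> fi f2i; have /measurable_EFinP mf := measurable_int _ fi.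
have mtr m := measurable_truncation m mf.
set P := ((2 * pi) ^+ n).
pose e_ m := (\int[leb]_x ((f x - truncation m f x) ^+ 2)%:E)%E.
(* 6 = 2 + 2 * 2: the truncation error enters once when f is compared with its truncation, and once
   more, doubled, when the transforms are compared. *)
apply: (@lee_cvg0D _ _ _ (fun m => (6 * P)%:E * e_ m)%E); last first.
  by rewrite -(mule0 (6 * P)%:E); apply: cvgeZl => //; exact: cvg_truncation_sqr.
move=> m.
have tri : leb.-integrable setT (EFin \o truncation m f).
  by apply: (integrable_bandnM (mtr m)); exact: truncation_le_band.
have h1 : (\int[leb]_x (f x ^+ 2)%:E <= 2%:E * \int[leb]_x (truncation m f x ^+ 2)%:E + 2%:E * e_ m)%E.
  apply: le_integral_sqr_split => [||||x|x]; rewrite ?sqr_ge0//.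
  - exact: measurable_funX.
  - exact: measurable_funX.
  - by apply: measurable_funX; exact: measurable_funB.
  - by move=> x; rewrite sqr_ge0 sqrr_le2.
have h2 : (\int[leb]_xi (power (truncation m f) xi)%:E <= 2%:E * \int[leb]_xi (power f xi)%:E +
    2%:E * \int[leb]_xi (power (fun x => f x - truncation m f x) xi)%:E)%E.
  apply: le_integral_sqr_split => [||||x|x]; rewrite ?power_ge0//.
  - exact: measurable_power.
  - exact: measurable_power.
  - by apply: measurable_power; exact: measurable_funB.
  - move=> xi; rewrite power_ge0 /= powerB// /power.
    have := sqrr_le2 (cosT (truncation m f) xi) (cosT f xi).
    have := sqrr_le2 (sinT (truncation m f) xi) (sinT f xi).
    rewrite -[(sinT (truncation m f) xi - sinT f xi) ^+ 2]sqrrN opprB.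
    rewrite -[(cosT (truncation m f) xi - cosT f xi) ^+ 2]sqrrN opprB.
    lra.
have h3 : (\int[leb]_xi (power (fun x => f x - truncation m f x) xi)%:E <= P%:E * e_ m)%E.
  by apply: bessel; exact: (integrableB measurableT fi tri).
rewrite plancherel_truncation// -/P in h2.
have P0 : 0 <= P := twopiXn_ge0.
have e0 : (0 <= e_ m)%E by apply: integral_ge0 => x _; rewrite lee_fin sqr_ge0.
have p0 : (0 <= \int[leb]_xi (power f xi)%:E)%E by apply: integral_ge0 => x _; rewrite lee_fin power_ge0.
have t0 : (0 <= \int[leb]_x (truncation m f x ^+ 2)%:E)%E by apply: integral_ge0 => x _; rewrite lee_fin sqr_ge0.
apply: le_trans (lee_wpmul2l _ h1) _; first by rewrite lee_fin.
rewrite ge0_muleDr ?mule_ge0// muleCA [(P%:E * (2 * e_ m))%E]muleCA.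
apply: (@le_trans _ _ (2%:E * (2%:E * \int[leb]_xi (power f xi)%:E + 2%:E * (P%:E * e_ m)) + 2%:E * (P%:E * e_ m))%E).
  apply: leeD => //; apply: lee_wpmul2l => //.
  by apply: le_trans h2 _; apply: leeD => //; apply: lee_wpmul2l.
rewrite ge0_muleDr ?mule_ge0// !muleA -!EFinM -addeA -ge0_muleDl ?lee_fin ?mulr_ge0//.
rewrite -EFinD; apply: leeD; first by rewrite -natrM.
by rewrite (_ : 2 * 2 * P + 2 * P = 6 * P)//; ring.
Qed.

End plancherel.

(** * Two-sided norm bounds for the Fourier-Plancherel transform *)

Section fourier_L2.
Context {R : realType} (n : nat).
Local Notation leb := (lebesgue_Rn R n).
Implicit Types f : Rn R n -> R.

Lemma L2norm_sqr f : (L2norm f `^ 2 = \int[leb]_x (f x ^+ 2)%:E)%E.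
Proof.
rewrite /L2norm powR_Lnorm//; apply: eq_integral => x _ /=.
by rewrite powR_mulrn// real_normK// num_real.
Qed.

Lemma L2norm_ge0 f : (0 <= L2norm f)%E.
Proof. exact: Lnorm_ge0. Qed.

Lemma L2norm_le f (a : R) : 0 <= a -> (\int[leb]_x (f x ^+ 2)%:E <= (a ^+ 2)%:E)%E -> (L2norm f <= a%:E)%E.
Proof.
move=> a0; rewrite -L2norm_sqr; move: (L2norm_ge0 f); case: (L2norm f) => [r|//|//].
- rewrite lee_fin => r0; rewrite poweR_EFin lee_fin powR_mulrn// => h.
  by rewrite lee_fin -(@ler_pXn2r _ 2) ?nnegrE.
- by move=> _; rewrite poweRyr// leye_eq.
Qed.

Lemma L2norm_ge f (a : R) : 0 <= a -> ((a ^+ 2)%:E <= \int[leb]_x (f x ^+ 2)%:E)%E -> (a%:E <= L2norm f)%E.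
Proof.
move=> a0; rewrite -L2norm_sqr; move: (L2norm_ge0 f); case: (L2norm f) => [r|//|//].
- rewrite lee_fin => r0; rewrite poweR_EFin lee_fin powR_mulrn// => h.
  by rewrite lee_fin -(@ler_pXn2r _ 2) ?nnegrE.
- by move=> _ _; rewrite leey.
Qed.

Lemma measurable_enorm : measurable_fun setT (@enorm R n).
Proof.
apply: (@measurableT_comp _ _ _ _ _ _ (@Num.sqrt R)).
  by apply: continuous_measurable_fun => x; exact: sqrt_continuous.
exact: measurable_dotp.
Qed.

Lemma normr_tnth_le_enorm (x : Rn R n) i : `|tnth x i| <= enorm x.
Proof.
rewrite -(@ler_pXn2r _ 2) ?nnegrE ?sqrtr_ge0// sqr_sqrtr; last first.
  by apply: sumr_ge0 => j _; rewrite -expr2 sqr_ge0.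
rewrite real_normK ?num_real// /dotp (bigD1 i)//= -expr2 lerDl.
by apply: sumr_ge0 => j _; rewrite -expr2 sqr_ge0.
Qed.

Lemma measurable_ball_cut f m : measurable_fun setT f -> measurable_fun setT (ball_cut f m).
Proof.
move=> mf; apply: measurable_fun_if => //.
- by apply: measurable_fun_ler => //; exact: measurable_enorm.
- exact: measurable_funTS.
Qed.

Lemma ball_cut_sqr_le f m x : ball_cut f m x ^+ 2 <= f x ^+ 2.
Proof. by rewrite /ball_cut; case: ifP => // _; rewrite expr0n sqr_ge0. Qed.

Lemma sub_ball_cut_sqr_le f m x : (f x - ball_cut f m x) ^+ 2 <= f x ^+ 2.
Proof. by rewrite /ball_cut; case: ifP => _; rewrite ?subrr ?expr0n ?sqr_ge0 ?subr0. Qed.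

Variable f : Rn R n -> R.
Hypothesis fL2 : f \in Lfun leb 2%:E.

Let f2i : leb.-integrable setT (EFin \o (fun x => f x ^+ 2)).
Proof. exact: Lfun2_integrable_sqr. Qed.

Let mf : measurable_fun setT f.
Proof. by move: fL2; rewrite inE => /andP[+ _]; rewrite inE. Qed.

(** On the ball |f| <= 1 + f^2, and the ball lies in the cube where [bandn] equals 1. *)
Lemma integrable_ball_cut m : leb.-integrable setT (EFin \o ball_cut f m).
Proof.
apply: (integrable_dominated (g := fun x => bandn m%:R x + f x ^+ 2)).
- exact: measurable_ball_cut.
- exact: (integrableD measurableT (integrable_bandn n m%:R) f2i).
- move=> x; rewrite /ball_cut; case: ifP => xm; last by rewrite normr0 addr_ge0 ?bandn_ge0 ?sqr_ge0.
  rewrite /bandn big1 => [|i _]; last by apply: band1; apply: le_trans xm; exact: normr_tnth_le_enorm.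
  by rewrite -[f x ^+ 2]real_normK ?num_real//; have := sqr_ge0 (`|f x| - 1); have := normr_ge0 (f x); nra.
Qed.

Lemma integrable_ball_cut_sqr m : leb.-integrable setT (EFin \o (fun x => ball_cut f m x ^+ 2)).
Proof.
apply: (integrable_dominated (g := fun x => f x ^+ 2)) => //.
- by apply: measurable_funX; exact: measurable_ball_cut.
- by move=> x; rewrite ger0_norm ?sqr_ge0// ball_cut_sqr_le.
Qed.

Lemma cvg_ball_cut_sqr :
  (fun m => \int[leb]_x ((f x - ball_cut f m x) ^+ 2)%:E)%E @ \oo --> 0%E.
Proof.
have [||||_ _ +] := @dominated_convergence _ _ _ leb setT measurableT
  (fun m x => ((f x - ball_cut f m x) ^+ 2)%:E) (cst 0%E) (EFin \o (fun x => f x ^+ 2)) _ _ _ f2i.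
- by move=> m; apply/measurable_EFinP; apply: measurable_funX; apply: measurable_funB => //; exact: measurable_ball_cut.
- by [].
- apply: aeW => x _; apply: cvg_near_cst; near=> m.
  rewrite /ball_cut ifT ?subrr ?expr0n//.
  by near: m; exact: nbhs_infty_ger.
- by apply: aeW => x m _ /=; rewrite lee_fin ger0_norm ?sqr_ge0// sub_ball_cut_sqr_le.
by rewrite integral0.
Unshelve. all: by end_near. Qed.

Variable g : Rn R n -> R[i].
Hypothesis fg : is_fourier_L2 f g.

Let sqnorm xi := complex.Re (g xi) ^+ 2 + complex.Im (g xi) ^+ 2.

Let err m xi := complex.Re (g xi - fourier (ball_cut f m) xi) ^+ 2
           + complex.Im (g xi - fourier (ball_cut f m) xi) ^+ 2.

Let errE m xi : err m xi = (complex.Re (g xi) - cosT (ball_cut f m) xi) ^+ 2 +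
  (complex.Im (g xi) + sinT (ball_cut f m) xi) ^+ 2.
Proof. by rewrite /err /fourier; case: (g xi) => a c /=; rewrite opprK. Qed.

Let msq : measurable_fun setT sqnorm.
Proof. by case: fg => _ m1 m2 _; apply: measurable_funD; exact: measurable_funX. Qed.

Let merr m : measurable_fun setT (err m).
Proof.
rewrite (funext (errE m)); case: fg => _ m1 m2 _.
apply: measurable_funD; apply: measurable_funX.
- by apply: measurable_funB => //; apply: measurable_cosT; exact: measurable_ball_cut.
- by apply: measurable_funD => //; apply: measurable_sinT; exact: measurable_ball_cut.
Qed.

Let mpow m : measurable_fun setT (power (ball_cut f m)).
Proof. by apply: measurable_power; exact: measurable_ball_cut. Qed.

Let sq0 xi : 0 <= sqnorm xi. Proof. by rewrite addr_ge0 ?sqr_ge0. Qed.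
Let err0 m xi : 0 <= err m xi. Proof. by rewrite addr_ge0 ?sqr_ge0. Qed.

Let ierr : (fun m => \int[leb]_xi (err m xi)%:E)%E @ \oo --> 0%E.
Proof. by case: fg. Qed.

Let int0 (h : Rn R n -> R) : (forall x, 0 <= h x) -> (0 <= \int[leb]_x (h x)%:E)%E.
Proof. by move=> h0; apply: integral_ge0 => x _; rewrite lee_fin. Qed.

(** [plancherel_lower] for the ball cuts, placed between two squared triangle inequalities, from f
    to its cuts and from their transforms to g: 16 = 2 * 4 * 2. It bounds f from above by its
    transform. *)
Lemma fourier_L2_upper :
  (((2 * pi) ^+ n)%:E * \int[leb]_x (f x ^+ 2)%:E <= 16%:E * \int[leb]_xi (sqnorm xi)%:E)%E.
Proof.
set P := ((2 * pi) ^+ n); have P0 : 0 <= P by exact: twopiXn_ge0.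
pose d m := (\int[leb]_x ((f x - ball_cut f m x) ^+ 2)%:E)%E.
pose e m := (\int[leb]_xi (err m xi)%:E)%E.
apply: (@lee_cvg0D _ _ _ (fun m => (2 * P)%:E * d m + 16%:E * e m)%E); last first.
  rewrite -[X in _ --> X](adde0 0%E); apply: cvgeD => //.
    by rewrite -(mule0 (2 * P)%:E); apply: cvgeZl => //; exact: cvg_ball_cut_sqr.
  by rewrite -(mule0 16%:E); apply: cvgeZl.
move=> m; have mb := measurable_ball_cut m mf.
have h1 : (\int[leb]_x (f x ^+ 2)%:E <= 2%:E * \int[leb]_x (ball_cut f m x ^+ 2)%:E + 2%:E * d m)%E.
  apply: le_integral_sqr_split => [||||x|x]; rewrite ?sqr_ge0//.
  - exact: measurable_funX.
  - exact: measurable_funX.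
  - by apply: measurable_funX; exact: measurable_funB.
  - by move=> x; rewrite sqr_ge0 sqrr_le2.
have h2 := plancherel_lower (integrable_ball_cut m) (integrable_ball_cut_sqr m).
have h3 : (\int[leb]_xi (power (ball_cut f m) xi)%:E <= 2%:E * \int[leb]_xi (sqnorm xi)%:E + 2%:E * e m)%E.
  apply: le_integral_sqr_split => // xi; rewrite power_ge0 /= errE /power /sqnorm.
  have := sqrr_le2 (cosT (ball_cut f m) xi) (complex.Re (g xi)).
  have := sqrr_le2 (- sinT (ball_cut f m) xi) (complex.Im (g xi)).
  rewrite sqrrN -[(- _ - _) ^+ 2]sqrrN opprB opprK.
  rewrite -[(cosT (ball_cut f m) xi - _) ^+ 2]sqrrN opprB.
  lra.
rewrite -/P in h2.
have d0 : (0 <= d m)%E by apply: int0 => x; rewrite sqr_ge0.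
have e0 : (0 <= e m)%E by apply: int0.
have s0 : (0 <= \int[leb]_xi (sqnorm xi)%:E)%E by apply: int0.
have b0 : (0 <= \int[leb]_x (ball_cut f m x ^+ 2)%:E)%E by apply: int0 => x; rewrite sqr_ge0.
apply: le_trans (lee_wpmul2l _ h1) _; first by rewrite lee_fin.
rewrite ge0_muleDr ?mule_ge0// muleCA [(P%:E * (2 * d m))%E]muleCA.
apply: (@le_trans _ _ (2%:E * (4%:E * (2%:E * \int[leb]_xi (sqnorm xi)%:E + 2%:E * e m)) + 2%:E * (P%:E * d m))%E).
  apply: leeD => //; apply: lee_wpmul2l => //.
  by apply: le_trans h2 _; apply: lee_wpmul2l.
rewrite (@ge0_muleDr _ 4%:E) ?mule_ge0// ge0_muleDr ?mule_ge0//.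
rewrite !muleA -!EFinM -!natrM -addeA; apply: leeD => //.
by rewrite addeC.
Qed.

(** Bessel's inequality for the ball cuts, which are dominated by f; the factor 2 comes from
    comparing their transforms with g. *)
Lemma fourier_L2_lower :
  (\int[leb]_xi (sqnorm xi)%:E <= (2 * (2 * pi) ^+ n)%:E * \int[leb]_x (f x ^+ 2)%:E)%E.
Proof.
set P := ((2 * pi) ^+ n); have P0 : 0 <= P by exact: twopiXn_ge0.
pose e m := (\int[leb]_xi (err m xi)%:E)%E.
apply: (@lee_cvg0D _ _ _ (fun m => 2%:E * e m)%E); last first.
  by rewrite -(mule0 2%:E); apply: cvgeZl.
move=> m; have mb := measurable_ball_cut m mf.
have h3 : (\int[leb]_xi (sqnorm xi)%:E <= 2%:E * \int[leb]_xi (power (ball_cut f m) xi)%:E + 2%:E * e m)%E.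
  apply: le_integral_sqr_split => // [xi|xi]; last exact: power_ge0.
  rewrite sq0 /= errE /power /sqnorm.
  have := sqrr_le2 (complex.Re (g xi)) (cosT (ball_cut f m) xi).
  have := sqrr_le2 (complex.Im (g xi)) (- sinT (ball_cut f m) xi).
  by rewrite sqrrN opprK; lra.
apply: le_trans h3 _; apply: leeD => //.
rewrite EFinM -muleA; apply: lee_wpmul2l => //.
apply: le_trans (bessel (integrable_ball_cut m)) _; apply: lee_wpmul2l; first by rewrite lee_fin.
apply: ge0_le_integral => //.
- by move=> x _; rewrite lee_fin sqr_ge0.
- by apply/measurable_EFinP; exact: measurable_funX.
- by apply/measurable_EFinP; exact: measurable_funX.
- by move=> x _; rewrite lee_fin ball_cut_sqr_le.
Qed.

End fourier_L2.

(** * The damped oscillator *)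

Section halfline_calculus.
Context {R : realType}.

(** The equations hold for t > 0 only, while the data are taken at t = 0. The mean value theorem
    asks for no more than continuity up to 0. *)
Lemma MVT_halfline (f df : R -> R) (t : R) : 0 < t ->
  {within `[0, +oo[, continuous f} -> (forall s : R, 0 < s -> is_derive s 1 f (df s)) ->
  exists2 s : R, 0 < s & f t - f 0 = df s * t.
Proof.
move=> t0 cf dF.
have cf' : {within `[0, t], continuous f}.
  by apply: continuous_subspaceW cf => x /=; rewrite !in_itv /= => /andP[->].
have dF' s : s \in `]0, t[%R -> is_derive s 1 f (df s).
  by rewrite in_itv /= => /andP[s0 _]; exact: dF.
have [s + ->] := MVT t0 dF' cf'.
by rewrite in_itv /= subr0 => /andP[s0 _]; exists s.
Qed.

Lemma le0_derive_halfline (f df : R -> R) (t : R) : 0 <= t ->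
  {within `[0, +oo[, continuous f} -> (forall s : R, 0 < s -> is_derive s 1 f (df s)) ->
  (forall s : R, 0 < s -> df s <= 0) -> f t <= f 0.
Proof.
rewrite le_eqVlt => /orP[/eqP<- //|t0] cf dF df0.
have [s s0 fs] := MVT_halfline t0 cf dF.
by rewrite -subr_le0 fs mulr_le0_ge0 ?df0// ltW.
Qed.

Lemma le_derive_halfline (f df : R -> R) (t K : R) : 0 <= t ->
  {within `[0, +oo[, continuous f} -> (forall s : R, 0 < s -> is_derive s 1 f (df s)) ->
  (forall s : R, 0 < s -> `|df s| <= K) -> `|f t - f 0| <= K * t.
Proof.
rewrite le_eqVlt => /orP[/eqP<- _ _ _|t0 cf dF dfK].
  by rewrite subrr normr0 mulr0.
have [s s0 ->] := MVT_halfline t0 cf dF.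
by rewrite normrM (gtr0_norm t0) ler_wpM2r ?dfK// ltW.
Qed.

End halfline_calculus.

Section damped_oscillator.
Context {R : realType}.
Variables (b kappa gamma : R).
Hypotheses (b0 : 0 < b) (kappa0 : 0 < kappa) (gamma0 : 0 < gamma).

Record oscillator (r : R) (w v G : R -> R) : Prop := Oscillator {
  osc_cw : {within `[0, +oo[, continuous w};
  osc_cv : {within `[0, +oo[, continuous v};
  osc_cG : {within `[0, +oo[, continuous G};
  osc_dw : forall t : R, 0 < t -> is_derive t 1 w (v t);
  osc_dv : forall t : R, 0 < t -> is_derive t 1 v (- (b ^+ 2 * r ^+ 2 * w t) - G t);
  osc_dG : forall t : R, 0 < t -> is_derive t 1 G (- (kappa * r ^+ 2 * G t) + gamma * r ^+ 2 * v t) }.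

(* For r = 0 the last term is 0, since x / 0 = 0. *)
Definition energy (r w v G : R) : R := v ^+ 2 + b ^+ 2 * r ^+ 2 * w ^+ 2 + G ^+ 2 / (gamma * r ^+ 2).

Lemma energy_ge0 r w v G : 0 <= energy r w v G.
Proof.
by rewrite /energy !(sqr_ge0, addr_ge0, invr_ge0, mulr_ge0)// ltW.
Qed.

(* energy plus small cross terms which detect the dissipation of v and w *)
Definition lyapunov (a r w v G : R) : R :=
  energy r w v G - a * (v * G) / (1 + r ^+ 2) + a * gamma / 2 * (r ^+ 2 * (w * v)) / (1 + r ^+ 2).

(** The derivative of [lyapunov] along the flow. The energy alone yields only -2 kappa / gamma G^2.
    The first cross term adds - a gamma p r^2 v^2, half of which the second one exchanges for
    dissipation of w. The rest has indefinite sign and is absorbed by choosing a small. *)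
Definition lyapunov_rate (a r w v G : R) : R :=
  let p := (1 + r ^+ 2)^-1 in
  - (2 * kappa / gamma - a * p) * G ^+ 2 - a * gamma / 2 * p * r ^+ 2 * (v ^+ 2 + b ^+ 2 * r ^+ 2 * w ^+ 2)
  + a * p * r ^+ 2 * ((b ^+ 2 - gamma / 2) * (w * G) + kappa * (v * G)).

Lemma is_derive_lyapunov (a r : R) w v G (t : R) : 0 < r -> 0 < t -> oscillator r w v G ->
  is_derive t 1 (fun s => lyapunov a r (w s) (v s) (G s)) (lyapunov_rate a r (w t) (v t) (G t)).
Proof.
move=> r0 t0 [_ _ _ /(_ t t0) dw /(_ t t0) dv /(_ t t0) dG].
have p0 : 1 + r ^+ 2 != 0 by rewrite gt_eqF// ltr_wpDr ?sqr_ge0.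
rewrite /lyapunov /energy; apply: is_derive_eq.
rewrite /lyapunov_rate /GRing.scale /=; field.
by rewrite p0 !gt_eqF.
Qed.

Lemma continuous_lyapunov (a r : R) w v G : oscillator r w v G ->
  {within `[0, +oo[, continuous (fun s => lyapunov a r (w s) (v s) (G s))}.
Proof.
move=> [cw cv cG _ _ _] x.
have cst_ (c : R) : (fun=> c) y @[y --> nbhs (x : subspace `[0, +oo[%classic)] --> c by exact: cvg_cst.
have sq (f : R -> R) : {within `[0, +oo[, continuous f} ->
   f y ^+ 2 @[y --> nbhs (x : subspace `[0, +oo[%classic)] --> f x ^+ 2.
  by move=> cf; rewrite expr2; under eq_fun do rewrite expr2; apply: cvgM; exact: cf.
have := (cw x, cv x, cG x).
rewrite /lyapunov /energy => -[[cwx cvx] cGx].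
apply: cvgD; [apply: cvgB; [apply: cvgD; [apply: cvgD|]|]|].
- exact: sq.
- by apply: cvgM => //; exact: sq.
- by apply: cvgM => //; exact: sq.
- by apply: cvgM => //; apply: cvgM => //; apply: cvgM.
- by apply: cvgM => //; apply: cvgM => //; apply: cvgM => //; apply: cvgM.
Qed.

Lemma young (k x y z : R) : 0 < z -> k * (x * y) <= z * x ^+ 2 + k ^+ 2 / (4 * z) * y ^+ 2.
Proof.
move=> z0.
have -> : z * x ^+ 2 + k ^+ 2 / (4 * z) * y ^+ 2 = k * (x * y) + z * (x - k / (2 * z) * y) ^+ 2.
  by field; rewrite gt_eqF.
by rewrite lerDl mulr_ge0 ?sqr_ge0// ltW.
Qed.

(** [lyap_K] bounds the G^2 terms of the wrong sign in [lyapunov_rate], in units of a: 1 is the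
    direct one, the other two come from Young's inequality for w G and v G. [lyap_K'] bounds the
    cross terms of [lyapunov] by the energy. [lyap_a] is small enough for both [lyap_a_K] and
    [lyap_a_K']. *)
Definition lyap_K : R := 1 + 2 * (b ^+ 2 - gamma / 2) ^+ 2 / (gamma * b ^+ 2) + 2 * kappa ^+ 2 / gamma.
Definition lyap_K' : R := (1 + gamma) / 2 + gamma / 4 * (1 + b ^- 2).
Definition lyap_a : R := (gamma / kappa * lyap_K + 2 * lyap_K')^-1.

Lemma lyap_K_ge0 : 0 <= lyap_K.
Proof. by rewrite /lyap_K !(sqr_ge0, addr_ge0, invr_ge0, mulr_ge0)// ltW. Qed.

Lemma lyap_K'_gt0 : 0 < lyap_K'.
Proof.
rewrite /lyap_K' ltr_pwDl ?divr_gt0 ?addr_gt0// mulr_ge0 ?divr_ge0 ?(ltW gamma0)//.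
by rewrite addr_ge0// invr_ge0 sqr_ge0.
Qed.

Lemma lyap_a_gt0 : 0 < lyap_a.
Proof.
rewrite invr_gt0 ltr_wpDl ?mulr_gt0 ?lyap_K'_gt0//.
by rewrite mulr_ge0 ?divr_ge0 ?lyap_K_ge0// ltW.
Qed.

Lemma lyap_a_K : lyap_a * lyap_K <= kappa / gamma.
Proof.
rewrite -ler_pdivlMl ?lyap_a_gt0// /lyap_a invrK mulrDl.
rewrite [leLHS](_ : _ = gamma / kappa * lyap_K * (kappa / gamma)).
  by rewrite lerDl !mulr_ge0 ?invr_ge0 ?(ltW lyap_K'_gt0) ?(ltW kappa0) ?(ltW gamma0).
by field; rewrite !gt_eqF.
Qed.

Lemma lyap_a_K' : lyap_a * lyap_K' <= 2^-1.
Proof.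
rewrite -ler_pdivlMl ?lyap_a_gt0// /lyap_a invrK mulrDl.
rewrite [leLHS](_ : _ = 2 * lyap_K' * 2^-1); last by field.
by rewrite lerDr !mulr_ge0 ?invr_ge0 ?lyap_K_ge0 ?(ltW kappa0) ?(ltW gamma0).
Qed.

(** The weight p = 1 / (1 + r^2) satisfies p^2 r^2 <= 1, which bounds both cross terms by the energy
    uniformly in r, at low and at high frequencies; [lyap_a_K'] brings the factor down to 1/2. *)
Lemma lyapunov_equiv (r w v G : R) : 0 < r ->
  `|lyapunov lyap_a r w v G - energy r w v G| <= energy r w v G / 2.
Proof.
move=> r0.
have r2 : 0 < r ^+ 2 by rewrite exprn_gt0.
set p := (1 + r ^+ 2)^-1.
have p0 : 0 < p by rewrite invr_gt0 addr_gt0.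
have pr : p * r ^+ 2 <= 1 by rewrite mulrC ler_pdivrMr ?addr_gt0// mul1r lerDr.
have p1 : p <= 1 by rewrite invf_le1 ?addr_gt0// lerDl ltW.
have ppr : p * r ^+ 2 * p <= 1.
  by apply: mulr_ile1 => //; [exact: mulr_ge0 (ltW p0) (ltW r2)|exact: ltW].
pose Z := G ^+ 2 / (gamma * r ^+ 2).
have Z0 : 0 <= Z by rewrite !(sqr_ge0, invr_ge0, mulr_ge0)// ltW.
have GZ : G ^+ 2 = gamma * r ^+ 2 * Z by rewrite /Z; field; rewrite !gt_eqF.
pose Y := b ^+ 2 * r ^+ 2 * w ^+ 2.
have Y0 : 0 <= Y by rewrite !(sqr_ge0, mulr_ge0).
have X0 := sqr_ge0 v.
have h1 : `|p * (v * G)| <= (v ^+ 2 + gamma * Z) / 2.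
  have : (p * G) ^+ 2 <= gamma * Z.
    rewrite exprMn GZ [leLHS](_ : _ = p * r ^+ 2 * p * (gamma * Z)); last by ring.
    by apply: ler_piMl => //; exact: mulr_ge0 (ltW gamma0) Z0.
  rewrite mulrCA; have := sqr_ge0 (v - p * G); have := sqr_ge0 (v + p * G).
  rewrite ler_norml => *; apply/andP; split; nra.
have h2 : `|p * r ^+ 2 * (w * v)| <= (v ^+ 2 + b ^- 2 * Y) / 2.
  have : (p * r ^+ 2 * w) ^+ 2 <= b ^- 2 * Y.
    have -> : b ^- 2 * Y = r ^+ 2 * w ^+ 2 by rewrite /Y; field; rewrite gt_eqF.
    rewrite [leLHS](_ : _ = p * r ^+ 2 * p * (r ^+ 2 * w ^+ 2)); last by ring.
    by apply: ler_piMl => //; rewrite !(sqr_ge0, mulr_ge0).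
  rewrite mulrA; have := sqr_ge0 (v - p * r ^+ 2 * w); have := sqr_ge0 (v + p * r ^+ 2 * w).
  rewrite ler_norml => *; apply/andP; split; nra.
have -> : lyapunov lyap_a r w v G - energy r w v G =
   lyap_a * (- (p * (v * G)) + gamma / 2 * (p * r ^+ 2 * (w * v))).
  by rewrite /lyapunov /p; field; rewrite gt_eqF// addr_gt0.
rewrite normrM (gtr0_norm lyap_a_gt0).
have E0 := energy_ge0 r w v G.
have h3 : `|- (p * (v * G)) + gamma / 2 * (p * r ^+ 2 * (w * v))| <= lyap_K' * energy r w v G.
  have h2' : `|gamma / 2 * (p * r ^+ 2 * (w * v))| <= gamma / 2 * ((v ^+ 2 + b ^- 2 * Y) / 2).
    by rewrite normrM gtr0_norm ?divr_gt0// ler_wpM2l// divr_ge0// ltW.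
  apply: le_trans (ler_normD _ _) _; rewrite normrN.
  apply: le_trans (lerD h1 h2') _; rewrite /lyap_K' /energy -/Y -/Z.
  have bi : 0 <= b ^- 2 by rewrite invr_ge0 sqr_ge0.
  have := mulr_ge0 (ltW gamma0) X0; have := mulr_ge0 (ltW gamma0) Y0; have := mulr_ge0 (ltW gamma0) Z0.
  have := mulr_ge0 (mulr_ge0 (ltW gamma0) bi) X0; have := mulr_ge0 (mulr_ge0 (ltW gamma0) bi) Z0.
  have := mulr_ge0 (mulr_ge0 (ltW gamma0) bi) Y0.
  nra.
apply: le_trans (ler_wpM2l (ltW lyap_a_gt0) h3) _.
by rewrite mulrA [leRHS]mulrC ler_wpM2r// lyap_a_K'.
Qed.

(** [kappa] is the rate available for the G part of the energy; 3/8 = 1/2 - 1/8 is what Young's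
    inequality leaves for v and w. The division by 2 pays for [lyapunov] <= 2 [energy]. *)
Definition decay_rate : R := Num.min kappa (3 * lyap_a * gamma / 8) / 2.

Lemma decay_rate_gt0 : 0 < decay_rate.
Proof. by rewrite divr_gt0// lt_min kappa0 divr_gt0// !mulr_gt0// lyap_a_gt0. Qed.

(** Young's inequality moves the indefinite terms onto gamma / 8 of the v and w dissipation and onto
    G^2; by [lyap_a_K] the latter uses up at most half of the 2 kappa / gamma G^2 at hand. *)
Lemma lyapunov_rate_le (r w v G : R) : 0 < r ->
  lyapunov_rate lyap_a r w v G <= - (decay_rate * (r ^+ 2 / (1 + r ^+ 2)) * lyapunov lyap_a r w v G).
Proof.
move=> r0.
have r2 : 0 < r ^+ 2 by rewrite exprn_gt0.
set p := (1 + r ^+ 2)^-1.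
have p0 : 0 < p by rewrite invr_gt0 addr_gt0.
have pr : p * r ^+ 2 <= 1 by rewrite mulrC ler_pdivrMr ?addr_gt0// mul1r lerDr.
have p1 : p <= 1 by rewrite invf_le1 ?addr_gt0// lerDl ltW.
pose Z := G ^+ 2 / (gamma * r ^+ 2).
have Z0 : 0 <= Z by rewrite !(sqr_ge0, invr_ge0, mulr_ge0)// ltW.
have GZ : G ^+ 2 = gamma * r ^+ 2 * Z by rewrite /Z; field; rewrite !gt_eqF.
pose Y := b ^+ 2 * r ^+ 2 * w ^+ 2.
have Y0 : 0 <= Y by rewrite !(sqr_ge0, mulr_ge0).
have X0 := sqr_ge0 v.
have a0 := lyap_a_gt0.
have h1 : kappa * (v * G) <= gamma / 8 * v ^+ 2 + 2 * kappa ^+ 2 / gamma * G ^+ 2.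
  have := @young kappa v G (gamma / 8); rewrite divr_gt0// => /(_ isT).
  by rewrite [kappa ^+ 2 / _](_ : _ = 2 * kappa ^+ 2 / gamma)//; field; rewrite gt_eqF.
pose K2 := 2 * (b ^+ 2 - gamma / 2) ^+ 2 / (gamma * b ^+ 2).
have K20 : 0 <= K2 by rewrite !(sqr_ge0, invr_ge0, mulr_ge0)// ltW.
have h2 : r ^+ 2 * ((b ^+ 2 - gamma / 2) * (w * G)) <= r ^+ 2 * (gamma / 8 * Y) + K2 * G ^+ 2.
  have := @young (b ^+ 2 - gamma / 2) w G (gamma / 8 * (b ^+ 2 * r ^+ 2)).
  rewrite !mulr_gt0 ?exprn_gt0 ?divr_gt0// => /(_ isT) /(ler_wpM2l (ltW r2)) /le_trans; apply.
  rewrite /Y /K2 le_eqVlt; apply/orP; left; apply/eqP; field.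
  by rewrite !gt_eqF.
have G0 := sqr_ge0 G.
have aK := lyap_a_K.
have h3 : lyapunov_rate lyap_a r w v G <= - (kappa / gamma * G ^+ 2) - 3 * lyap_a * gamma / 8 * (p * r ^+ 2 * (v ^+ 2 + Y)).
  rewrite /lyapunov_rate -/p -/Y.
  have h4 : lyap_a * p * r ^+ 2 * ((b ^+ 2 - gamma / 2) * (w * G) + kappa * (v * G)) <=
     lyap_a * (p * r ^+ 2 * (gamma / 8 * Y + gamma / 8 * v ^+ 2)) + lyap_a * (K2 + 2 * kappa ^+ 2 / gamma) * G ^+ 2.
    rewrite -!mulrA -mulrDr ler_pM2l//.
    rewrite mulrDr mulrDr.
    have e1 := ler_wpM2l (ltW p0) h2.
    have e2 := ler_wpM2l (mulr_ge0 (ltW p0) (ltW r2)) h1.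
    have e3 : p * (K2 * G ^+ 2) <= K2 * G ^+ 2 by rewrite ler_piMl// mulr_ge0.
    have k0 : 0 <= 2 * kappa ^+ 2 / gamma by rewrite !(sqr_ge0, invr_ge0, mulr_ge0)// ltW.
    have e4 : p * r ^+ 2 * (2 * kappa ^+ 2 / gamma * G ^+ 2) <= 2 * kappa ^+ 2 / gamma * G ^+ 2.
      by rewrite ler_piMl// mulr_ge0.
    move: e1 e2 e3 e4; rewrite !mulrDr !mulrDl !mulrA => e1 e2 e3 e4; lra.
  have h5 : lyap_a * p * G ^+ 2 <= lyap_a * G ^+ 2.
    by rewrite ler_wpM2r// ler_piMr// ltW.
  have h6 : lyap_a * lyap_K * G ^+ 2 <= kappa / gamma * G ^+ 2 by rewrite ler_wpM2r.
  move: h4 h5 h6; rewrite /lyap_K -/K2.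
  move: (2 * kappa ^+ 2 / gamma) => k2.
  rewrite -[2 * kappa / gamma]mulrA.
  move: (kappa / gamma) => kg.
  rewrite !mulrDr !mulrDl !mulNr !mulrA => h4 h5 h6; lra.
apply: le_trans h3 _.
have h7 : p * r ^+ 2 * (kappa * Z) <= kappa / gamma * G ^+ 2.
  rewrite GZ [leRHS](_ : _ = r ^+ 2 * (kappa * Z)); last by field; rewrite gt_eqF.
  rewrite -mulrA; apply: ler_piMl => //; apply: mulr_ge0; first exact: ltW.
  by apply: mulr_ge0 => //; exact: ltW.
have := lyapunov_equiv w v G r0; rewrite ler_norml => /andP[_ h8].
have c0 := decay_rate_gt0.
have h9 : decay_rate * lyapunov lyap_a r w v G <= 2 * decay_rate * energy r w v G.
  have hL : lyapunov lyap_a r w v G <= 2 * energy r w v G.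
    have := energy_ge0 r w v G; lra.
  by have := ler_wpM2l (ltW c0) hL; lra.
have d1 : 2 * decay_rate <= kappa by rewrite /decay_rate mulrC divfK// ge_min lexx.
have d2 : 2 * decay_rate <= 3 * lyap_a * gamma / 8 by rewrite /decay_rate mulrC divfK// ge_min lexx orbT.
have h10 : 2 * decay_rate * energy r w v G <= 3 * lyap_a * gamma / 8 * (v ^+ 2 + Y) + kappa * Z.
  rewrite /energy -/Y -/Z mulrDr; apply: lerD; first by rewrite ler_wpM2r ?addr_ge0.
  by rewrite ler_wpM2r.
have h11 := ler_wpM2l (mulr_ge0 (ltW p0) (ltW r2)) (le_trans h9 h10).
move: h11 h7.
move: (lyapunov lyap_a r w v G) => L h11 h7; lra.
Qed.

(** The product of [lyapunov] with the growing exponential does not increase; [lyapunov_equiv] at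
    both times gives 4 = 2 * 2. *)
Lemma energy_decay (r : R) w v G (t : R) : 0 < r -> 0 <= t -> oscillator r w v G ->
  energy r (w t) (v t) (G t) <=
  4 * expR (- (decay_rate * (r ^+ 2 / (1 + r ^+ 2)) * t)) * energy r (w 0) (v 0) (G 0).
Proof.
move=> r0 t0 osc.
set c := decay_rate * _.
pose L s := lyapunov lyap_a r (w s) (v s) (G s).
have le1 : expR (c * t) * L t <= expR (c * 0) * L 0.
  apply: (@le0_derive_halfline _ (fun s => expR (c * s) * L s)
    (fun s => expR (c * s) * (lyapunov_rate lyap_a r (w s) (v s) (G s) + c * L s))).
  - exact: t0.
  - have cL : {within `[0, +oo[, continuous L} := continuous_lyapunov osc.
    have cE : {within `[0, +oo[, continuous (fun s : R => expR (c * s))}.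
      by apply: continuous_subspaceT => y; exact: is_derive_continuous.
    by move=> x; exact: (cvgM (cE x) (cL x)).
  - move=> s s0; have dL := is_derive_lyapunov lyap_a r0 s0 osc.
    rewrite -/(L _) in dL.
    apply: is_derive_eq; rewrite /GRing.scale /=; ring.
  - move=> s s0; rewrite mulr_ge0_le0 ?expR_ge0//.
    by have := lyapunov_rate_le (w s) (v s) (G s) r0; rewrite -/c -/(L s); lra.
rewrite mulr0 expR0 mul1r in le1.
have := lyapunov_equiv (w t) (v t) (G t) r0; rewrite -/(L t) ler_norml => /andP[h1 _].
have := lyapunov_equiv (w 0) (v 0) (G 0) r0; rewrite -/(L 0) ler_norml => /andP[_ h2].
have h3 : L t <= expR (- (c * t)) * L 0.
  by rewrite expRN -ler_pdivrMl ?invr_gt0 ?expR_gt0// invrK.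
have E0 := energy_ge0 r (w 0) (v 0) (G 0).
have h4 := ler_wpM2l (expR_ge0 (- (c * t))) (_ : L 0 <= 2 * energy r (w 0) (v 0) (G 0)).
rewrite -mulrA; lra.
Qed.

Lemma energy_le4 (r : R) w v G (t : R) : 0 < r -> 0 <= t -> oscillator r w v G ->
  energy r (w t) (v t) (G t) <= 4 * energy r (w 0) (v 0) (G 0).
Proof.
move=> r0 t0 osc; apply: le_trans (energy_decay r0 t0 osc) _.
rewrite ler_wpM2r ?energy_ge0// ler_piMr// expR_le1 oppr_le0.
apply: mulr_ge0 => //; apply: mulr_ge0; first exact: ltW decay_rate_gt0.
by rewrite divr_ge0 ?sqr_ge0// addr_ge0 ?sqr_ge0.
Qed.

Lemma energy_ge_v r w v G : v ^+ 2 <= energy r w v G.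
Proof.
rewrite /energy -addrA lerDl !(sqr_ge0, invr_ge0, addr_ge0, mulr_ge0)//; exact: ltW.
Qed.

Lemma energy_ge_w r w v G : b ^+ 2 * r ^+ 2 * w ^+ 2 <= energy r w v G.
Proof.
rewrite /energy addrAC lerDr !(sqr_ge0, invr_ge0, addr_ge0, mulr_ge0)//; exact: ltW.
Qed.

Lemma energy_ge_G (r w v G : R) : 0 < r -> G ^+ 2 <= gamma * r ^+ 2 * energy r w v G.
Proof.
move=> r0; rewrite mulrC -ler_pdivrMr ?mulr_gt0 ?exprn_gt0//.
by rewrite /energy lerDr !(sqr_ge0, invr_ge0, addr_ge0, mulr_ge0)//; exact: ltW.
Qed.

(** The velocity is bounded by the initial energy, so w moves at most linearly. The decay estimate
    excludes r = 0, but there v is constant once G vanishes. *)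
Lemma oscillator_drift (r : R) w v G (t : R) : 0 <= r -> 0 <= t -> oscillator r w v G ->
  (r = 0 -> forall s, 0 < s -> G s = 0) ->
  w t ^+ 2 <= 2 * w 0 ^+ 2 + 8 * t ^+ 2 * energy r (w 0) (v 0) (G 0).
Proof.
move=> r0 t0 osc G0.
have E0 := energy_ge0 r (w 0) (v 0) (G 0).
have [|t_gt0] := leP t 0 => [t0'|].
  have -> : t = 0 by apply/eqP; rewrite eq_le t0' t0.
  by rewrite expr0n /= mulr0 mul0r addr0; have := sqr_ge0 (w 0); lra.
have [s s0 ws] := MVT_halfline t_gt0 (osc_cw osc) (osc_dw osc).
have vs : v s ^+ 2 <= 4 * energy r (w 0) (v 0) (G 0).
  move: r0; rewrite le_eqVlt => /orP[/eqP r0|r0]; last first.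
    exact: le_trans (energy_ge_v _ _ _ _) (energy_le4 r0 (ltW s0) osc).
  have [z z0 vz] := MVT_halfline s0 (osc_cv osc) (osc_dv osc).
  have vv : v s = v 0.
    apply/eqP; rewrite -subr_eq0 vz (G0 (esym r0) _ z0) -r0 expr0n /= mulr0 mul0r !oppr0 addr0.
    by rewrite mul0r.
  rewrite vv; apply: le_trans (energy_ge_v r (w 0) (v 0) (G 0)) _; lra.
have -> : w t = w 0 + v s * t by rewrite -ws; ring.
have h : (v s * t) ^+ 2 <= 4 * t ^+ 2 * energy r (w 0) (v 0) (G 0).
  by rewrite exprMn; have := ler_wpM2l (sqr_ge0 t) vs; lra.
by have := sqr_ge0 (w 0 - v s * t); nra.
Qed.

(* w follows the conservative oscillator of frequency beta r as long as r^2 t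
   is small: in the rotating frame of that oscillator, the dissipation moves w
   by at most kappa r t sup |G| / r. *)
Lemma oscillator_small_time (r : R) w v G (t B beta : R) : 0 < r -> 0 <= t -> oscillator r w v G ->
  0 < beta -> beta ^+ 2 = b ^+ 2 + gamma ->
  (forall s, 0 < s -> `|G s| <= r * B) ->
  `|w t - ((- (G 0 - gamma * r ^+ 2 * w 0) / (beta ^+ 2 * r ^+ 2)) * (1 - cos (beta * r * t))
     + v 0 * sin (beta * r * t) / (beta * r) + w 0 * cos (beta * r * t))| <=
   3 * kappa * B / beta ^+ 2 * (r ^+ 2 * t) / r.
Proof.
move=> r0 t0 osc beta0 betaE GB.
have B0 : 0 <= B.
  by rewrite -(pmulr_rge0 _ r0); apply: le_trans (GB 1 ltr01).
(* For kappa = 0 the quantity [S] is conserved, and ([P], [v]) rotates with angular speed [om]. *)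
pose S s := G s - gamma * r ^+ 2 * w s.
pose P s := beta * r * (w s + S s / (beta ^+ 2 * r ^+ 2)).
pose om := beta * r.
have dS (s : R) : 0 < s -> is_derive s 1 S (- (kappa * r ^+ 2 * G s)).
  move=> s0; have dG := osc_dG osc s0; have dw := osc_dw osc s0.
  by apply: is_derive_eq; rewrite /GRing.scale /=; ring.
have dP (s : R) : 0 < s -> is_derive s 1 P (om * v s - kappa * r / beta * G s).
  move=> s0; have dS' := dS s s0; have dw := osc_dw osc s0.
  apply: is_derive_eq; rewrite /GRing.scale /om /=; field.
  by rewrite !gt_eqF.
have dv (s : R) : 0 < s -> is_derive s 1 v (- (om * P s)).
  move=> s0; have dv := osc_dv osc s0; apply: is_derive_eq.
  rewrite /P /S /om.
  have -> : b ^+ 2 = beta ^+ 2 - gamma by rewrite betaE; ring.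
  by field; rewrite !gt_eqF.
have cst_ (c : R) (x : subspace `[(0:R), +oo[%classic) : (fun=> c) y @[y --> nbhs x] --> c by exact: cvg_cst.
have cS : {within `[0, +oo[, continuous S}.
  move=> x; apply: cvgB; first exact: (osc_cG osc).
  by apply: cvgM; [exact: cst_|exact: (osc_cw osc)].
have cP : {within `[0, +oo[, continuous P}.
  move=> x; apply: cvgM; first exact: cst_.
  apply: cvgD; first exact: (osc_cw osc).
  by apply: cvgM; [exact: cS|exact: cst_].
have ccos : {within `[0, +oo[, continuous (fun s : R => cos (om * s))}.
  by apply: continuous_subspaceT => y; exact: is_derive_continuous.
have csin : {within `[0, +oo[, continuous (fun s : R => sin (om * s))}.
  by apply: continuous_subspaceT => y; exact: is_derive_continuous.
(* ([U], [V]) is ([P], [v]) in the rotating frame, so its derivative contains only the dissipative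
   term. *)
pose U s := P s * cos (om * s) - v s * sin (om * s).
pose V s := P s * sin (om * s) + v s * cos (om * s).
have Gk (s c : R) : 0 < s -> `|c| <= 1 -> `|- (kappa * r / beta * G s) * c| <= kappa * r / beta * (r * B).
  move=> s0 c1; rewrite normrM normrN normrM gtr0_norm ?divr_gt0 ?mulr_gt0// -[leRHS]mulr1.
  apply: ler_pM => //; first by rewrite mulr_ge0 ?divr_ge0 ?mulr_ge0// ltW.
  by rewrite ler_wpM2l ?GB// divr_ge0 ?mulr_ge0// ltW.
have hU : `|U t - U 0| <= kappa * r / beta * (r * B) * t.
  apply: (le_derive_halfline (df := fun s => - (kappa * r / beta * G s) * cos (om * s))) => //.
  - move=> x; apply: cvgB; apply: cvgM; [exact: cP|exact: ccos|exact: (osc_cv osc)|exact: csin].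
  - move=> s s0; have dP' := dP s s0; have dv' := dv s s0.
    by apply: is_derive_eq; rewrite /GRing.scale /=; ring.
  - by move=> s s0; apply: Gk => //; exact: cos_max.
have hV : `|V t - V 0| <= kappa * r / beta * (r * B) * t.
  apply: (le_derive_halfline (df := fun s => - (kappa * r / beta * G s) * sin (om * s))) => //.
  - move=> x; apply: cvgD; apply: cvgM; [exact: cP|exact: csin|exact: (osc_cv osc)|exact: ccos].
  - move=> s s0; have dP' := dP s s0; have dv' := dv s s0.
    by apply: is_derive_eq; rewrite /GRing.scale /=; ring.
  - by move=> s s0; apply: Gk => //; exact: sin_max.
have hS : `|S t - S 0| <= kappa * r ^+ 2 * (r * B) * t.
  apply: (le_derive_halfline (df := fun s => - (kappa * r ^+ 2 * G s))) => //.
  move=> s s0; rewrite normrN normrM gtr0_norm ?mulr_gt0 ?exprn_gt0//.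
  by rewrite ler_wpM2l ?GB// mulr_ge0 ?sqr_ge0// ltW.
have U0 : U 0 = P 0 by rewrite /U mulr0 cos0 sin0; ring.
have V0 : V 0 = v 0 by rewrite /V mulr0 cos0 sin0; ring.
have PE : P t = U t * cos (om * t) + V t * sin (om * t).
  by rewrite /U /V; have := cos2Dsin2 (om * t) => h; rewrite -[LHS]mulr1 -h; ring.
have -> : w t - ((- (G 0 - gamma * r ^+ 2 * w 0) / (beta ^+ 2 * r ^+ 2)) * (1 - cos (beta * r * t))
     + v 0 * sin (beta * r * t) / (beta * r) + w 0 * cos (beta * r * t)) =
   ((U t - U 0) * cos (om * t) + (V t - V 0) * sin (om * t)) / om - (S t - S 0) / (beta ^+ 2 * r ^+ 2).
  have -> : w t = P t / om - S t / (beta ^+ 2 * r ^+ 2).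
    by rewrite /P /om; field; rewrite !gt_eqF.
  rewrite PE U0 V0 /P -/om -/(S 0).
  move: (U t) (V t) (S t) (S 0) => Ut Vt St S0.
  by rewrite /om; field; rewrite !gt_eqF.
have om0 : 0 < om by rewrite mulr_gt0.
have e1 (x c : R) (K : R) : `|x| <= K -> `|c| <= 1 -> `|x * c| <= K.
  by move=> xK c1; rewrite normrM -[leRHS]mulr1 ler_pM.
apply: le_trans (ler_normB _ _) _.
have br0 : 0 < beta ^+ 2 * r ^+ 2 by rewrite mulr_gt0 ?exprn_gt0.
rewrite [X in X + _]normrM [X in _ + X]normrM !normfV (gtr0_norm om0) (gtr0_norm br0).
(* The drifts of [U], [V] and [S] contribute the same amount each, whence the factor 3. *)
have -> : 3 * kappa * B / beta ^+ 2 * (r ^+ 2 * t) / r =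
  (kappa * r / beta * (r * B) * t + kappa * r / beta * (r * B) * t) / om + kappa * r ^+ 2 * (r * B) * t / (beta ^+ 2 * r ^+ 2).
  by rewrite /om; field; rewrite !gt_eqF.
apply: lerD; (apply: ler_wpM2r; first by rewrite invr_ge0 ltW) => //.
apply: le_trans (ler_normD _ _) _; apply: lerD; apply: e1 => //; [exact: cos_max|exact: sin_max].
Qed.

End damped_oscillator.

(** * Curl-free fields in Fourier variables *)

Section flat_function.
Context {R : realType}.

(* This family is stable under differentiation, hence consists of smooth functions. *)
Definition flat (P : {poly R}) (x : R) : R := if 0 < x then P.[x^-1] * expR (- x^-1) else 0.

(** Term by term, from y^k <= k! e^y. *)
Lemma poly_le_expR (P : {poly R}) : exists2 C : R, 0 <= C & forall y : R, 0 <= y -> `|P.[y]| <= C * expR y.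
Proof.
exists (\sum_(i < size P) `|P`_i| * i`!%:R).
  by apply: sumr_ge0 => i _; rewrite mulr_ge0.
move=> y y0; rewrite horner_coef mulr_suml; apply: le_trans (ler_norm_sum _ _ _) _.
apply: ler_sum => i _; rewrite normrM -mulrA ler_wpM2l//.
rewrite ger0_norm ?exprn_ge0//.
case: (nat_of_ord i) => [|k]; first by rewrite fact0 expr0 mul1r -expR0 ler_expR.
have := expR_ge1Dxn k y0 => h.
have : y ^+ k.+1 / k.+1`!%:R <= expR y by apply: le_trans h; rewrite lerDr.
by rewrite ler_pdivrMr ?ltr0n ?fact_gt0// mulrC.
Qed.

Lemma flat_bounded (P : {poly R}) : exists2 C : R, 0 <= C & forall x, `|flat P x| <= C.
Proof.
have [C C0 PC] := poly_le_expR P; exists C => // x.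
rewrite /flat; case: ifP => x0; last by rewrite normr0.
rewrite normrM (ger0_norm (expR_ge0 _)) expRN ler_pdivrMr ?expR_gt0//.
by apply: PC; rewrite invr_ge0 ltW.
Qed.

(** From (P(1/x) e^(-1/x))' = x^-2 (P - P')(1/x) e^(-1/x). *)
Definition flat_next (P : {poly R}) : {poly R} := 'X^2 * (P - P^`()).

Lemma is_derive_sqr_bounded (f : R -> R) (C : R) : (forall x, `|f x| <= C * x ^+ 2) -> is_derive (0 : R) 1 f 0.
Proof.
move=> fC.
have f0 : f 0 = 0 by apply/eqP; rewrite -normr_le0; apply: le_trans (fC 0) _; rewrite expr0n mulr0.
have cv : (fun h : R => h^-1 *: (f (h *: 1 + 0) - f 0)) @ 0^' --> (0 : R).
  have cC : (fun h : R => C * `|h|) @ 0^' --> (0 : R).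
    apply: cvg_within_filter.
    have : (fun h : R => C * `|h|) @ (0 : R) --> C * `|0 : R|.
      by apply: cvgM; [exact: cvg_cst|exact: norm_continuous].
    by rewrite normr0 mulr0.
  apply: norm_cvg0; apply: squeeze_cvgr (cvg_cst 0) cC.
  near=> h; have h0 : h != 0 by near: h; exact: nbhs_dnbhs_neq.
  rewrite normr_ge0 /= f0 subr0 addr0 normrM normfV /GRing.scale /= mulr1.
  rewrite mulrC ler_pdivrMr ?normr_gt0//; apply: le_trans (fC h) _.
  by rewrite -mulrA -expr2 real_normK ?num_real.
apply: DeriveDef; first by apply/cvg_ex; exists 0.
by apply/cvg_lim.
Unshelve. all: by end_near. Qed.

Lemma is_derive_flat (P : {poly R}) (x : R) : is_derive x 1 (flat P) (flat (flat_next P) x).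
Proof.
have [x0|x0|->] := ltgtP x 0.
- rewrite [X in is_derive _ _ _ X](_ : _ = 0); last by rewrite /flat ltNge (ltW x0).
  have dc : is_derive x 1 (cst 0 : R -> R) 0 by exact: is_derive_cst.
  apply: near_eq_is_derive dc.
  near=> y; rewrite /flat ifF//; apply/negbTE; rewrite -leNgt; apply/ltW.
  near: y; exact: lt_nbhsl.
- have xn : x != 0 by rewrite gt_eqF.
  rewrite [X in is_derive _ _ _ X](_ : _ = - x ^- 2 * P^`().[x^-1] * expR (- x^-1) + P.[x^-1] * (x ^- 2 * expR (- x^-1))); last first.
    rewrite /flat x0 /flat_next hornerM hornerXn hornerD hornerN exprVn; ring.
  have dP : is_derive x 1 (fun y : R => P.[y^-1]) (- x ^- 2 * P^`().[x^-1]).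
    have dh : is_derive x^-1 1 (horner P) (P^`().[x^-1]).
      by rewrite derivE derive1E; apply: derivableP; exact: derivable_horner.
    have dc := is_derive1_comp dh (is_deriveV xn (is_derive_id x 1)).
    rewrite (_ : - x ^- 2 * _ = P^`().[x^-1] * (- x ^- 2 *: 1)); last by rewrite /GRing.scale /=; ring.
    exact: dc.
  have dM : is_derive x 1 (fun y : R => P.[y^-1] * expR (- y^-1))
      (- x ^- 2 * P^`().[x^-1] * expR (- x^-1) + P.[x^-1] * (x ^- 2 * expR (- x^-1))).
    have dV : is_derive x 1 (fun y : R => - y^-1) (x ^- 2).
      have := is_deriveN (is_deriveV xn (is_derive_id x 1)).
      by rewrite (_ : - (- x ^- 2 *: 1) = x ^- 2)// /GRing.scale /= mulr1 opprK.
    have dE : is_derive x 1 (fun y : R => expR (- y^-1)) (expR (- x^-1) * x ^- 2).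
      exact: is_derive1_comp (is_derive_expR _) dV.
    by apply: is_derive_eq; rewrite /GRing.scale /=; ring.
  apply: near_eq_is_derive dM.
  near=> y; rewrite /flat ifT//.
  near: y; exact: lt_nbhsr.
- rewrite [X in is_derive _ _ _ X](_ : _ = 0); last by rewrite /flat ltxx.
  (* Multiplying P by X^2 keeps the function bounded and amounts to dividing it by x^2; hence
     [flat P] is at most C x^2 near 0. *)
  have [C C0 QC] := flat_bounded ('X^2 * P).
  apply: (@is_derive_sqr_bounded _ C) => y.
  have := QC y; rewrite /flat; case: ifP => y0; last by rewrite normr0 mulr_ge0 ?sqr_ge0.
  rewrite hornerM hornerXn => h.
  have -> : P.[y^-1] * expR (- y^-1) = y ^+ 2 * (y^-1 ^+ 2 * P.[y^-1] * expR (- y^-1)).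
    by rewrite exprVn -mulrA mulVKf// gt_eqF// exprn_gt0.
  by rewrite normrM (ger0_norm (sqr_ge0 y)) mulrC ler_wpM2r ?sqr_ge0.
Unshelve. all: by end_near. Qed.

Fixpoint flat_poly (k : nat) : {poly R} := if k is k'.+1 then flat_next (flat_poly k') else 1.

Lemma flat1E (x : R) : 0 < x -> flat 1 x = expR (- x^-1).
Proof. by move=> x0; rewrite /flat x0 hornerC mul1r. Qed.

End flat_function.

Section smooth_functions.
Context {R : realType} (n : nat).
Implicit Types (phi : 'rV[R]_n -> R) (v : 'rV[R]_n).

Definition linform (l : 'I_n -> R) (x : 'rV[R]_n) : R := \sum_j l j * x 0 j.

(* finite combinations of ridge functions: a class of smooth functions stable
   under partial derivatives *)
Inductive ridge_algebra : ('rV[R]_n -> R) -> Prop :=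
| ridge_fun (F : nat -> R -> R) l : (forall k (x : R), is_derive x 1 (F k) (F k.+1 x)) ->
    ridge_algebra (fun x => F 0%N (linform l x))
| ridge_add phi psi : ridge_algebra phi -> ridge_algebra psi ->
    ridge_algebra (fun x => phi x + psi x)
| ridge_mul phi psi : ridge_algebra phi -> ridge_algebra psi ->
    ridge_algebra (fun x => phi x * psi x)
| ridge_scale c phi : ridge_algebra phi -> ridge_algebra (fun x => c * phi x).

Lemma differentiable_linform l x : differentiable (linform l) x.
Proof.
rewrite (_ : linform l = \sum_j (fun x : 'rV[R]_n => l j * x 0 j)).
  apply: differentiable_sum => j; apply: differentiableM; first exact: differentiable_cst.
  exact: differentiable_coord.
by apply/funext => y; rewrite fct_sumE.
Qed.

Lemma derive_linform l x v : 'D_v (linform l) x = linform l v.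
Proof.
apply/cvg_lim => //; apply: cvg_near_cst; near=> h.
have h0 : h != 0 by near: h; exact: nbhs_dnbhs_neq.
rewrite /linform -sumrB /GRing.scale /= mulr_sumr; apply: eq_bigr => j _.
by rewrite !mxE; field.
Unshelve. all: by end_near. Qed.

(** Differentiating a ridge function along v shifts the sequence [F] of derivatives by one and
    multiplies by the value of the linear form at v; sums, products and multiples follow the usual
    rules. *)
Lemma ridge_algebraP phi : ridge_algebra phi ->
  (forall x, differentiable phi x) /\ forall v, ridge_algebra (fun x => 'D_v phi x).
Proof.
elim => [F l dF|{}phi psi _ [dphi Dphi] _ [dpsi Dpsi]|{}phi psi gphi [dphi Dphi] gpsi [dpsi Dpsi]|c {}phi _ [dphi Dphi]].
- have dF1 (k : nat) (y : R) : differentiable (F k) y.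
    by apply/derivable1_diffP; case: (dF k y).
  have dFl (k : nat) x : differentiable (F k \o linform l) x.
    by apply: differentiable_comp => //; exact: differentiable_linform.
  split=> [x|v]; first exact: (dFl 0%N).
  rewrite (_ : (fun x => _) = fun x => linform l v * F 1%N (linform l x)).
    by apply: ridge_scale; apply: (ridge_fun (F := fun k => F k.+1)).
  apply/funext => x; rewrite (deriveE _ (dFl 0%N x)) diff_comp//; last exact: differentiable_linform.
  rewrite /= deriv1E; last by case: (dF 0%N (linform l x)).
  rewrite -(deriveE _ (differentiable_linform l x)) derive_linform derive1E.
  by have [_ ->] := dF 0%N (linform l x).
- split=> [x|v]; first exact: differentiableD.
  rewrite (_ : (fun x => _) = fun x => 'D_v phi x + 'D_v psi x); first exact: ridge_add.
  by apply/funext => x; rewrite deriveD//; exact: diff_derivable.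
- split=> [x|v]; first exact: differentiableM.
  rewrite (_ : (fun x => _) = fun x => phi x * 'D_v psi x + psi x * 'D_v phi x).
    by apply: ridge_add; apply: ridge_mul.
  by apply/funext => x; rewrite deriveM//; exact: diff_derivable.
- split=> [x|v].
    by apply: differentiableM => //; exact: differentiable_cst.
  rewrite (_ : (fun x => _) = fun x => c * 'D_v phi x); first exact: ridge_scale.
  by apply/funext => x; rewrite deriveMl//; exact: diff_derivable.
Qed.

Lemma ridge_iter_partial phi s : ridge_algebra phi -> ridge_algebra (iter_partial s phi).
Proof.
move=> gphi; elim: s => //= j s IHs.
exact: (ridge_algebraP IHs).2.
Qed.

Lemma ridge_differentiable phi s x : ridge_algebra phi -> differentiable (iter_partial s phi) x.
Proof. by move=> gphi; exact: (ridge_algebraP (ridge_iter_partial s gphi)).1. Qed.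

End smooth_functions.

Section cutoff.
Context {R : realType}.

(** The bump exp(-2 / (1 - x^2)), supported in [-1, 1], written as a product so that it falls under
    [ridge_algebra] when x is a linear form. *)
Definition bump (x : R) : R := flat 1 (1 + x) * flat 1 (1 - x).
Definition dbump (x : R) : R :=
  flat (flat_next 1) (1 + x) * flat 1 (1 - x) - flat 1 (1 + x) * flat (flat_next 1) (1 - x).

Lemma is_derive_flat_comp (P : {poly R}) (g : R -> R) (x dg : R) : is_derive x 1 g dg ->
  is_derive x 1 (fun y => flat P (g y)) (flat (flat_next P) (g x) * dg).
Proof. by move=> dG; exact: is_derive1_comp (is_derive_flat P (g x)) dG. Qed.

Lemma is_derive_1D (x : R) : is_derive x 1 (fun y : R => 1 + y) 1.
Proof.
have -> : (fun y : R => 1 + y) = cst 1 + id by apply/funext.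
by apply: is_derive_eq; rewrite add0r.
Qed.

Lemma is_derive_bump (x : R) : is_derive x 1 bump (dbump x).
Proof.
have d1 : is_derive x 1 (fun y : R => flat 1 (1 + y)) (flat (flat_next 1) (1 + x) * 1).
  by apply: is_derive_flat_comp; apply: is_derive_eq; rewrite add0r.
have d2 : is_derive x 1 (fun y : R => flat 1 (1 - y)) (flat (flat_next 1) (1 - x) * -1).
  by apply: is_derive_flat_comp; apply: is_derive_eq; lra.
by apply: is_derive_eq; rewrite /dbump /GRing.scale /=; ring.
Qed.

Lemma continuous_flat (P : {poly R}) : continuous (flat P).
Proof.
by move=> x; have := is_derive_flat P x => h; exact: is_derive_continuous.
Qed.

Lemma flat1_itv (x : R) : 0 <= flat 1 x <= 1.
Proof.
rewrite /flat; case: ifP => x0; last by rewrite lexx ler01.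
by rewrite hornerC mul1r expR_ge0 expR_le1 oppr_le0 invr_ge0 ltW.
Qed.

Lemma bump_itv x : 0 <= bump x <= 1.
Proof.
have /andP[a0 a1] := flat1_itv (1 + x); have /andP[b0 b1] := flat1_itv (1 - x).
by rewrite mulr_ge0//= mulr_ile1.
Qed.

Lemma bump_eq0 x : 1 < `|x| -> bump x = 0.
Proof.
rewrite /bump ltr_normr => /orP[x1|x1].
  by rewrite [flat 1 (1 - x)]/flat ifF ?mulr0//; apply/negbTE; rewrite -leNgt; lra.
by rewrite [flat 1 (1 + x)]/flat ifF ?mul0r//; apply/negbTE; rewrite -leNgt; lra.
Qed.

Lemma bump0_gt0 : 0 < bump 0.
Proof. by rewrite /bump addr0 subr0 flat1E// mulr_gt0 ?expR_gt0. Qed.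

Lemma dbump_bounded : exists2 C, 0 <= C & forall x, `|dbump x| <= C.
Proof.
have [C C0 PC] := flat_bounded (flat_next (1 : {poly R})); exists (C + C); first exact: addr_ge0.
move=> x; have /andP[a0 a1] := flat1_itv (1 + x); have /andP[b0 b1] := flat1_itv (1 - x).
apply: le_trans (ler_normB _ _) _; rewrite !normrM; apply: lerD.
  by rewrite -[leRHS]mulr1 ler_pM// ger0_norm.
by rewrite -[leRHS]mul1r ler_pM// ger0_norm.
Qed.

Lemma continuous_bump : continuous bump.
Proof. by move=> x; have := is_derive_bump x => h; exact: is_derive_continuous. Qed.

Lemma measurable_dbump : measurable_fun setT dbump.
Proof.
have mf (P : {poly R}) : measurable_fun setT (flat P).
  by apply: continuous_measurable_fun; exact: continuous_flat.
by apply: measurable_funB; apply: measurable_funM; apply: measurableT_comp (mf _) _;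
  [apply: measurable_funD|apply: measurable_funB|apply: measurable_funD|apply: measurable_funB].
Qed.

End cutoff.

(** * Parallelism of xi and the transform of a rotation-free field *)

Section rotation_free_fourier.
Context {R : realType} (n : nat).
Local Notation leb := (lebesgue_Rn R n).

Lemma derive_line (phi : 'rV[R]_n -> R) v x :
  'D_v phi x = 'D_1 (fun h : R => phi (h *: v + x)) 0.
Proof.
rewrite /derive (_ : (fun h : R => h^-1 *: _) = (fun h : R => h^-1 *: (phi (h *: v + x) - phi x)))//.
rewrite [in RHS](_ : (fun h : R => h^-1 *: _) = (fun h : R => h^-1 *: (phi (h *: v + x) - phi x)))//.
apply/funext => h; rewrite scale0r add0r [h *: 1]/GRing.scale /= mulr1 addr0; reflexivity.
Qed.

(* Letting m tend to infinity turns the weak form of rot w = 0 into the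
   parallelism of xi and the Fourier transform of w. *)
Definition wave_packet (xi : Rn R n) (a : R) (m : nat) (y : 'rV[R]_n) : R :=
  (\prod_(j < n) bump (y 0 j / m.+1%:R)) * cos (\sum_(j < n) tnth xi j * y 0 j + a).

Lemma ridge_cst (c : R) : ridge_algebra (fun _ : 'rV[R]_n => c).
Proof.
pose F (k : nat) (x : R) : R := if k is 0 then c else 0.
apply: (@ridge_fun R n F (fun=> 0)) => k x; rewrite /F; case: k => [|k]; exact: is_derive_cst.
Qed.

Lemma ridge_prod I (r : seq I) (F : I -> 'rV[R]_n -> R) : (forall i, ridge_algebra (F i)) ->
  ridge_algebra (fun x => \prod_(i <- r) F i x).
Proof.
move=> gF; elim: r => [|i r IHr].
  by under eq_fun do rewrite big_nil; exact: ridge_cst.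
by under eq_fun do rewrite big_cons; exact: ridge_mul.
Qed.

Lemma ridge_flat (l : 'I_n -> R) : ridge_algebra (fun x => flat 1 (1 + linform l x)).
Proof.
apply: (@ridge_fun R n (fun k x => flat (flat_poly k) (1 + x)) l) => k x.
have := @is_derive_flat_comp R (flat_poly k) (fun y => 1 + y) x 1; rewrite mulr1; apply.
exact: is_derive_1D.
Qed.

Lemma linform_coord (c : R) (j : 'I_n) (y : 'rV[R]_n) : linform (fun i => if i == j then c else 0) y = c * y 0 j.
Proof.
rewrite /linform (bigD1 j)//= eqxx big1 ?addr0// => i ij.
by rewrite (negbTE ij) mul0r.
Qed.

Lemma ridge_eq phi psi : phi =1 psi -> ridge_algebra phi -> ridge_algebra (psi : 'rV[R]_n -> R).
Proof. by move=> /funext ->. Qed.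

Lemma ridge_wave_packet xi a m : ridge_algebra (wave_packet xi a m).
Proof.
apply: ridge_mul.
  apply: ridge_prod => j; apply: ridge_mul.
    have := ridge_flat (fun i => if i == j then m.+1%:R^-1 else 0).
    by under eq_fun do rewrite linform_coord mulrC.
  have := ridge_flat (fun i => if i == j then - m.+1%:R^-1 else 0).
  by under eq_fun do rewrite linform_coord mulNr mulrC.
(* The successive derivatives of the cosine are its shifts by multiples of pi / 2, which provides
   the sequence that [ridge_fun] requires. *)
apply: (@ridge_eq (fun x => cos (linform (fun j => tnth xi j) x + a + 0%:R * (pi / 2)))).
  by move=> x; rewrite mul0r addr0.
apply: (@ridge_fun R n (fun k x => cos (x + a + k%:R * (pi / 2))) (fun j => tnth xi j)) => k x.
have d : is_derive x 1 (fun x : R => x + a + k%:R * (pi / 2)) 1.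
  by apply: is_derive_eq; rewrite !addr0.
rewrite (_ : cos (x + a + k.+1%:R * (pi / 2)) = - sin (x + a + k%:R * (pi / 2)) * 1).
  exact: is_derive1_comp (is_derive_cos _) d.
by rewrite -natr1 mulrDl mul1r addrA cosDpihalf mulr1.
Qed.

Lemma test_wave_packet xi a m : test_function (wave_packet xi a m).
Proof.
split=> [s x|]; first by apply: ridge_differentiable; exact: ridge_wave_packet.
exists m.+1%:R => x mx.
have [j xj] : exists j, m.+1%:R < `|x 0 j|.
  apply/existsP; apply: contraLR mx; rewrite negb_exists => /forallP h.
  rewrite -leNgt [`|x|]mx_normrE; apply: bigmax_le => // -[i j] _ /=.
  by rewrite leNgt ord1; exact: h.
rewrite /wave_packet (bigD1 j)//= bump_eq0 ?mul0r//.
by rewrite normrM normfV normr_nat ltr_pdivlMr// mul1r.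
Qed.

Let others (i : 'I_n) m (y : 'rV[R]_n) := \prod_(j < n) (if j == i then 1 else bump (y 0 j / m.+1%:R)).

Let othersE i m y : others i m y = \prod_(j < n | j != i) bump (y 0 j / m.+1%:R).
Proof. by rewrite big_mkcond; apply: eq_bigr => j _; case: ifP. Qed.

Let others_norm i m y : `|others i m y| <= 1.
Proof.
have h (j : 'I_n) : 0 <= (if j == i then 1 else bump (y 0 j / m.+1%:R)) <= 1.
  by case: ifP => _; rewrite ?lexx ?ler01//; exact: bump_itv.
rewrite ger0_norm; last by apply: prodr_ge0 => k _; case/andP: (h k).
by apply: prodr_ile1 => k _; exact: h.
Qed.

(** The term in which the cutoff is differentiated carries 1 / (m + 1) and disappears in the limit;
    the other one is xi_i times a plane wave. *)
Lemma derive_wave_packet xi a m i y : 'D_(delta_mx 0 i) (wave_packet xi a m) y =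
  dbump (y 0 i / m.+1%:R) / m.+1%:R * others i m y * cos (\sum_(j < n) tnth xi j * y 0 j + a)
  - tnth xi i * ((\prod_(j < n) bump (y 0 j / m.+1%:R)) * sin (\sum_(j < n) tnth xi j * y 0 j + a)).
Proof.
set S := \sum_(j < n) _ + a.
rewrite derive_line (_ : (fun h : R => _) = fun h : R => bump ((h + y 0 i) / m.+1%:R) * others i m y * cos (h * tnth xi i + S)); last first.
  apply/funext => h; rewrite /wave_packet (bigD1 i)//= othersE; congr (bump _ * _ * cos _).
  - by rewrite !mxE !eqxx mulr1.
  - by apply: eq_bigr => j ji; rewrite !mxE (negbTE ji) andbF mulr0 add0r.
  - rewrite /S addrA; congr (_ + _).
    under eq_bigr do rewrite !mxE mulrDr.
    rewrite big_split /=; congr (_ + _); rewrite (bigD1 i)//= eqxx mulr1 mulrC big1 ?addr0// => j ji.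
    by rewrite (negbTE ji) mulr0 mulr0.
have d1 : is_derive (0 : R) 1 (fun h : R => bump ((h + y 0 i) / m.+1%:R)) (dbump (y 0 i / m.+1%:R) * m.+1%:R^-1).
  have dl : is_derive (0 : R) 1 (fun h : R => (h + y 0 i) / m.+1%:R) m.+1%:R^-1.
    by apply: is_derive_eq; rewrite /GRing.scale /=; ring.
  have := is_derive_bump ((0 + y 0 i) / m.+1%:R); rewrite add0r => db.
  have := @is_derive1_comp R bump (fun h : R => (h + y 0 i) / m.+1%:R) 0 _ _ _ dl.
  by rewrite add0r; apply.
have d2 : is_derive (0 : R) 1 (fun h : R => cos (h * tnth xi i + S)) (- sin S * tnth xi i).
  have dl : is_derive (0 : R) 1 (fun h : R => h * tnth xi i + S) (tnth xi i).
    by apply: is_derive_eq; rewrite /GRing.scale /=; ring.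
  have := @is_derive1_comp R cos (fun h : R => h * tnth xi i + S) 0 _ _ _ dl.
  by rewrite mul0r add0r; apply; exact: is_derive_cos.
have d3 : is_derive (0 : R) 1 (fun h : R => bump ((h + y 0 i) / m.+1%:R) * others i m y * cos (h * tnth xi i + S))
  (dbump (y 0 i / m.+1%:R) / m.+1%:R * others i m y * cos S - tnth xi i * (bump (y 0 i / m.+1%:R) * others i m y * sin S)).
  by apply: is_derive_eq; rewrite /GRing.scale /= mul0r !add0r; ring.
rewrite derive_val; congr (_ - _ * (_ * _)).
by rewrite (bigD1 i)//= othersE.
Qed.

Variable w : 'I_n -> Rn R n -> R.
Hypothesis w1 : forall k, leb.-integrable setT (EFin \o w k).
Hypothesis wrot : rotation_free w.

Let mw k : measurable_fun setT (w k).
Proof. by have /measurable_EFinP := measurable_int _ (w1 k). Qed.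

Let phase (xi x : Rn R n) a : \sum_(j < n) tnth xi j * rV_of_Rn x 0 j + a = dotp x xi + a.
Proof. by rewrite /dotp; congr (_ + _); apply: eq_bigr => j _; rewrite mxE mulrC. Qed.

Let cvgVn (c : R) : (fun m => c / m.+1%:R) @ \oo --> (0 : R).
Proof. by rewrite -[X in _ --> X](mulr0 c); apply: cvgM; [exact: cvg_cst|exact: cvg_harmonic]. Qed.

Let mcoord (j : 'I_n) (c : R) : measurable_fun setT (fun x : Rn R n => rV_of_Rn x 0 j / c).
Proof.
under eq_fun do rewrite mxE.
by apply: measurable_funM => //; exact: measurable_tnth.
Qed.

Let mbump : measurable_fun setT (@bump R).
Proof. by apply: continuous_measurable_fun; exact: continuous_bump. Qed.

(** Dominated convergence as the cutoffs spread out. Since [bump 0] is not 1, a power of it remains;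
    it is cancelled in [rotation_free_wave]. *)
Lemma cvg_integral_wave_packet xi a (i j : 'I_n) :
  (fun m => \int[leb]_x (w j x * 'D_(delta_mx 0 i) (wave_packet xi a m) (rV_of_Rn x))) @ \oo -->
  \int[leb]_x (w j x * (- (tnth xi i * (bump 0 ^+ n * sin (dotp x xi + a))))).
Proof.
have [C C0 dC] := @dbump_bounded R.
apply: (cvg_Rintegral (g := fun x => `|w j x| * (C + `|tnth xi i|))).
- move=> m; apply: measurable_funM => //.
  under eq_fun do rewrite derive_wave_packet !phase.
  apply: measurable_funB.
    apply: measurable_funM; first apply: measurable_funM; first apply: measurable_funM => //.
    + by apply: (measurableT_comp (@measurable_dbump R)); exact: mcoord.
    + apply: measurable_prod => k _; case: (k == i) => //.
      by apply: (measurableT_comp mbump); exact: mcoord.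
    + by apply: measurable_cos_comp; apply: measurable_funD => //; exact: measurable_dotp.
  apply: measurable_funM => //; apply: measurable_funM.
  + by apply: measurable_prod => k _; apply: (measurableT_comp mbump); exact: mcoord.
  + by apply: measurable_sin_comp; apply: measurable_funD => //; exact: measurable_dotp.
- apply: measurable_funM => //; apply: measurableT_comp => //; apply: measurable_funM => //; apply: measurable_funM => //.
  by apply: measurable_sin_comp; apply: measurable_funD => //; exact: measurable_dotp.
- move=> x; apply: cvgM; first exact: cvg_cst.
  under eq_fun do rewrite derive_wave_packet !phase.
  rewrite -[- (tnth xi i * (bump 0 ^+ n * _))]add0r; apply: cvgB.
    pose d m := C / m.+1%:R.
    apply: norm_cvg0; apply: squeeze_cvgr (cvg_cst 0) (cvgVn C).
    apply: nearW => m; rewrite normr_ge0 /= !normrM normfV normr_nat.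
    rewrite -[leRHS]mulr1 ler_pM ?cos_max ?mulr_ge0// -[leRHS]mulr1 ler_pM ?mulr_ge0// ?ler_wpM2r//.
  apply: cvgM; first exact: cvg_cst.
  apply: cvgM; last exact: cvg_cst.
  rewrite (_ : bump 0 ^+ n = \prod_(k < n) bump 0); last by rewrite prodr_const card_ord.
  apply: (@cvg_big _ _ _ _ _ _ _ _ _ (fun k m => bump (rV_of_Rn x 0 k / m.+1%:R)) (fun=> bump 0)).
    by move=> [u v]; exact: mul_continuous.
  move=> k _; apply: (cvg_comp (fun m => rV_of_Rn x 0 k / m.+1%:R) bump); first exact: cvgVn.
  exact: continuous_bump.
- rewrite (_ : (fun x => _) = (fun x => (C + `|tnth xi i|) * `|w j x|)); last by apply/funext => x; rewrite mulrC.
  exact: (integrable_scale _ (integrable_norm (w1 j))).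
- move=> m x; rewrite normrM ler_wpM2l// derive_wave_packet !phase.
  have P1 : `|\prod_(k < n) bump (rV_of_Rn x 0 k / m.+1%:R)| <= 1.
    rewrite ger0_norm; last by apply: prodr_ge0 => k _; case/andP: (bump_itv (rV_of_Rn x 0 k / m.+1%:R)).
    by apply: prodr_ile1 => k _; exact: bump_itv.
  apply: le_trans (ler_normB _ _) _; apply: lerD.
    rewrite normrM -[leRHS]mulr1 ler_pM ?cos_max// normrM -[leRHS]mulr1 ler_pM//.
    rewrite normrM normfV normr_nat ler_pdivrMr//.
    by apply: le_trans (dC _) _; rewrite ler_peMr// ler1n.
  by rewrite normrM -[leRHS]mulr1 ler_pM// normrM mulr_ile1// sin_max.
Qed.

Lemma rotation_free_wave (xi : Rn R n) (a : R) (i j : 'I_n) :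
  tnth xi i * \int[leb]_x (w j x * sin (dotp x xi + a)) =
  tnth xi j * \int[leb]_x (w i x * sin (dotp x xi + a)).
Proof.
have h := @cvg_integral_wave_packet xi a i j.
have h' := @cvg_integral_wave_packet xi a j i.
have e : \int[leb]_x (w j x * (- (tnth xi i * (bump 0 ^+ n * sin (dotp x xi + a))))) =
  \int[leb]_x (w i x * (- (tnth xi j * (bump 0 ^+ n * sin (dotp x xi + a))))).
  have hh : (fun m => \int[leb]_x (w j x * 'D_(delta_mx 0 i) (wave_packet xi a m) (rV_of_Rn x))) =
      (fun m => \int[leb]_x (w i x * 'D_(delta_mx 0 j) (wave_packet xi a m) (rV_of_Rn x))).
    by apply/funext => m; apply: wrot; exact: test_wave_packet.
  rewrite hh in h.
  exact: (@cvg_unique R (@norm_hausdorff R R) _ _ _ _ h h').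
have ms : measurable_fun setT (fun x => sin (dotp x xi + a)).
  by apply: measurable_sin_comp; apply: measurable_funD => //; exact: measurable_dotp.
have E (k l : 'I_n) : \int[leb]_x (w k x * (- (tnth xi l * (bump 0 ^+ n * sin (dotp x xi + a))))) =
   - bump 0 ^+ n * (tnth xi l * \int[leb]_x (w k x * sin (dotp x xi + a))).
  rewrite mulrA -RintegralZl//; last by apply: integrable_trig => // x; exact: sin_max.
  by apply: eq_Rintegral => x _; ring.
move: e; rewrite !E => /mulfI; apply.
by rewrite oppr_eq0 expf_neq0// gt_eqF// bump0_gt0.
Qed.

Lemma rotation_free_sinT (xi : Rn R n) (i j : 'I_n) : tnth xi i * sinT (w j) xi = tnth xi j * sinT (w i) xi.
Proof.
have := rotation_free_wave xi 0 i j; rewrite /sinT.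
by under eq_Rintegral do rewrite addr0; under [in RHS]eq_Rintegral do rewrite addr0.
Qed.

Lemma rotation_free_cosT (xi : Rn R n) (i j : 'I_n) : tnth xi i * cosT (w j) xi = tnth xi j * cosT (w i) xi.
Proof.
have := rotation_free_wave xi (pi / 2) i j; rewrite /cosT.
by under eq_Rintegral do rewrite sinDpihalf; under [in RHS]eq_Rintegral do rewrite sinDpihalf.
Qed.

End rotation_free_fourier.

(** * Reduction of the Fourier system to real oscillators *)

Section real_and_imaginary_parts.
Context {R : realType}.
Local Open Scope complex_scope.

Lemma Re_sum I (r : seq I) (F : I -> R[i]) : complex.Re (\sum_(i <- r) F i) = \sum_(i <- r) complex.Re (F i).
Proof. by elim/big_rec2: _ => [//|i y1 y2 _ <-]; case: (F i) => a c; case: y2. Qed.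

Lemma Im_sum I (r : seq I) (F : I -> R[i]) : complex.Im (\sum_(i <- r) F i) = \sum_(i <- r) complex.Im (F i).
Proof. by elim/big_rec2: _ => [//|i y1 y2 _ <-]; case: (F i) => a c; case: y2. Qed.

Lemma Re_realM (a : R) (z : R[i]) : complex.Re (a%:C * z) = a * complex.Re z.
Proof. by case: z => x y /=; rewrite mul0r subr0. Qed.

Lemma Im_realM (a : R) (z : R[i]) : complex.Im (a%:C * z) = a * complex.Im z.
Proof. by case: z => x y /=; rewrite mul0r addr0. Qed.

Lemma Re_accel (a c : R) (z y : R[i]) :
  complex.Re (- a%:C * z - 'i * c%:C * y) = - (a * complex.Re z) + c * complex.Im y.
Proof. by case: z => z1 z2; case: y => y1 y2 /=; ring. Qed.

Lemma Im_accel (a c : R) (z y : R[i]) :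
  complex.Im (- a%:C * z - 'i * c%:C * y) = - (a * complex.Im z) - c * complex.Re y.
Proof. by case: z => z1 z2; case: y => y1 y2 /=; ring. Qed.

End real_and_imaginary_parts.

Section fourier_ode.
Context {R : realType} (n : nat).
Variables (b kappa gamma1 gamma2 : R) (xi : Rn R n).
Variables (uh0 uh1 : 'I_n -> R[i]) (th0 : R[i]) (uh vh : R -> 'I_n -> R[i]) (th : R -> R[i]).
Local Notation r := (enorm xi).

Hypothesis init : forall j, [/\ continuous_Rplus (uh ^~ j), continuous_Rplus (vh ^~ j),
                    uh 0 j = uh0 j & vh 0 j = uh1 j].
Hypothesis cth : continuous_Rplus th.
Hypothesis eq_u : forall (t : R) j, 0 < t ->
        is_cderive (uh ^~ j) t (vh t j) /\
        is_cderive (vh ^~ j) t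
          (- (b ^+ 2 * r ^+ 2)%:C%C * uh t j
           - 'i%C * (gamma1 * tnth xi j)%:C%C * th t).
Hypothesis eq_th : forall t : R, 0 < t ->
        is_cderive th t
          (- (kappa * r ^+ 2)%:C%C * th t
           - 'i%C * gamma2%:C%C * \sum_(j < n) (tnth xi j)%:C%C * vh t j).

(** Uniqueness by conservation of y^2 + om^2 z^2; concluding on [y] alone covers om = 0 as well. *)
Let harmonic_zero (z y : R -> R) (om : R) : {within `[0, +oo[, continuous z} ->
  {within `[0, +oo[, continuous y} -> (forall t : R, 0 < t -> is_derive t 1 z (y t)) ->
  (forall t : R, 0 < t -> is_derive t 1 y (- (om ^+ 2 * z t))) -> z 0 = 0 -> y 0 = 0 ->
  forall t, 0 <= t -> y t = 0.
Proof.
move=> cz cy dz dy z0 y0 t t0.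
have : y t ^+ 2 + om ^+ 2 * z t ^+ 2 <= y 0 ^+ 2 + om ^+ 2 * z 0 ^+ 2.
  apply: (@le0_derive_halfline _ (fun s => y s ^+ 2 + om ^+ 2 * z s ^+ 2) (fun=> 0)) => //.
  - have sq (f : R -> R) : {within `[0, +oo[, continuous f} ->
      {within `[0, +oo[, continuous (fun s => f s ^+ 2)}.
      move=> cf x.
      have h : f y * f y @[y --> nbhs (x : subspace `[0, +oo[%classic)] --> f x * f x.
        by apply: cvgM; exact: cf.
      by have -> : (fun s => f s ^+ 2) = (fun s => f s * f s) by apply/funext => s; rewrite expr2.
    move=> x; apply: cvgD; first exact: sq.
    by apply: cvgM; [exact: cvg_cst|exact: sq].
  - move=> s s0; have dz' := dz s s0; have dy' := dy s s0.
    by apply: is_derive_eq; rewrite /GRing.scale /=; ring.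
rewrite z0 y0 !expr0n /= mulr0 addr0 => h; apply/eqP; rewrite -sqrf_eq0 eq_le sqr_ge0 andbT.
by apply: le_trans h; rewrite lerDl mulr_ge0 ?sqr_ge0.
Qed.

Hypothesis par0 : forall i j, (tnth xi i)%:C%C * uh0 j = (tnth xi j)%:C%C * uh0 i.
Hypothesis par1 : forall i j, (tnth xi i)%:C%C * uh1 j = (tnth xi j)%:C%C * uh1 i.

(** The forcing by theta^ is parallel to xi and drops out of xi_i u^_j - xi_j u^_i. This combination
    solves the free harmonic equation with zero data, hence its velocity stays 0. *)
Let parRe (t : R) i j : 0 <= t -> tnth xi i * complex.Re (vh t j) = tnth xi j * complex.Re (vh t i).
Proof.
move=> t0; apply/eqP; rewrite -subr_eq0; apply/eqP.
have [[cui _] [cvi _] u0i v0i] := init i; have [[cuj _] [cvj _] u0j v0j] := init j.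
apply: (@harmonic_zero (fun t => tnth xi i * complex.Re (uh t j) - tnth xi j * complex.Re (uh t i))
  (fun t => tnth xi i * complex.Re (vh t j) - tnth xi j * complex.Re (vh t i)) (b * r)) => //.
- by move=> x; apply: cvgB; apply: cvgM; [exact: cvg_cst|exact: cuj|exact: cvg_cst|exact: cui].
- by move=> x; apply: cvgB; apply: cvgM; [exact: cvg_cst|exact: cvj|exact: cvg_cst|exact: cvi].
- move=> s s0; have [[d1 _] _] := eq_u i s0; have [[d2 _] _] := eq_u j s0.
  by apply: is_derive_eq; rewrite /GRing.scale /=; ring.
- move=> s s0; have [_ [d1 _]] := eq_u i s0; have [_ [d2 _]] := eq_u j s0.
  by apply: is_derive_eq; rewrite !Re_accel /GRing.scale /=; ring.
- by rewrite u0i u0j -!Re_realM par0 subrr.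
- by rewrite v0i v0j -!Re_realM par1 subrr.
Qed.

Let parIm (t : R) i j : 0 <= t -> tnth xi i * complex.Im (vh t j) = tnth xi j * complex.Im (vh t i).
Proof.
move=> t0; apply/eqP; rewrite -subr_eq0; apply/eqP.
have [[_ cui] [_ cvi] u0i v0i] := init i; have [[_ cuj] [_ cvj] u0j v0j] := init j.
apply: (@harmonic_zero (fun t => tnth xi i * complex.Im (uh t j) - tnth xi j * complex.Im (uh t i))
  (fun t => tnth xi i * complex.Im (vh t j) - tnth xi j * complex.Im (vh t i)) (b * r)) => //.
- by move=> x; apply: cvgB; apply: cvgM; [exact: cvg_cst|exact: cuj|exact: cvg_cst|exact: cui].
- by move=> x; apply: cvgB; apply: cvgM; [exact: cvg_cst|exact: cvj|exact: cvg_cst|exact: cvi].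
- move=> s s0; have [[_ d1] _] := eq_u i s0; have [[_ d2] _] := eq_u j s0.
  by apply: is_derive_eq; rewrite /GRing.scale /=; ring.
- move=> s s0; have [_ [_ d1]] := eq_u i s0; have [_ [_ d2]] := eq_u j s0.
  by apply: is_derive_eq; rewrite !Im_accel /GRing.scale /=; ring.
- by rewrite u0i u0j -!Im_realM par0 subrr.
- by rewrite v0i v0j -!Im_realM par1 subrr.
Qed.

Lemma enorm_sqr : r ^+ 2 = \sum_(j < n) tnth xi j ^+ 2.
Proof.
rewrite sqr_sqrtr; last by apply: sumr_ge0 => j _; rewrite -expr2 sqr_ge0.
by rewrite /dotp; apply: eq_bigr => j _; rewrite expr2.
Qed.

(** For f parallel to xi the divergence term closes up: xi_k times xi . f depends on the k-th
    component alone. This is what decouples the components. *)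
Let div_v (f : 'I_n -> R) k : (forall i j, tnth xi i * f j = tnth xi j * f i) ->
  tnth xi k * \sum_(j < n) tnth xi j * f j = r ^+ 2 * f k.
Proof.
move=> h; rewrite mulr_sumr enorm_sqr mulr_suml; apply: eq_bigr => j _.
by rewrite mulrCA h; ring.
Qed.

(** G is the real part of i gamma1 xi_k theta^; the factor i brings in the imaginary part of theta^
    with a minus sign. *)
Lemma oscillator_Re k : oscillator b kappa (gamma1 * gamma2) r (fun t => complex.Re (uh t k))
  (fun t => complex.Re (vh t k)) (fun t => - (gamma1 * tnth xi k * complex.Im (th t))).
Proof.
have [[cu _] [cv _] _ _] := init k; have [_ ct] := cth.
split=> //.
- by move=> x; apply: cvgN; apply: cvgM; [exact: cvg_cst|exact: ct].
- by move=> t t0; have [[d _] _] := eq_u k t0.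
- move=> t t0; have [_ [d _]] := eq_u k t0.
  by apply: is_derive_eq; rewrite Re_accel; ring.
- move=> t t0; have [_ d] := eq_th t0.
  apply: is_derive_eq; rewrite Im_accel /GRing.scale /= Re_sum.
  under eq_bigr do rewrite Re_realM.
  have := @div_v (fun j => complex.Re (vh t j)) k (fun i j => parRe i j (ltW t0)).
  move: (\sum_(i < n) _) => S h.
  have -> : gamma1 * gamma2 * r ^+ 2 * complex.Re (vh t k) = gamma1 * gamma2 * (tnth xi k * S) by rewrite h; ring.
  by ring.
Qed.

Lemma oscillator_Im k : oscillator b kappa (gamma1 * gamma2) r (fun t => complex.Im (uh t k))
  (fun t => complex.Im (vh t k)) (fun t => gamma1 * tnth xi k * complex.Re (th t)).
Proof.
have [[_ cu] [_ cv] _ _] := init k; have [ct _] := cth.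
split=> //.
- by move=> x; apply: cvgM; [exact: cvg_cst|exact: ct].
- by move=> t t0; have [[_ d] _] := eq_u k t0.
- move=> t t0; have [_ [_ d]] := eq_u k t0.
  by apply: is_derive_eq; rewrite Im_accel; ring.
- move=> t t0; have [d _] := eq_th t0.
  apply: is_derive_eq; rewrite Re_accel /GRing.scale /= Im_sum.
  under eq_bigr do rewrite Im_realM.
  have := @div_v (fun j => complex.Im (vh t j)) k (fun i j => parIm i j (ltW t0)).
  move: (\sum_(i < n) _) => S h.
  have -> : gamma1 * gamma2 * r ^+ 2 * complex.Im (vh t k) = gamma1 * gamma2 * (tnth xi k * S) by rewrite h; ring.
  by ring.
Qed.

End fourier_ode.

(** * Upper bound *)

Section oscillator_bounds.
Context {R : realType}.
Variables (b kappa gamma rho : R).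
Hypotheses (b0 : 0 < b) (kappa0 : 0 < kappa) (gamma0 : 0 < gamma) (rho0 : 0 < rho).

Definition half_rate : R := decay_rate b kappa gamma / 2.

Lemma half_rate_gt0 : 0 < half_rate.
Proof. by rewrite divr_gt0// decay_rate_gt0. Qed.

Definition energy_const : R := 1 + b ^+ 2 + rho.

Lemma energy_const_ge1 : 1 <= energy_const.
Proof. by rewrite /energy_const -addrA lerDl addr_ge0 ?sqr_ge0// ltW. Qed.

Lemma energy_const_gt0 : 0 < energy_const.
Proof. exact: lt_le_trans energy_const_ge1. Qed.

(** [y] stands for a part of theta^ at time 0. The factor xi_k in G compensates the division by r^2
    in the energy; at r = 0 that quotient is 0 by convention. *)
Lemma initial_energy_le (r w v G y : R) : 0 <= r -> G ^+ 2 <= gamma * rho * r ^+ 2 * y ^+ 2 ->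
  energy b gamma r w v G <= energy_const * (v ^+ 2 + y ^+ 2 + r ^+ 2 * w ^+ 2).
Proof.
move=> r0 hG; have := sqr_ge0 v; have := sqr_ge0 w; have := sqr_ge0 y; have := sqr_ge0 r => r2 y2 w2 v2.
have b2 := sqr_ge0 b; have rw2 := mulr_ge0 r2 w2.
have hG' : G ^+ 2 / (gamma * r ^+ 2) <= rho * y ^+ 2.
  move: r0; rewrite le_eqVlt => /orP[/eqP<-|r0].
    by rewrite expr0n/= mulr0 invr0 mulr0 mulr_ge0// ltW.
  by rewrite ler_pdivrMr ?mulr_gt0 ?exprn_gt0//; apply: le_trans hG _; rewrite le_eqVlt; apply/orP; left; apply/eqP; ring.
rewrite /energy /energy_const.
have h1 := mulr_ge0 b2 v2; have h2 := mulr_ge0 b2 y2; have h3 := mulr_ge0 (ltW rho0) v2.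
have h4 := mulr_ge0 (ltW rho0) rw2; rewrite -mulrA; lra.
Qed.

Variables (r : R) (w v G : R -> R) (y : R).
Hypotheses (r0 : 0 <= r) (osc : oscillator b kappa gamma r w v G).
Hypothesis hG : G 0 ^+ 2 <= gamma * rho * r ^+ 2 * y ^+ 2.
Local Notation K := (w 0 ^+ 2 + v 0 ^+ 2 + y ^+ 2).

Let K0 : 0 <= K. Proof. by rewrite !addr_ge0 ?sqr_ge0. Qed.

Let d0 : 0 <= decay_rate b kappa gamma. Proof. exact/ltW/decay_rate_gt0. Qed.

Let S0 : 0 <= v 0 ^+ 2 + y ^+ 2 + r ^+ 2 * w 0 ^+ 2.
Proof. by rewrite !addr_ge0 ?sqr_ge0// mulr_ge0 ?sqr_ge0. Qed.

Lemma oscillator_decay (t : R) : 0 < r -> 0 <= t ->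
  w t ^+ 2 <= 4 * energy_const / (b ^+ 2 * r ^+ 2) * expR (- (decay_rate b kappa gamma * (r ^+ 2 / (1 + r ^+ 2)) * t)) *
  (v 0 ^+ 2 + y ^+ 2 + r ^+ 2 * w 0 ^+ 2).
Proof.
move=> rgt0 t0.
have h1 := energy_ge_w b gamma0 r (w t) (v t) (G t).
have h2 := energy_decay b0 kappa0 gamma0 rgt0 t0 osc.
have h3 := initial_energy_le (w 0) (v 0) r0 hG.
rewrite [leRHS](_ : _ = 4 * expR (- (decay_rate b kappa gamma * (r ^+ 2 / (1 + r ^+ 2)) * t)) *
  (energy_const * (v 0 ^+ 2 + y ^+ 2 + r ^+ 2 * w 0 ^+ 2)) / (b ^+ 2 * r ^+ 2)); last by ring.
rewrite ler_pdivlMr ?mulr_gt0 ?exprn_gt0// mulrC; apply: le_trans h1 _; apply: le_trans h2 _.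
by rewrite ler_wpM2l// mulr_ge0 ?expR_ge0.
Qed.

(** For r >= 1 the ratio r^2 / (1 + r^2) is at least 1/2, and the division by r^2 in
    [oscillator_decay] absorbs r^2 w(0)^2. *)
Lemma oscillator_high (t : R) : 1 <= r -> 0 <= t ->
  w t ^+ 2 <= 4 * energy_const / b ^+ 2 * expR (- (half_rate * t)) * K.
Proof.
move=> r1 t0; have rgt0 : 0 < r by exact: lt_le_trans r1.
apply: le_trans (oscillator_decay rgt0 t0) _.
have r2 : 1 <= r ^+ 2 by rewrite -(expr1n _ 2) lerXn2r ?nnegrE// ltW.
rewrite [leLHS](_ : _ = 4 * energy_const / b ^+ 2 *
  (expR (- (decay_rate b kappa gamma * (r ^+ 2 / (1 + r ^+ 2)) * t)) *
   ((v 0 ^+ 2 + y ^+ 2 + r ^+ 2 * w 0 ^+ 2) / r ^+ 2))); last by field; rewrite !gt_eqF//; lra.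
rewrite -[leRHS]mulrA ler_wpM2l ?divr_ge0 ?sqr_ge0 ?mulr_ge0 ?(ltW energy_const_gt0)//.
apply: ler_pM; rewrite ?expR_ge0 ?divr_ge0 ?sqr_ge0//.
  rewrite ler_expR lerN2 ler_wpM2r// ler_wpM2l//.
  rewrite ler_pdivlMr; lra.
rewrite ler_pdivrMr ?exprn_gt0//.
have := sqr_ge0 (w 0); have := sqr_ge0 (v 0); have := sqr_ge0 y.
set r2' := r ^+ 2 in r2 *; set w2 := w 0 ^+ 2; set v2 := v 0 ^+ 2; set y2 := y ^+ 2 => h1 h2 h3.
by have := mulr_ge0 h2 (_ : 0 <= r2' - 1); have := mulr_ge0 h1 (_ : 0 <= r2' - 1); lra.
Qed.

(** The singular factor r^-2 is replaced by a scale [s] above it, and r^2 / (1 + r^2) >= r^2 / 2 for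
    r <= 1. *)
Lemma oscillator_low_decay (t s : R) : 0 < r -> r <= 1 -> 0 <= t -> 1 <= s * r ^+ 2 ->
  w t ^+ 2 <= 4 * energy_const / b ^+ 2 * s * expR (- (half_rate * (t * r ^+ 2))) * K.
Proof.
move=> rgt0 r1 t0 hs.
apply: le_trans (oscillator_decay rgt0 t0) _.
have r2 : 0 < r ^+ 2 by rewrite exprn_gt0.
have r21 : r ^+ 2 <= 1 by rewrite -(expr1n _ 2) lerXn2r ?nnegrE// ltW.
rewrite [leLHS](_ : _ = 4 * energy_const / b ^+ 2 *
  (r ^- 2 * expR (- (decay_rate b kappa gamma * (r ^+ 2 / (1 + r ^+ 2)) * t)) *
   ((v 0 ^+ 2 + y ^+ 2 + r ^+ 2 * w 0 ^+ 2)))); last by field; rewrite !gt_eqF//; lra.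
rewrite -2![leRHS]mulrA ler_wpM2l ?divr_ge0 ?sqr_ge0 ?mulr_ge0 ?(ltW energy_const_gt0)//.
rewrite [leRHS]mulrA.
have s0 : r ^- 2 <= s by rewrite -[leLHS]mul1r ler_pdivrMr.
apply: ler_pM; rewrite ?mulr_ge0 ?expR_ge0 ?invr_ge0 ?sqr_ge0//.
  apply: ler_pM; rewrite ?expR_ge0 ?invr_ge0 ?sqr_ge0//.
  rewrite ler_expR lerN2 [t * _]mulrC [leLHS]mulrA ler_wpM2r// /half_rate -[leLHS]mulrA.
  rewrite ler_wpM2l// ler_pdivlMr; last lra.
  by have := mulr_ge0 (ltW r2) (_ : 0 <= 1 - r ^+ 2); lra.
by have := ler_wpM2r (sqr_ge0 (w 0)) r21; lra.
Qed.

(** 18 = 2 + 16: since t^2 r^2 <= 2, the energy term 8 t^2 r^2 w(0)^2 costs at most 16 w(0)^2, in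
    addition to the 2 w(0)^2 of [oscillator_drift]. *)
Lemma oscillator_low_drift (t : R) : 1 <= t -> t ^+ 2 * r ^+ 2 <= 2 ->
  (r = 0 -> forall s : R, 0 < s -> G s = 0) ->
  w t ^+ 2 <= 18 * energy_const * t ^+ 2 * K.
Proof.
move=> t1 tr G00; have t0 : 0 <= t by lra.
apply: le_trans (oscillator_drift b0 kappa0 gamma0 r0 t0 osc G00) _.
have h3 := initial_energy_le (w 0) (v 0) r0 hG.
have t2 : 1 <= t ^+ 2 by rewrite -(expr1n _ 2) lerXn2r ?nnegrE.
have h4 : 8 * t ^+ 2 * energy b gamma r (w 0) (v 0) (G 0) <=
  8 * t ^+ 2 * (energy_const * (v 0 ^+ 2 + y ^+ 2 + r ^+ 2 * w 0 ^+ 2)).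
  by rewrite ler_wpM2l// mulr_ge0 ?sqr_ge0.
apply: le_trans (lerD (lexx _) h4) _.
have M1 := energy_const_ge1; have := sqr_ge0 (w 0); have := sqr_ge0 (v 0); have := sqr_ge0 y.
set T := t ^+ 2 in tr t2 *; set q := r ^+ 2 in tr *; set M := energy_const in M1 *.
set w2 := w 0 ^+ 2; set v2 := v 0 ^+ 2; set y2 := y ^+ 2 => hy hv hw.
clearbody T q M w2 v2 y2.
have M0 : 0 <= M by lra.
have T0 : 0 <= T by lra.
have a1 : M * w2 * (T * q) <= M * w2 * 2 by rewrite ler_wpM2l// mulr_ge0.
have a2 : w2 <= M * w2 * T.
  by rewrite mulrAC ler_peMl// -[1]mulr1 ler_pM.
have a3 : M * w2 <= M * w2 * T by rewrite ler_peMr // mulr_ge0.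
have a4 : 0 <= M * T * v2 by rewrite !mulr_ge0.
have a5 : 0 <= M * T * y2 by rewrite !mulr_ge0.
rewrite [leLHS](_ : _ = 2 * w2 + 8 * (M * T * v2) + 8 * (M * T * y2) + 8 * (M * w2 * (T * q))); last by ring.
rewrite [leRHS](_ : _ = 18 * (M * w2 * T) + 18 * (M * T * v2) + 18 * (M * T * y2)); last by ring.
lra.
Qed.

(** 8 = 4 * 2 because r^-2 is at most twice the chosen scale, 36 = 18 * 2 because t^2 is at most
    twice the last scale, and the exponential compensates a Gaussian evaluated where s r^2 <= 1. *)
Definition dyadic_const : R := expR half_rate * (8 * energy_const / b ^+ 2 + 36 * energy_const).

Lemma dyadic_search (x : R) J : [\/ 1 < x, x * 2 ^+ J <= 1 |
  exists2 j, (j < J)%N & x * 2 ^+ j <= 1 /\ 1 < x * 2 ^+ j.+1].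
Proof.
elim: J => [|J [h|h|[j jJ h]]].
- by rewrite expr0 mulr1; case: (leP x 1) => h; [apply: Or32|apply: Or31].
- exact: Or31.
- by case: (leP (x * 2 ^+ J.+1) 1) => h'; [apply: Or32|apply: Or33; exists J].
- by apply: Or33; exists j => //; exact: ltnW.
Qed.

(** Only one term of the sum is used: the scale s_j = t 2^j just below r^-2, where the decay bound
    applies and the Gaussian is bounded below. If r^-2 < t, the decay bound is used with s = t, the
    first scale; if r^-2 lies above the last scale, which is at least t^2 / 2, the drift bound takes
    over. *)
Lemma oscillator_dyadic (t : R) J : 1 <= t -> t <= 2 ^+ J.+1 -> r <= 1 ->
  (r = 0 -> forall s : R, 0 < s -> G s = 0) ->
  w t ^+ 2 <= dyadic_const *
    (\sum_(j < J.+1) t * 2 ^+ j * expR (- (half_rate * (t * 2 ^+ j * r ^+ 2)))) * K.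
Proof.
move=> t1 tJ r1 G00.
have t0 : 0 <= t by lra.
have M0 := energy_const_gt0; have c0 := half_rate_gt0.
have b20 : 0 < b ^+ 2 by rewrite exprn_gt0.
have suff_term (j : 'I_J.+1) : w t ^+ 2 <= dyadic_const *
    (t * 2 ^+ j * expR (- (half_rate * (t * 2 ^+ j * r ^+ 2)))) * K ->
  w t ^+ 2 <= dyadic_const *
    (\sum_(j < J.+1) t * 2 ^+ j * expR (- (half_rate * (t * 2 ^+ j * r ^+ 2)))) * K.
  move=> h; apply: le_trans h _; rewrite ler_wpM2r// ler_wpM2l//.
    by rewrite mulr_ge0 ?expR_ge0// addr_ge0 ?divr_ge0 ?mulr_ge0// ltW.
  rewrite (bigD1 j)//= lerDl; apply: sumr_ge0 => i _.
  by rewrite !mulr_ge0 ?exprn_ge0 ?expR_ge0.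
(* Where s r^2 <= 1 the Gaussian is at least exp(- half_rate), so it can be inserted at the price of
   a constant. *)
have term (s D : R) : 0 <= s -> 0 <= D -> s * r ^+ 2 <= 1 -> D <= 8 * energy_const / b ^+ 2 + 36 * energy_const ->
    w t ^+ 2 <= D * s * K -> w t ^+ 2 <= dyadic_const * (s * expR (- (half_rate * (s * r ^+ 2)))) * K.
  move=> s0 D0 sr hD h; apply: le_trans h _; rewrite ler_wpM2r// /dyadic_const.
  rewrite [leRHS](_ : _ = (8 * energy_const / b ^+ 2 + 36 * energy_const) * s *
     (expR half_rate * expR (- (half_rate * (s * r ^+ 2))))); last by ring.
  rewrite -expRD -[leLHS]mulr1 ler_pM ?ler_wpM2r ?mulr_ge0//.
  by rewrite -expR0 ler_expR subr_ge0 ler_piMr// ltW.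
have [h|h|[j jJ [h h']]] := dyadic_search (t * r ^+ 2) J.
- apply: (suff_term ord0); rewrite expr0 mulr1.
  have rgt0 : 0 < r.
    by rewrite lt_neqAle r0 andbT; apply: contraTneq h => <-; rewrite expr0n/= mulr0 -leNgt.
  apply: le_trans (oscillator_low_decay rgt0 r1 t0 (ltW h)) _.
  rewrite ler_wpM2r// -[leLHS]mulrA ler_wpM2r ?mulr_ge0 ?expR_ge0//.
  rewrite /dyadic_const -[leLHS]mul1r ler_pM//.
  + by rewrite divr_ge0 ?mulr_ge0// ltW.
  + by rewrite -expR0 ler_expR ltW.
  + have := divr_gt0 M0 b20; rewrite -!mulrA; lra.
- apply: (suff_term ord_max); apply: (term _ (36 * energy_const)).
  + by rewrite mulr_ge0// exprn_ge0.
  + by rewrite mulr_ge0// ltW.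
  + by rewrite mulrAC.
  + by rewrite lerDr divr_ge0 ?mulr_ge0// ltW.
  + have hs : t ^+ 2 <= 2 * (t * 2 ^+ J) by rewrite expr2 mulrCA -exprS ler_wpM2l.
    have htr : t ^+ 2 * r ^+ 2 <= 2.
      apply: le_trans (ler_wpM2r (sqr_ge0 r) hs) _.
      by rewrite -[leLHS]mulrA -[leRHS]mulr1 ler_wpM2l// mulrAC.
    apply: le_trans (oscillator_low_drift t1 htr G00) _.
    rewrite ler_wpM2r// -[leLHS]mulrA; have := ler_wpM2l (ltW M0) hs.
    by rewrite /=; set x := t * 2 ^+ J; lra.
- apply: (suff_term (widen_ord (leqnSn _) (Ordinal jJ))) => /=; apply: (term _ (8 * energy_const / b ^+ 2)).
  + by rewrite mulr_ge0// exprn_ge0.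
  + by rewrite divr_ge0 ?mulr_ge0// ltW.
  + by rewrite mulrAC.
  + by rewrite lerDl mulr_ge0// ltW.
  + have rgt0 : 0 < r.
      by rewrite lt_neqAle r0 andbT; apply: contraTneq h' => <-; rewrite expr0n/= mulr0 mul0r -leNgt.
    have h2 : 1 <= (t * 2 ^+ j.+1) * r ^+ 2 by rewrite mulrAC ltW.
    apply: le_trans (oscillator_low_decay rgt0 r1 t0 h2) _.
    rewrite ler_wpM2r// -[leRHS]mulr1; apply: ler_pM; rewrite ?expR_ge0//.
    * by rewrite mulr_ge0 ?divr_ge0 ?mulr_ge0 ?exprn_ge0 ?(ltW b20) ?(ltW M0)//; exact: ltW.
    * by rewrite le_eqVlt; apply/orP; left; apply/eqP; rewrite [2 ^+ j.+1]exprS; ring.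
    * by rewrite expR_le1 oppr_le0 (mulr_ge0 (ltW c0))// mulr_ge0 ?sqr_ge0.
Qed.

End oscillator_bounds.

(** * Gaussian integrals on R^n *)

Section gaussian.
Context {R : realType}.
Local Notation mu := (@lebesgue_measure R).
Local Notation leb n := (lebesgue_Rn R n).

Definition gauss_mass : R := \int[mu]_x gauss_fun x.

Lemma gauss_mass_ge0 : 0 <= gauss_mass.
Proof. by apply: Rintegral_ge0 => x _; exact: gauss_fun_ge0. Qed.

Lemma integral_gaussian (s : R) : 0 < s ->
  (\int[mu]_x (expR (- (s * x ^+ 2)))%:E = (gauss_mass / Num.sqrt s)%:E)%E.
Proof.
move=> s0; have q0 : 0 < Num.sqrt s by rewrite sqrtr_gt0.
have mg : measurable_fun setT (fun x : measurableTypeR R => (gauss_fun x)%:E).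
  by apply/measurable_EFinP; exact: measurable_gauss_fun.
have := @ge0_integral_affine R (Num.sqrt s) 0 (fun x => (gauss_fun x)%:E) q0 mg.
have -> : (\int[mu]_x (gauss_fun x)%:E = gauss_mass%:E)%E.
  by rewrite /gauss_mass EFin_Rintegral//; exact: (@integrableT_gauss R).
move=> /(_ (fun x => gauss_fun_ge0 x)); rewrite -EFinM mulrC => <-.
by apply: eq_integral => x _; rewrite /gauss_fun addr0 exprMn sqr_sqrtr// ltW.
Qed.

Lemma integral_prod_Rn n (g : R -> R) (c : R) : measurable_fun setT g -> (forall x, 0 <= g x) ->
  (\int[mu]_x (g x)%:E = c%:E)%E ->
  (\int[leb n]_x (\prod_(i < n) g (tnth x i))%:E = (c ^+ n)%:E)%E.
Proof.
move=> mg g0 gc.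
have mp m : measurable_fun setT (fun x : Rn R m => \prod_(i < m) g (tnth x i)).
  apply: measurable_prod => i _; apply: (measurableT_comp mg); exact: measurable_tnth.
have p0 m (x : Rn R m) : 0 <= \prod_(i < m) g (tnth x i) by apply: prodr_ge0.
have c0 : 0 <= c by rewrite -lee_fin -gc; apply: integral_ge0 => x _; rewrite lee_fin.
elim: n => [|n IH].
  by rewrite integral_Rn0 ?big_ord0 ?expr0//; apply/measurable_EFinP; exact: mp.
rewrite ge0_integral_RnS; [|by apply/measurable_EFinP; exact: mp|by move=> x; rewrite lee_fin].
have mpE : measurable_fun setT (fun x : Rn R n => (\prod_(i < n) g (tnth x i))%:E).
  by apply/measurable_EFinP; exact: mp.
have E (x : R) : (\int[leb n]_y (\prod_(i < n.+1) g (tnth (cons_Rn (x, y)) i))%:E = (g x)%:E * (c ^+ n)%:E)%E.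
  transitivity (\int[leb n]_y ((g x)%:E * (\prod_(i < n) g (tnth y i))%:E))%E.
    apply: eq_integral => y _; rewrite -EFinM big_ord_recl; congr (_ * _)%:E.
    by apply: eq_bigr => i _; rewrite tnthS.
  by rewrite ge0_integralZl ?IH ?lee_fin// => y _; rewrite lee_fin.
under eq_integral do rewrite E.
have mgE : measurable_fun setT (fun x : measurableTypeR R => (g x)%:E) by exact/measurable_EFinP.
rewrite ge0_integralZr//; [|by move=> x _; rewrite lee_fin|by rewrite lee_fin exprn_ge0].
by rewrite gc -EFinM -exprS.
Qed.

Lemma measurable_gaussian n (s : R) :
  measurable_fun setT (fun x : Rn R n => expR (- (s * enorm x ^+ 2))).
Proof.
apply: measurable_expR_comp; apply: measurable_funN; apply: measurable_funM => //.
by apply: measurable_funX; exact: measurable_enorm.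
Qed.

Lemma integral_gaussian_Rn n (s : R) : 0 < s ->
  (\int[lebesgue_Rn R n]_x (expR (- (s * enorm x ^+ 2)))%:E = ((gauss_mass / Num.sqrt s) ^+ n)%:E)%E.
Proof.
move=> s0; rewrite -(@integral_prod_Rn n (fun x => expR (- (s * x ^+ 2)))).
- by apply: eq_integral => x _; rewrite -expR_sum enorm_sqr mulr_sumr sumrN.
- by apply: measurable_expR_comp; apply: measurable_funN; apply: measurable_funM => //; exact: measurable_funX.
- by move=> x; exact: expR_ge0.
- exact: integral_gaussian.
Qed.

End gaussian.

(** * Pointwise bound of the transformed solution *)

Section pointwise.
Context {R : realType} (n : nat).
Local Notation leb := (lebesgue_Rn R n).

Definition sqnormC (z : R[i]) : R := complex.Re z ^+ 2 + complex.Im z ^+ 2.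

Lemma sqnormC_ge0 z : 0 <= sqnormC z.
Proof. by rewrite addr_ge0 ?sqr_ge0. Qed.

Lemma sqnormC_fourier (f : Rn R n -> R) xi : sqnormC (fourier f xi) = power f xi.
Proof. by rewrite /sqnormC /fourier /= sqrrN. Qed.

Lemma power_le (f : Rn R n -> R) xi : leb.-integrable setT (EFin \o f) ->
  power f xi <= 2 * (\int[leb]_x `|f x|) ^+ 2.
Proof.
move=> fi; have /measurable_EFinP mf := measurable_int _ fi.
have ai : leb.-integrable setT (EFin \o (fun x => `|f x|)) by exact: integrable_norm.
have h (c : R -> R) : measurable_fun setT (fun x : Rn R n => c (dotp x xi)) -> (forall x, `|c x| <= 1) ->
  (\int[leb]_x (f x * c (dotp x xi))) ^+ 2 <= (\int[leb]_x `|f x|) ^+ 2.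
  move=> mc c1; rewrite -[leLHS]real_normK ?num_real// lerXn2r ?nnegrE//.
    by apply: Rintegral_ge0.
  apply: le_Rintegral_dom => //; first exact: measurable_funM.
  by move=> x; rewrite normrM ler_piMr.
rewrite mulr_natl mulr2n lerD// h//.
- exact: measurable_cosdot.
- by move=> x; rewrite ler_norml cos_geN1 cos_le1.
- exact: measurable_sindot.
- by move=> x; rewrite ler_norml sin_geN1 sin_le1.
Qed.

Variables (b kappa gamma1 gamma2 : R).
Hypotheses (b0 : 0 < b) (kappa0 : 0 < kappa) (gamma0 : 0 < gamma1 * gamma2).
Local Notation gamma := (gamma1 * gamma2).
(** Chosen so that gamma rho = gamma1^2, the square of the coupling constant in G. *)
Let rho : R := gamma1 ^+ 2 / gamma.

Let gamma1_neq0 : gamma1 != 0.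
Proof. by apply: contraTneq gamma0 => ->; rewrite mul0r ltxx. Qed.

Let rho0 : 0 < rho.
Proof. by rewrite divr_gt0// lt_neqAle sqr_ge0 andbT eq_sym sqrf_eq0. Qed.

Definition frequency_rate : R := half_rate b kappa gamma.

Definition frequency_const : R :=
  dyadic_const b kappa gamma rho + 4 * energy_const b rho / b ^+ 2.

Let dyadic_const_ge0 : 0 <= dyadic_const b kappa gamma rho.
Proof.
have M0 := ltW (energy_const_gt0 b rho0); have b2 := sqr_ge0 b.
by rewrite mulr_ge0 ?expR_ge0// addr_ge0// ?divr_ge0// mulr_ge0.
Qed.

Let high_const_ge0 : 0 <= 4 * energy_const b rho / b ^+ 2.
Proof. by have M0 := ltW (energy_const_gt0 b rho0); rewrite divr_ge0 ?sqr_ge0// mulr_ge0. Qed.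

Lemma frequency_const_ge0 : 0 <= frequency_const.
Proof. exact: addr_ge0. Qed.

(* r enters only through r2 = r^2; the last term accounts for r >= 1. *)
Definition frequency_profile (t : R) J (r2 : R) : R :=
  \sum_(j < J.+1) t * 2 ^+ j * expR (- (frequency_rate * (t * 2 ^+ j * r2))) + expR (- (frequency_rate * t)).

Let oscillator_bound (r : R) w v G y (t : R) J : 0 <= r -> oscillator b kappa gamma r w v G ->
  G 0 ^+ 2 <= gamma * rho * r ^+ 2 * y ^+ 2 -> (r = 0 -> forall s : R, 0 < s -> G s = 0) ->
  1 <= t -> t <= 2 ^+ J.+1 ->
  w t ^+ 2 <= frequency_const * frequency_profile t J (r ^+ 2) * (w 0 ^+ 2 + v 0 ^+ 2 + y ^+ 2).
Proof.
move=> r0 osc hG G0 t1 tJ; have t0 : 0 <= t by lra.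
have S0 : 0 <= \sum_(j < J.+1) t * 2 ^+ j * expR (- (frequency_rate * (t * 2 ^+ j * r ^+ 2))).
  by apply: sumr_ge0 => j _; rewrite !mulr_ge0 ?exprn_ge0 ?expR_ge0.
have K0 : 0 <= w 0 ^+ 2 + v 0 ^+ 2 + y ^+ 2 by rewrite !addr_ge0 ?sqr_ge0.
case: (leP r 1) => r1.
  apply: le_trans (oscillator_dyadic b0 kappa0 gamma0 rho0 r0 osc hG t1 tJ r1 G0) _.
  by rewrite ler_wpM2r// ler_pM// /frequency_profile /frequency_const ?lerDl// expR_ge0.
apply: le_trans (oscillator_high b0 kappa0 gamma0 rho0 r0 osc hG (ltW r1) t0) _.
by rewrite ler_wpM2r// ler_pM ?expR_ge0// /frequency_profile /frequency_const lerDr.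
Qed.

Lemma fourier_ode_bound (xi : Rn R n) (uh0 uh1 : 'I_n -> R[i]) th0 uh th (k : 'I_n) (t : R) J :
  fourier_ode b kappa gamma1 gamma2 xi uh0 uh1 th0 uh th ->
  (forall i j, (tnth xi i)%:C%C * uh0 j = (tnth xi j)%:C%C * uh0 i) ->
  (forall i j, (tnth xi i)%:C%C * uh1 j = (tnth xi j)%:C%C * uh1 i) ->
  1 <= t -> t <= 2 ^+ J.+1 ->
  sqnormC (uh t k) <= frequency_const * frequency_profile t J (enorm xi ^+ 2) *
    (sqnormC (uh0 k) + sqnormC (uh1 k) + sqnormC th0).
Proof.
move=> [vh [init cth th0E equ eqth]] par0 par1 t1 tJ.
have oR := oscillator_Re init cth equ eqth par0 par1 k.
have oI := oscillator_Im init cth equ eqth par0 par1 k.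
have r0 : 0 <= enorm xi by exact: sqrtr_ge0.
have xk : `|tnth xi k| <= enorm xi by exact: normr_tnth_le_enorm.
have xk2 : tnth xi k ^+ 2 <= enorm xi ^+ 2 by rewrite -[leLHS]real_normK ?num_real// lerXn2r ?nnegrE.
have xk0 : enorm xi = 0 -> tnth xi k = 0.
  by move=> e; apply/eqP; rewrite -normr_le0 -e.
have gr (y : R) : (gamma1 * tnth xi k * y) ^+ 2 <= gamma * rho * enorm xi ^+ 2 * y ^+ 2.
  have -> : gamma * rho = gamma1 ^+ 2 by rewrite /rho mulrCA divff ?gt_eqF// mulr1.
  by rewrite !exprMn ler_wpM2r ?sqr_ge0// ler_wpM2l ?sqr_ge0.
have hR := oscillator_bound r0 oR (y := complex.Im (th 0)) _ _ t1 tJ.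
have hI := oscillator_bound r0 oI (y := complex.Re (th 0)) _ _ t1 tJ.
have [_ _ u0E u1E] := init k.
rewrite /sqnormC -u0E -u1E -th0E.
apply: le_trans (lerD (hR _ _) (hI _ _)) _.
- by rewrite sqrrN.
- by move=> /xk0 -> s _; rewrite mulr0 mul0r oppr0.
- exact: gr.
- by move=> /xk0 -> s _; rewrite mulr0 mul0r.
by rewrite -mulrDr le_eqVlt; apply/orP; left; apply/eqP; congr (_ * _); ring.
Qed.

End pointwise.

(** * Dyadic sums and the growth rate *)

Section growth.
Context {R : realType}.

Lemma growth3_sqr (t : R) : 0 <= t -> growth 3 t ^+ 2 = (Num.sqrt t)^-1.
Proof.
move=> t0; rewrite /growth -powR_mulrn ?powR_ge0// -powRrM.
have -> : - 4^-1 * 2%:R = - 2^-1 :> R by lra.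
by rewrite powRN powR12_sqrt.
Qed.

Lemma growth_ge0 n (t : R) : 0 <= growth n t.
Proof. by case: n => [|[|[|[|n]]]]//=; rewrite ?sqrtr_ge0// powR_ge0. Qed.

Lemma growth2_sqr (t : R) : 1 <= t -> growth 2 t ^+ 2 = ln t.
Proof. by move=> t1; rewrite /growth sqr_sqrtr// ln_ge0. Qed.

Lemma growth1_sqr (t : R) : 0 <= t -> growth 1 t ^+ 2 = t.
Proof. by move=> t0; rewrite /growth sqr_sqrtr. Qed.

Let q : R := Num.sqrt 2.
Let q2 : q ^+ 2 = 2. Proof. by rewrite sqr_sqrtr. Qed.
Let q_le : q <= 3/2.
Proof. by rewrite -(@ler_pXn2r _ 2) ?nnegrE ?sqrtr_ge0// q2; lra. Qed.
Let q_ge : 7/5 <= q.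
Proof. by rewrite -(@ler_pXn2r _ 2) ?nnegrE ?sqrtr_ge0// q2; lra. Qed.

Let geom_up m : \sum_(j < m) q ^+ j <= 4 * q ^+ m.
Proof.
elim: m => [|m IH]; first by rewrite big_ord0 expr0; lra.
rewrite big_ord_recr/= exprS; have : 0 <= q ^+ m by rewrite exprn_ge0// sqrtr_ge0.
by have := q_ge; nra.
Qed.

(** The subtracted multiple of the next power lets the induction close: it asks for 4 / q <= 3,
    which 7/5 <= q gives. *)
Let geom_down m : \sum_(j < m) q ^- j <= 5 - 4 * q ^- m.
Proof.
elim: m => [|m IH]; first by rewrite big_ord0 expr0; lra.
rewrite big_ord_recr/=; have h : 0 <= q ^- m.+1 by rewrite invr_ge0 exprn_ge0// sqrtr_ge0.
have e : q ^- m = q * q ^- m.+1 by rewrite exprS invfM mulrA divff ?mul1r// gt_eqF//; have := q_ge; lra.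
by rewrite e in IH *; have := q_ge; nra.
Qed.

Let sqrt_pow j : Num.sqrt (2 ^+ j) = q ^+ j.
Proof. by elim: j => [|j IH]; rewrite ?expr0 ?sqrtr1// !exprS sqrtrM// IH. Qed.

Let sqrt_dyadic (t : R) j : 0 <= t -> Num.sqrt (t * 2 ^+ j) = Num.sqrt t * q ^+ j.
Proof. by move=> t0; rewrite sqrtrM// sqrt_pow. Qed.

Lemma ln2_gt0 : 0 < ln (2 : R).
Proof. by rewrite ln_gt0// ltr1n. Qed.

Definition dyadic_growth_const : R := 20 + 2 / ln 2.

(** With s_j = t 2^j the terms are s_j^(1 - n/2). For n = 1 the last one dominates, about sqrt (t
    2^J) <= t; for n = 2 all are 1 and there are about ln t / ln 2 of them; for n = 3 the first one,
    t^(-1/2), dominates. *)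
Lemma dyadic_sum_growth n (t : R) J : (1 <= n <= 3)%N -> 2 <= t -> 2 ^+ J <= t ->
  \sum_(j < J.+1) t * 2 ^+ j * (Num.sqrt (t * 2 ^+ j))^-1 ^+ n <= dyadic_growth_const * growth n t ^+ 2.
Proof.
move=> n13 t2 Jt.
have t0 : 0 <= t by lra.
have l2 := ln2_gt0.
have il2 : 0 < 2 / ln (2 : R) by rewrite divr_gt0.
have st0 : 0 < Num.sqrt t by rewrite sqrtr_gt0; lra.
have st2 : t = Num.sqrt t ^+ 2 by rewrite sqr_sqrtr.
have sp j : 0 < t * 2 ^+ j by rewrite mulr_gt0// ?exprn_gt0//; lra.
have sq j : t * 2 ^+ j = Num.sqrt (t * 2 ^+ j) ^+ 2 by rewrite sqr_sqrtr// ltW.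
have sn0 j : Num.sqrt (t * 2 ^+ j) != 0 by rewrite gt_eqF// sqrtr_gt0.
case: n n13 => [|[|[|[|n]]]]// _.
- rewrite growth1_sqr//.
  under eq_bigr => j _ do rewrite expr1 {1}sq expr2 mulfK// sqrt_dyadic//.
  rewrite -mulr_sumr.
  have h : q ^+ J <= Num.sqrt t.
    by rewrite -sqrt_pow ler_sqrt.
  have := geom_up J.+1; rewrite exprS => h1.
  have h2 : \sum_(i < J.+1) q ^+ i <= 6 * Num.sqrt t.
    apply: le_trans h1 _; have : 0 <= q ^+ J by rewrite exprn_ge0// sqrtr_ge0.
    by have := q_le; nra.
  apply: le_trans (ler_wpM2l (ltW st0) h2) _.
  rewrite mulrCA -expr2 -st2 ler_wpM2r// /dyadic_growth_const; lra.
- rewrite growth2_sqr; last lra.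
  under eq_bigr => j _ do rewrite {1}sq -exprMn divff// expr1n.
  rewrite sumr_const card_ord.
  have lnt : ln 2 <= ln t by rewrite ler_ln ?posrE//; lra.
  have h : J%:R * ln 2 <= ln t.
    by rewrite mulr_natl -lnXn// ler_ln ?posrE ?exprn_gt0//; lra.
  rewrite /dyadic_growth_const mulrDl -[leLHS]add0r lerD//; first by rewrite mulr_ge0//; lra.
  rewrite mulrAC ler_pdivlMr// -addn1 natrD; lra.
- rewrite growth3_sqr//.
  under eq_bigr => j _ do rewrite {1}sq [_^-1 ^+ 3]exprSr mulrA -exprMn divff// expr1n mul1r sqrt_dyadic// invfM.
  rewrite -mulr_sumr mulrC ler_wpM2r ?invr_ge0 ?sqrtr_ge0//.
  apply: le_trans (geom_down _) _.
  have : 0 <= q ^- J.+1 by rewrite invr_ge0 exprn_ge0// sqrtr_ge0.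
  rewrite /dyadic_growth_const; lra.
Qed.

(** Serves the high frequencies, whose exponential factor is bounded by 1 / (c t). *)
Lemma growth_inv n (t : R) : (1 <= n <= 3)%N -> 2 <= t -> t^-1 <= dyadic_growth_const * growth n t ^+ 2.
Proof.
move=> n13 t2; have t0 : 0 < t by lra.
have l2 := ln2_gt0.
have il2 : 0 < 2 / ln (2 : R) by rewrite divr_gt0.
have it : t^-1 <= 1 by rewrite invf_le1//; lra.
have D20 : 20 <= dyadic_growth_const by rewrite /dyadic_growth_const; lra.
case: n n13 => [|[|[|[|n]]]]// _.
- by rewrite growth1_sqr//; [nra|lra].
- rewrite growth2_sqr; last lra.
  have lnt : ln 2 <= ln t by rewrite ler_ln ?posrE//; lra.
  apply: (le_trans it); apply: le_trans (_ : 2 / ln 2 * ln t <= _); last by rewrite ler_wpM2r// /dyadic_growth_const; lra.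
  by rewrite mulrAC ler_pdivlMr//; lra.
- rewrite growth3_sqr; last lra.
  have s0 : 0 < Num.sqrt t by rewrite sqrtr_gt0.
  have s1 : 1 <= Num.sqrt t by rewrite -[leLHS]sqrtr1 ler_sqrt; lra.
  have h : t^-1 <= (Num.sqrt t)^-1.
    by rewrite lef_pV2 ?posrE// -{2}[t]sqr_sqrtr ?(ltW t0)// expr2 ler_peMl// ltW.
  apply: (le_trans h); rewrite ler_peMl ?invr_ge0 ?(ltW s0)//; lra.
Qed.

End growth.

Section data.
Context {R : realType} (n : nat).
Local Notation leb := (lebesgue_Rn R n).

Lemma L12_integrable (f : Rn R n -> R) : L12 f -> leb.-integrable setT (EFin \o f).
Proof. by move=> [/Lfun1_integrable]. Qed.

Definition L1norm (f : Rn R n -> R) : R := \int[leb]_x `|f x|.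

Lemma L1norm_ge0 f : 0 <= L1norm f.
Proof. exact: Rintegral_ge0. Qed.

Lemma L12norm_EFin (f : Rn R n -> R) : L12 f -> exists a : R, [/\ 0 <= a,
  (\int[leb]_x (f x ^+ 2)%:E = (a ^+ 2)%:E)%E & L12norm f = (a + L1norm f)%:E].
Proof.
move=> h; have fi := L12_integrable h; have [_ f2] := h.
have fin : L2norm f \is a fin_num.
  rewrite ge0_fin_numE ?L2norm_ge0//; move: f2.
  by rewrite inE => /andP[_]; rewrite inE.
exists (fine (L2norm f)); split.
- exact/fine_ge0/L2norm_ge0.
- by rewrite -L2norm_sqr -powR_mulrn ?fine_ge0 ?L2norm_ge0// -poweR_EFin fineK.
- rewrite /L12norm EFinD fineK// Lnorm1 /L1norm EFin_Rintegral//.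
  exact: integrable_norm.
Qed.

Lemma fourier_parallel (w : 'I_n -> Rn R n -> R) xi : (forall k, leb.-integrable setT (EFin \o w k)) ->
  rotation_free w ->
  forall i j, (tnth xi i)%:C%C * fourier (w j) xi = (tnth xi j)%:C%C * fourier (w i) xi.
Proof.
move=> wi wrot i j; apply/eqP; rewrite eq_complex /= !mul0r subr0 subr0 !addr0 !mulrN.
have := rotation_free_cosT wi wrot xi i j; have := rotation_free_sinT wi wrot xi i j.
by rewrite /cosT /sinT => -> ->; rewrite !eqxx.
Qed.

End data.

(** * Integration of the pointwise upper bound *)

Section upper_bound.
Context {R : realType} (n : nat).
Local Notation leb := (lebesgue_Rn R n).
Variables (b kappa gamma1 gamma2 : R).
Hypotheses (b0 : 0 < b) (kappa0 : 0 < kappa) (gamma0 : 0 < gamma1 * gamma2).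
Variables (u0 u1 : 'I_n -> Rn R n -> R) (theta0 : Rn R n -> R).
Hypothesis data : admissible_data u0 u1 theta0.
Variables (u : R -> 'I_n -> Rn R n -> R) (theta : R -> Rn R n -> R).
Hypothesis sol : fourier_solution b kappa gamma1 gamma2 u0 u1 theta0 u theta.
Variable k : 'I_n.

Local Notation c := (frequency_rate b kappa gamma1 gamma2).
Local Notation C := (frequency_const b kappa gamma1 gamma2).
Local Notation profile := (frequency_profile b kappa gamma1 gamma2).
Let f0 := u0 k. Let f1 := u1 k.

Let i0 : leb.-integrable setT (EFin \o f0). Proof. exact: (L12_integrable (data_u0 data k)). Qed.
Let i1 : leb.-integrable setT (EFin \o f1). Proof. exact: (L12_integrable (data_u1 data k)). Qed.
Let i2 : leb.-integrable setT (EFin \o theta0). Proof. exact: (L12_integrable (data_theta0 data)). Qed.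

Let c0 : 0 < c. Proof. by rewrite /frequency_rate half_rate_gt0. Qed.
Let C0 : 0 <= C. Proof. exact: frequency_const_ge0. Qed.

Let P xi := power f0 xi + power f1 xi + power theta0 xi.
Let P0 xi : 0 <= P xi. Proof. exact: addr_ge0 (addr_ge0 (power_ge0 _ _) (power_ge0 _ _)) (power_ge0 _ _). Qed.

Let mP : measurable_fun setT P.
Proof.
by apply: measurable_funD; [apply: measurable_funD|]; apply: measurable_power; apply/measurable_EFinP;
   [exact: measurable_int i0|exact: measurable_int i1|exact: measurable_int i2].
Qed.

Let L : R := 2 * (L1norm f0 ^+ 2 + L1norm f1 ^+ 2 + L1norm theta0 ^+ 2).

Let PL xi : P xi <= L.
Proof. by rewrite /L !mulrDr !lerD ?power_le. Qed.

(** In front of the Gaussians the data are bounded by the constant [L], that is by L^1 norms. In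
    front of the exponential, which does not depend on xi, they stay under the integral, to be
    handled by Bessel's inequality. *)
Lemma fourier_integral_upper (t : R) J : 1 <= t -> t <= 2 ^+ J.+1 ->
  exists g : Rn R n -> R[i], is_fourier_L2 (u t k) g /\
  (\int[leb]_xi (sqnormC (g xi))%:E <=
  (\sum_(j < J.+1) C * L * (t * 2 ^+ j) * (gauss_mass / Num.sqrt (c * (t * 2 ^+ j))) ^+ n)%:E +
  (C * expR (- (c * t)))%:E * \int[leb]_xi (P xi)%:E)%E.
Proof.
move=> t1 tJ; have [uh [th [ode uhF _]]] := sol; have t0 : 0 <= t by lra.
have sp j : 0 < t * 2 ^+ j by rewrite mulr_gt0 ?exprn_gt0//; lra.
exists (uh t k); split; first exact: uhF.
pose F (j : nat) (xi : Rn R n) := C * L * (t * 2 ^+ j) * expR (- (c * (t * 2 ^+ j) * enorm xi ^+ 2)).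
pose H xi := C * expR (- (c * t)) * P xi.
have L0 : 0 <= L by exact: le_trans (P0 [tuple of nseq n 0]) (PL _).
have CL0 : 0 <= C * L by exact: mulr_ge0.
have F0 j xi : 0 <= F j xi by exact: mulr_ge0 (mulr_ge0 CL0 (ltW (sp j))) (expR_ge0 _).
have CE0 : 0 <= C * expR (- (c * t)) by exact: mulr_ge0 C0 (expR_ge0 _).
have mF j : measurable_fun setT (F j) by apply: measurable_funM => //; exact: measurable_gaussian.
have H0 xi : 0 <= H xi by exact: mulr_ge0.
have mH : measurable_fun setT H by apply: measurable_funM.
have le1 xi : sqnormC (uh t k xi) <= \sum_(j < J.+1) F j xi + H xi.
  have := fourier_ode_bound b0 kappa0 gamma0 k (ode xi)
    (fourier_parallel xi (fun k => L12_integrable (data_u0 data k)) (data_rot_u0 data))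
    (fourier_parallel xi (fun k => L12_integrable (data_u1 data k)) (data_rot_u1 data)) t1 tJ.
  rewrite !sqnormC_fourier => h; apply: (le_trans h).
  rewrite -/(P xi) /frequency_profile.
  have E (S e p : R) : C * (S + e) * p = S * (C * p) + C * e * p by ring.
  rewrite E lerD// mulr_suml; apply: ler_sum => j _.
  have -> : F j xi = t * 2 ^+ j * expR (- (c * (t * 2 ^+ j * enorm xi ^+ 2))) * (C * L).
    by rewrite /F -[c * _ * _]mulrA; ring.
  have s0 : 0 <= t * 2 ^+ j * expR (- (c * (t * 2 ^+ j * enorm xi ^+ 2))).
    exact: mulr_ge0 (ltW (sp j)) (expR_ge0 _).
  exact: ler_wpM2l s0 _ _ (ler_wpM2l C0 (PL xi)).
apply: le_trans (_ : (\int[leb]_xi ((\sum_(j < J.+1) (F j xi)%:E) + (H xi)%:E) <= _))%E.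
  apply: ge0_le_integral => //.
  - by move=> xi _; rewrite lee_fin sqnormC_ge0.
  - have [_ m1 m2 _] := uhF t k t0.
    by apply/measurable_EFinP; apply: measurable_funD; exact: measurable_funX.
  - apply: emeasurable_funD; last exact/measurable_EFinP.
    by apply: emeasurable_sum => j; exact/measurable_EFinP.
  - by move=> xi _; rewrite sumEFin -EFinD lee_fin.
rewrite ge0_integralD//; last 4 first.
- by move=> xi _; apply: sume_ge0 => j _; rewrite lee_fin.
- by apply: emeasurable_sum => j; exact/measurable_EFinP.
- by move=> xi _; rewrite lee_fin.
- exact/measurable_EFinP.
apply: leeD.
  rewrite ge0_integral_sum//; last 2 first.
  - by move=> j; exact/measurable_EFinP.
  - by move=> j xi _; rewrite lee_fin.
  rewrite -sumEFin; apply: lee_sum => j _.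
  under eq_integral do rewrite EFinM.
  rewrite ge0_integralZl//; last 2 first.
  - by apply/measurable_EFinP; exact: measurable_gaussian.
  - by rewrite lee_fin; exact: mulr_ge0 CL0 (ltW (sp j)).
  have cs : 0 < c * (t * 2 ^+ j) by exact: mulr_gt0.
  by rewrite integral_gaussian_Rn.
under eq_integral do rewrite EFinM.
rewrite ge0_integralZl//; first exact/measurable_EFinP.
by move=> xi _; rewrite lee_fin.
Qed.

(** 16 / (2 pi)^n comes from [fourier_L2_upper], the Gaussian part from the dyadic sum with its
    factor 2 from [L], and (2 pi)^n / c from Bessel's inequality with exp(-c t) <= 1 / (c t). *)
Definition upper_const : R := Num.sqrt (16 / (2 * pi) ^+ n *
  (dyadic_growth_const * (C * (2 * (gauss_mass / Num.sqrt c) ^+ n + (2 * pi) ^+ n / c)))).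

(** Both sides matter: 2^J <= t limits the number of scales, and t <= 2^(J+1) makes the last scale t
    2^J comparable to t^2. *)
Lemma dyadic_floor (t : R) : 1 <= t -> exists J, 2 ^+ J <= t <= 2 ^+ J.+1.
Proof.
move=> t1; exists (trunc_log 2 (Num.truncn t)).
have t0 : 0 <= t by lra.
have /andP[h1 h2] := truncn_itv t0.
have tr0 : (0 < Num.truncn t)%N by rewrite truncn_gt0.
have /andP[h3 h4] := trunc_log_bounds (ltnSn 1) tr0.
rewrite -!natrX; apply/andP; split; first by apply: le_trans h1; rewrite ler_nat.
by apply: le_trans (ltW h2) _; rewrite ler_nat.
Qed.

Lemma L2norm_solution_le (t : R) : (1 <= n <= 3)%N -> 2 <= t ->
  (L2norm (u t k) <= (upper_const * growth n t)%:E *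
           (L12norm f0 + L12norm f1 + L12norm theta0))%E.
Proof.
move=> n13 t2; have t1 : 1 <= t by lra.
have [J /andP[Jt tJ]] := dyadic_floor t1.
have [g [fg hg]] := fourier_integral_upper t1 tJ.
have [a0 [a00 e0 ->]] := L12norm_EFin (data_u0 data k).
have [a1 [a10 e1 ->]] := L12norm_EFin (data_u1 data k).
have [a2 [a20 e2 ->]] := L12norm_EFin (data_theta0 data).
set S := a0 + L1norm f0 + (a1 + L1norm f1) + (a2 + L1norm theta0).
rewrite -!EFinD -EFinM.
have [l0 l1 l2] := And3 (L1norm_ge0 f0) (L1norm_ge0 f1) (L1norm_ge0 theta0).
have S0 : 0 <= S by exact: addr_ge0 (addr_ge0 (addr_ge0 a00 l0) (addr_ge0 a10 l1)) (addr_ge0 a20 l2).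
have G0 := growth_ge0 n t.
have pin : 0 < (2 * pi : R) ^+ n by exact: twopiXn_gt0.
have K0 : 0 <= dyadic_growth_const :> R.
  by rewrite addr_ge0 ?divr_ge0// ltW// ln2_gt0.
have g0 : 0 <= (gauss_mass / Num.sqrt c) ^+ n by rewrite exprn_ge0// divr_ge0 ?sqrtr_ge0// gauss_mass_ge0.
have sq_add (x y z X Y Z : R) : 0 <= x -> 0 <= y -> 0 <= z -> 0 <= X -> 0 <= Y -> 0 <= Z ->
    x ^+ 2 + y ^+ 2 + z ^+ 2 <= (x + X + (y + Y) + (z + Z)) ^+ 2.
  move=> x0 y0 z0 X0 Y0 Z0; apply: le_trans (_ : (x + y + z) ^+ 2 <= _).
    have := mulr_ge0 x0 y0; have := mulr_ge0 x0 z0; have := mulr_ge0 y0 z0; lra.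
  by rewrite lerXn2r ?nnegrE ?addr_ge0//; lra.
have LS : L <= 2 * S ^+ 2.
  rewrite /L ler_wpM2l//; apply: le_trans (sq_add _ _ _ a0 a1 a2 l0 l1 l2 a00 a10 a20) _.
  by rewrite /S ![_ + a0]addrC ![_ + a1]addrC ![_ + a2]addrC.
have L0 : 0 <= L by exact: le_trans (P0 [tuple of nseq n 0]) (PL _).
have NS : a0 ^+ 2 + a1 ^+ 2 + a2 ^+ 2 <= S ^+ 2 by exact: sq_add.
have hP : (\int[leb]_xi (P xi)%:E <= ((2 * pi) ^+ n * (a0 ^+ 2 + a1 ^+ 2 + a2 ^+ 2))%:E)%E.
  have mp f : leb.-integrable setT (EFin \o f) -> measurable_fun setT (EFin \o power f).
    by move=> /measurable_int/measurable_EFinP/measurable_power mf; exact/measurable_EFinP.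
  have pw0 f xi : (0 <= (power f xi)%:E)%E by rewrite lee_fin power_ge0.
  have -> : (\int[leb]_xi (P xi)%:E = \int[leb]_xi (power f0 xi)%:E + \int[leb]_xi (power f1 xi)%:E +
      \int[leb]_xi (power theta0 xi)%:E)%E.
    rewrite -ge0_integralD//; [|by move=> xi _; exact: pw0|exact: (mp _ i0)|by move=> xi _; exact: pw0|exact: (mp _ i1)].
    rewrite -ge0_integralD//.
    - by move=> xi _; rewrite adde_ge0 ?pw0.
    - by apply: emeasurable_funD; [exact: (mp _ i0)|exact: (mp _ i1)].
    - by move=> xi _; exact: pw0.
    - exact: (mp _ i2).
  rewrite 2!mulrDr 2!EFinD.
  rewrite 3!(EFinM ((2 * pi) ^+ n)) -e0 -e1 -e2.
  by rewrite !leeD// bessel.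
have hsum : \sum_(j < J.+1) C * L * (t * 2 ^+ j) * (gauss_mass / Num.sqrt (c * (t * 2 ^+ j))) ^+ n <=
    C * L * (gauss_mass / Num.sqrt c) ^+ n * (dyadic_growth_const * growth n t ^+ 2).
  have := dyadic_sum_growth n13 t2 Jt.
  move=> /(ler_wpM2l (mulr_ge0 (mulr_ge0 C0 L0) g0)); apply: le_trans.
  rewrite mulr_sumr; apply: ler_sum => j _.
  by rewrite sqrtrM ?(ltW c0)// invfM !exprMn le_eqVlt; apply/orP; left; apply/eqP; ring.
have hexp : expR (- (c * t)) <= c^-1 * (dyadic_growth_const * growth n t ^+ 2).
  apply: le_trans (_ : c^-1 * t^-1 <= _); last first.
    by rewrite ler_wpM2l ?invr_ge0 ?(ltW c0)// growth_inv.
  have ct : 0 < c * t by rewrite mulr_gt0//; lra.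
  rewrite expRN -invfM lef_pV2 ?posrE ?expR_gt0//.
  by apply: le_trans (expR_ge1Dx _); rewrite lerDr.
have hint : (\int[leb]_xi (sqnormC (g xi))%:E <=
   (dyadic_growth_const * (C * (2 * (gauss_mass / Num.sqrt c) ^+ n + (2 * pi) ^+ n / c)) *
     growth n t ^+ 2 * S ^+ 2)%:E)%E.
  have CE0 : 0 <= C * expR (- (c * t)) by exact: mulr_ge0 C0 (expR_ge0 _).
  have cE : (0 <= (C * expR (- (c * t)))%:E)%E by rewrite lee_fin.
  apply: le_trans hg _; apply: le_trans (leeD (lexx _) (lee_wpmul2l cE hP)) _.
  rewrite -EFinM -EFinD lee_fin.
  have h1 : C * L * (gauss_mass / Num.sqrt c) ^+ n * (dyadic_growth_const * growth n t ^+ 2) <=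
     C * (2 * S ^+ 2) * (gauss_mass / Num.sqrt c) ^+ n * (dyadic_growth_const * growth n t ^+ 2).
    by rewrite ler_wpM2r ?mulr_ge0 ?sqr_ge0// ler_wpM2r// ler_wpM2l.
  have h2 : C * expR (- (c * t)) * ((2 * pi) ^+ n * (a0 ^+ 2 + a1 ^+ 2 + a2 ^+ 2)) <=
     C * (c^-1 * (dyadic_growth_const * growth n t ^+ 2)) * ((2 * pi) ^+ n * S ^+ 2).
    apply: ler_pM => //.
    - by rewrite mulr_ge0 ?(ltW pin)// !addr_ge0 ?sqr_ge0.
    - by rewrite ler_wpM2l.
    - by rewrite ler_wpM2l// ltW.
  apply: le_trans (lerD (le_trans hsum h1) h2) _.
  by rewrite le_eqVlt; apply/orP; left; apply/eqP; ring.
have [uL2 _ _ _] := fg.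
have up := fourier_L2_upper uL2 fg.
have D0 : 0 <= 16 / (2 * pi) ^+ n *
  (dyadic_growth_const * (C * (2 * (gauss_mass / Num.sqrt c) ^+ n + (2 * pi) ^+ n / c))).
  by rewrite !mulr_ge0 ?invr_ge0 ?(ltW pin)// addr_ge0 ?mulr_ge0 ?invr_ge0 ?(ltW pin) ?(ltW c0).
apply: L2norm_le; first by rewrite !mulr_ge0 ?sqrtr_ge0.
rewrite 2!exprMn sqr_sqrtr//.
have -> : 16 / (2 * pi) ^+ n *
  (dyadic_growth_const * (C * (2 * (gauss_mass / Num.sqrt c) ^+ n + (2 * pi) ^+ n / c))) * growth n t ^+ 2 * S ^+ 2 =
  ((2 * pi) ^+ n)^-1 * (16 * (dyadic_growth_const * (C * (2 * (gauss_mass / Num.sqrt c) ^+ n + (2 * pi) ^+ n / c)) * growth n t ^+ 2 * S ^+ 2)).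
  by ring.
rewrite (EFinM ((2 * pi) ^- n)) -lee_pdivrMl ?invr_gt0// invrK (EFinM 16); apply: le_trans up _.
by rewrite lee_wpmul2l.
Qed.

End upper_bound.

(** * Lower bound *)

Section small_time_lower.
Context {R : realType}.
Variables (b kappa gamma gamma' M : R).
Hypotheses (b0 : 0 < b) (kappa0 : 0 < kappa) (gamma0 : 0 < gamma) (gamma'0 : 0 < gamma') (M0 : 0 <= M).

Definition wave_speed : R := Num.sqrt (b ^+ 2 + gamma).
Local Notation beta := wave_speed.

Lemma wave_speed_gt0 : 0 < beta.
Proof. by rewrite sqrtr_gt0 ltr_wpDl ?sqr_ge0. Qed.

Lemma wave_speed_sqr : beta ^+ 2 = b ^+ 2 + gamma.
Proof. by rewrite sqr_sqrtr// addr_ge0 ?sqr_ge0// ltW. Qed.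

(** [drift_const] is the dissipative error of [oscillator_small_time] with |G| <= 2 r A sqrt (gamma
    M). [error_const] adds the effects of errors in v(0), in G(0), and of w(0), which contributes
    two terms. In [main_const], 1 / (2 beta) reflects sin >= 1/2, and gamma' / (4 beta^2) reflects
    xi_k >= |xi| / 4 with 1 - cos >= 1. *)
Definition drift_const : R := 6 * kappa * Num.sqrt (gamma * M) / beta ^+ 2.
Definition error_const : R := beta^-1 + 2 * gamma' / beta ^+ 2 + 2 * gamma / beta ^+ 2 + 1.
Definition main_const : R := Num.min (2 * beta)^-1 (gamma' / (4 * beta ^+ 2)).

Lemma main_const_gt0 : 0 < main_const.
Proof.
have B := wave_speed_gt0.
by rewrite /main_const lt_min invr_gt0 divr_gt0 ?mulr_gt0 ?exprn_gt0.
Qed.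

Lemma error_const_gt0 : 0 < error_const.
Proof.
have B := wave_speed_gt0; have B2 := exprn_gt0 2 B.
by rewrite /error_const !addr_gt0 ?invr_gt0 ?divr_gt0 ?mulr_gt0.
Qed.

Lemma drift_const_ge0 : 0 <= drift_const.
Proof.
have B2 := exprn_gt0 2 wave_speed_gt0.
by rewrite divr_ge0 ?(ltW B2)// !mulr_ge0 ?sqrtr_ge0// ltW.
Qed.

Variables (r : R) (w v G : R -> R) (t A eps eta m : R).
Hypotheses (r0 : 0 < r) (t0 : 0 <= t) (osc : oscillator b kappa gamma r w v G).
Hypotheses (A0 : 0 <= A) (eps0 : 0 <= eps) (rt : r ^+ 2 * t <= eta).
Hypothesis E0 : energy b gamma r (w 0) (v 0) (G 0) <= M * A ^+ 2.
Hypothesis w0 : r * `|w 0| <= eps * A.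

Let drift : r * `|w t - ((- (G 0 - gamma * r ^+ 2 * w 0) / (beta ^+ 2 * r ^+ 2)) * (1 - cos (beta * r * t))
     + v 0 * sin (beta * r * t) / (beta * r) + w 0 * cos (beta * r * t))| <= drift_const * eta * A.
Proof.
have B := wave_speed_gt0; have B2 := exprn_gt0 2 B.
have MA0 : 0 <= M * A ^+ 2 by rewrite mulr_ge0 ?sqr_ge0.
(* G^2 is at most gamma r^2 times the energy, and the energy never exceeds 4 M A^2. *)
pose Bd := 2 * Num.sqrt (gamma * (M * A ^+ 2)).
have hB (s : R) : 0 < s -> `|G s| <= r * Bd.
  move=> s0; rewrite -(@ler_pXn2r _ 2) ?nnegrE ?mulr_ge0 ?sqrtr_ge0 ?(ltW r0)//.
  rewrite real_normK ?num_real// /Bd 2!exprMn sqr_sqrtr ?(mulr_ge0 (ltW gamma0))//.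
  apply: le_trans (energy_ge_G b gamma0 (w s) (v s) (G s) r0) _.
  have h := le_trans (energy_le4 b0 kappa0 gamma0 r0 (ltW s0) osc) (ler_wpM2l (ler0n R 4) E0).
  have h2 : 0 <= gamma * r ^+ 2 by rewrite mulr_ge0 ?sqr_ge0// ltW.
  apply: le_trans (ler_wpM2l h2 h) _.
  by rewrite le_eqVlt; apply/orP; left; apply/eqP; ring.
have h := oscillator_small_time kappa0 r0 t0 osc B wave_speed_sqr hB.
apply: le_trans (ler_wpM2l (ltW r0) h) _.
have -> : Bd = 2 * (Num.sqrt (gamma * M) * A).
  by rewrite /Bd mulrA sqrtrM ?sqrtr_sqr ?ger0_norm ?mulr_ge0// ltW.
have -> : r * (3 * kappa * (2 * (Num.sqrt (gamma * M) * A)) / beta ^+ 2 * (r ^+ 2 * t) / r) =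
   drift_const * (r ^+ 2 * t) * A.
  by rewrite /drift_const; field; rewrite !gt_eqF.
by rewrite ler_wpM2r// ler_wpM2l// drift_const_ge0.
Qed.

Let main_scaled : r * ((- (G 0 - gamma * r ^+ 2 * w 0) / (beta ^+ 2 * r ^+ 2)) * (1 - cos (beta * r * t))
     + v 0 * sin (beta * r * t) / (beta * r) + w 0 * cos (beta * r * t)) =
  - (G 0 / r / beta ^+ 2 * (1 - cos (beta * r * t))) + gamma * (r * w 0) / beta ^+ 2 * (1 - cos (beta * r * t))
  + v 0 * sin (beta * r * t) / beta + r * w 0 * cos (beta * r * t).
Proof. by have B := wave_speed_gt0; field; rewrite !gt_eqF. Qed.

Let rwE : r * `|w t| = `|r * w t|. Proof. by rewrite normrM gtr0_norm. Qed.

Let scaled_drift : `|r * w t - (- (G 0 / r / beta ^+ 2 * (1 - cos (beta * r * t))) +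
  gamma * (r * w 0) / beta ^+ 2 * (1 - cos (beta * r * t))
  + v 0 * sin (beta * r * t) / beta + r * w 0 * cos (beta * r * t))| <= drift_const * eta * A.
Proof. by rewrite -main_scaled -mulrBr normrM gtr0_norm. Qed.

Let cosB : 0 <= 1 - cos (beta * r * t) <= 2.
Proof. by have := cos_le1 (beta * r * t); have := cos_geN1 (beta * r * t); lra. Qed.

Let sinB : `|sin (beta * r * t)| <= 1.
Proof. by rewrite ler_norml sin_geN1 sin_le1. Qed.

Let w_error : `|gamma * (r * w 0) / beta ^+ 2 * (1 - cos (beta * r * t)) + r * w 0 * cos (beta * r * t)| <=
  (2 * gamma / beta ^+ 2 + 1) * eps * A.
Proof.
have B2 := exprn_gt0 2 wave_speed_gt0.
have hw : `|r * w 0| <= eps * A by rewrite normrM gtr0_norm.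
have /andP[c0 c2] := cosB.
have cc : `|cos (beta * r * t)| <= 1 by rewrite ler_norml cos_geN1 cos_le1.
rewrite [leRHS](_ : _ = 2 * gamma / beta ^+ 2 * (eps * A) + eps * A); last by ring.
apply: le_trans (ler_normD _ _) _; rewrite lerD//; last first.
  by rewrite normrM -[leRHS]mulr1 ler_pM.
have -> : gamma * (r * w 0) / beta ^+ 2 * (1 - cos (beta * r * t)) =
  gamma / beta ^+ 2 * ((1 - cos (beta * r * t)) * (r * w 0)) by ring.
rewrite normrM ger0_norm ?divr_ge0 ?(ltW B2) ?(ltW gamma0)//.
have -> : 2 * gamma / beta ^+ 2 * (eps * A) = gamma / beta ^+ 2 * (2 * (eps * A)) by ring.
rewrite ler_wpM2l ?divr_ge0 ?(ltW B2) ?(ltW gamma0)//.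
by rewrite normrM ger0_norm// ler_pM.
Qed.

Let epsA : 0 <= eps * A. Proof. exact: mulr_ge0. Qed.

(** Meant for the real part of w: v(0) is close to the moment of u1, while G(0) comes from the
    imaginary part of theta^, small near xi = 0. All terms but the velocity one are errors. *)
Lemma velocity_lower : `|v 0 - m| <= eps * A -> `|G 0| <= gamma' * r * (eps * A) ->
  2^-1 <= sin (beta * r * t) ->
  main_const * `|m| - error_const * eps * A - drift_const * eta * A <= r * `|w t|.
Proof.
move=> hv hG hs.
have B := wave_speed_gt0; have B2 := exprn_gt0 2 B; have /andP[c0 c2] := cosB.
have h1 : `|G 0 / r / beta ^+ 2 * (1 - cos (beta * r * t))| <= 2 * gamma' / beta ^+ 2 * eps * A.
  have -> : 2 * gamma' / beta ^+ 2 * eps * A = (gamma' * r * (eps * A)) / r / beta ^+ 2 * 2.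
    by field; rewrite !gt_eqF.
  rewrite !normrM !normfV (gtr0_norm r0) (gtr0_norm B2) (ger0_norm c0).
  by rewrite ler_pM ?mulr_ge0 ?invr_ge0 ?(ltW r0) ?(ltW B2)// !ler_wpM2r ?invr_ge0 ?(ltW r0) ?(ltW B2).
have h2 : (2 * beta)^-1 * `|m| - beta^-1 * eps * A <= `|v 0 * sin (beta * r * t) / beta|.
  rewrite normrM normfV (gtr0_norm B) ler_pdivlMr// normrM (ger0_norm (_ : 0 <= sin _)); last lra.
  have -> : ((2 * beta)^-1 * `|m| - beta^-1 * eps * A) * beta = `|m| / 2 - eps * A.
    by field; rewrite gt_eqF.
  have h : `|m| <= `|v 0| + eps * A.
    have := ler_normB (v 0) (v 0 - m); rewrite opprB addrC subrK => h.
    exact: le_trans h (lerD (lexx _) hv).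
  have : `|v 0| * 2^-1 <= `|v 0| * sin (beta * r * t) by rewrite ler_wpM2l.
  have := epsA; lra.
have h3 : main_const * `|m| <= (2 * beta)^-1 * `|m|.
  by rewrite ler_wpM2r// ge_min lexx.
have := scaled_drift; have := w_error; rewrite rwE /error_const.
move: h1 h2; set X1 := _ * (1 - _); set X2 := _ * (1 - _); set X3 := v 0 * _ / _; set X4 := r * w 0 * _.
set W := r * w t; move=> h1 h2 h4 h5.
have : `|X3| <= `|W - (- X1 + X2 + X3 + X4)| + `|X1| + `|X2 + X4| + `|W|.
  have -> : X3 = - (W - (- X1 + X2 + X3 + X4)) + X1 - (X2 + X4) + W by ring.
  apply: le_trans (ler_normD _ _) _; rewrite lerD2r; apply: le_trans (ler_normB _ _) _.
  rewrite lerD2r; apply: le_trans (ler_normD _ _) _; rewrite normrN.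
  by rewrite (_ : W - _ = W - (- X1 + X2 + X3 + X4))//; ring.
lra.
Qed.

(** Meant for the imaginary part of w, where the roles are exchanged: v(0) is small and G(0) carries
    the moment of theta0. The factor 1/4 is that of the cone, xi_k >= |xi| / 4. *)
Lemma temperature_lower : `|v 0| <= eps * A -> gamma' * r * ((`|m| - eps * A) / 4) <= `|G 0| ->
  cos (beta * r * t) <= 0 ->
  main_const * `|m| - error_const * eps * A - drift_const * eta * A <= r * `|w t|.
Proof.
move=> hv hG hc.
have B := wave_speed_gt0; have B2 := exprn_gt0 2 B; have /andP[c0 c2] := cosB.
have h1 : gamma' / (4 * beta ^+ 2) * `|m| - gamma' / beta ^+ 2 * eps * A
    <= `|G 0 / r / beta ^+ 2 * (1 - cos (beta * r * t))|.
  rewrite !normrM !normfV (gtr0_norm r0) (gtr0_norm B2) (ger0_norm c0).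
  apply: le_trans (_ : `|G 0| / r / beta ^+ 2 * 1 <= _); last first.
    rewrite ler_wpM2l ?mulr_ge0 ?invr_ge0 ?(ltW r0) ?(ltW B2)//; lra.
  rewrite mulr1 ler_pdivlMr// ler_pdivlMr//; apply: le_trans hG.
  have -> : (gamma' / (4 * beta ^+ 2) * `|m| - gamma' / beta ^+ 2 * eps * A) * beta ^+ 2 * r =
     gamma' * r * ((`|m| - eps * A) / 4) - gamma' * r * (eps * A) * (3 / 4).
    by field; rewrite gt_eqF.
  have : 0 <= gamma' * r * (eps * A) by rewrite !mulr_ge0 ?(ltW r0) ?(ltW gamma'0).
  lra.
have h2 : `|v 0 * sin (beta * r * t) / beta| <= beta^-1 * eps * A.
  rewrite normrM normfV (gtr0_norm B) ler_pdivrMr// normrM.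
  have -> : beta^-1 * eps * A * beta = eps * A * 1 by field; rewrite gt_eqF.
  by rewrite ler_pM.
have h3 : main_const * `|m| <= gamma' / (4 * beta ^+ 2) * `|m|.
  by rewrite ler_wpM2r// ge_min lexx orbT.
have h4 : 0 <= gamma' / beta ^+ 2 * eps * A.
  by rewrite -mulrA mulr_ge0// divr_ge0 ?(ltW B2) ?(ltW gamma'0).
have := scaled_drift; have := w_error; rewrite rwE /error_const.
move: h1 h2; set X1 := _ * (1 - _); set X2 := _ * (1 - _); set X3 := v 0 * _ / _; set X4 := r * w 0 * _.
set W := r * w t; move=> h1 h2 h5 h6.
have : `|X1| <= `|W - (- X1 + X2 + X3 + X4)| + `|X3| + `|X2 + X4| + `|W|.
  have -> : X1 = (W - (- X1 + X2 + X3 + X4)) + X3 + (X2 + X4) - W by ring.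
  apply: le_trans (ler_normB _ _) _; rewrite lerD2r; apply: le_trans (ler_normD _ _) _.
  rewrite lerD2r; apply: le_trans (ler_normD _ _) _; rewrite lerD2r.
  by rewrite (_ : W - _ = W - (- X1 + X2 + X3 + X4))//; ring.
have e1 : 2 * gamma' / beta ^+ 2 * eps * A = 2 * (gamma' / beta ^+ 2 * eps * A) by ring.
lra.
Qed.

End small_time_lower.

(** * Pointwise lower bound of the transformed solution *)

Section fourier_lower.
Context {R : realType} (n : nat).
Variables (b kappa gamma1 gamma2 : R).
Hypotheses (b0 : 0 < b) (kappa0 : 0 < kappa) (gamma0 : 0 < gamma1 * gamma2).
Local Notation gamma := (gamma1 * gamma2).
Local Notation beta := (wave_speed b gamma).
Local Notation gamma' := (`|gamma1|).

(** One summand for each part of the initial energy in units of A^2: v^2 <= (2 A)^2, b^2 (r w)^2 <=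
    b^2 A^2, and G^2 / (gamma r^2) <= gamma1^2 / gamma (2 A)^2. *)
Let M : R := 4 + b ^+ 2 + 4 * (gamma1 ^+ 2 / gamma).
Let M0 : 0 <= M.
Proof. by rewrite !addr_ge0 ?sqr_ge0// mulr_ge0// divr_ge0 ?sqr_ge0// ltW. Qed.

Let gamma'0 : 0 < gamma'.
Proof. by rewrite normr_gt0; apply: contraTneq gamma0 => ->; rewrite mul0r ltxx. Qed.

(** The larger moment is at least A / 2, and [lower_eps] and [lower_eta] each allow an error of an
    eighth of the main constant: 1/2 - 1/8 - 1/8 = 1/4. The minimum with 1 keeps the data of size A;
    the 1 added to [drift_const] keeps the denominator positive. *)
Definition lower_amplitude : R := main_const b gamma gamma' / 4.
Definition lower_eps : R := Num.min 1 (main_const b gamma gamma' / (8 * error_const b gamma gamma')).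
Definition lower_eta : R := main_const b gamma gamma' / (8 * (drift_const b kappa gamma M + 1)).

Lemma lower_amplitude_gt0 : 0 < lower_amplitude.
Proof. by rewrite divr_gt0// main_const_gt0. Qed.

Lemma lower_eps_gt0 : 0 < lower_eps.
Proof. by rewrite lt_min ltr01 divr_gt0 ?main_const_gt0// mulr_gt0// error_const_gt0. Qed.

Lemma lower_eta_gt0 : 0 < lower_eta.
Proof. by rewrite divr_gt0 ?main_const_gt0// mulr_gt0// ltr_wpDl// drift_const_ge0. Qed.

Let eps_le : error_const b gamma gamma' * lower_eps <= main_const b gamma gamma' / 8.
Proof.
have K0 := error_const_gt0 b gamma0 gamma'0.
apply: le_trans (_ : error_const b gamma gamma' * (main_const b gamma gamma' / (8 * error_const b gamma gamma')) <= _).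
  by rewrite ler_wpM2l ?(ltW K0)// ge_min lexx orbT.
by rewrite le_eqVlt; apply/orP; left; apply/eqP; field; rewrite gt_eqF.
Qed.

Let eta_le : drift_const b kappa gamma M * lower_eta <= main_const b gamma gamma' / 8.
Proof.
have D0 := drift_const_ge0 b M kappa0 gamma0; have C0 := main_const_gt0 b gamma0 gamma'0.
have D1 : 0 < drift_const b kappa gamma M + 1 by lra.
rewrite /lower_eta mulrA ler_pdivrMr ?mulr_gt0//; nra.
Qed.

Let eps1 : lower_eps <= 1. Proof. by rewrite ge_min lexx. Qed.

Let amplitude (A m X : R) : 0 <= A -> A / 2 <= `|m| ->
  main_const b gamma gamma' * `|m| - error_const b gamma gamma' * lower_eps * A -
    drift_const b kappa gamma M * lower_eta * A <= X -> lower_amplitude * A <= X.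
Proof.
move=> A0 Am; apply: le_trans.
have C0 := main_const_gt0 b gamma0 gamma'0.
have h1 := ler_wpM2r A0 eps_le; have h2 := ler_wpM2r A0 eta_le.
have h3 := ler_wpM2l (ltW C0) Am; rewrite /lower_amplitude; lra.
Qed.

(** Since A <= |m1| + |m2|, one of the moments is at least A / 2 in absolute value. If it is m1, the
    real part of the solution is large, otherwise the imaginary part. *)
Lemma fourier_ode_lower (xi : Rn R n) (uh0 uh1 : 'I_n -> R[i]) th0 uh th (k : 'I_n) (t m1 m2 A : R) :
  fourier_ode b kappa gamma1 gamma2 xi uh0 uh1 th0 uh th ->
  (forall i j, (tnth xi i)%:C%C * uh0 j = (tnth xi j)%:C%C * uh0 i) ->
  (forall i j, (tnth xi i)%:C%C * uh1 j = (tnth xi j)%:C%C * uh1 i) ->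
  0 <= A -> A ^+ 2 = m1 ^+ 2 + m2 ^+ 2 ->
  `|complex.Re (uh1 k) - m1| <= lower_eps * A -> `|complex.Im (uh1 k)| <= lower_eps * A ->
  `|complex.Re th0 - m2| <= lower_eps * A -> `|complex.Im th0| <= lower_eps * A ->
  enorm xi * `|complex.Re (uh0 k)| <= lower_eps * A -> enorm xi * `|complex.Im (uh0 k)| <= lower_eps * A ->
  0 < enorm xi -> enorm xi <= 4 * tnth xi k -> 0 <= t -> enorm xi ^+ 2 * t <= lower_eta ->
  2^-1 <= sin (beta * enorm xi * t) -> cos (beta * enorm xi * t) <= 0 ->
  (lower_amplitude * A) ^+ 2 <= enorm xi ^+ 2 * sqnormC (uh t k).
Proof.
move=> [vh [init cth th0E equ eqth]] par0 par1 A0 AE hR1 hI1 hRt hIt hR0 hI0 r0 rk t0 rt hs hc.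
have oR := oscillator_Re init cth equ eqth par0 par1 k.
have oI := oscillator_Im init cth equ eqth par0 par1 k.
have [_ _ u0E u1E] := init k.
rewrite -u0E -u1E -th0E in hR1 hI1 hRt hIt hR0 hI0.
have xk0 : 0 <= tnth xi k by lra.
have xk : tnth xi k <= enorm xi.
  by apply: le_trans (normr_tnth_le_enorm xi k); exact: ler_norm.
have e0 := ltW lower_eps_gt0.
have epsA : lower_eps * A <= A by rewrite ler_piMl.
have A2 (x : R) : `|x| <= A -> x ^+ 2 <= A ^+ 2.
  by move=> h; rewrite -[leLHS]real_normK ?num_real// lerXn2r ?nnegrE.
have m1A : `|m1| <= A by rewrite -(@ler_pXn2r _ 2) ?nnegrE// AE real_normK ?num_real// lerDl sqr_ge0.
have m2A : `|m2| <= A by rewrite -(@ler_pXn2r _ 2) ?nnegrE// AE real_normK ?num_real// lerDr sqr_ge0.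
have near2 (x m : R) : `|x - m| <= lower_eps * A -> `|m| <= A -> x ^+ 2 <= 4 * A ^+ 2.
  move=> h h'; have : `|x| <= 2 * A.
    by rewrite -[x](subrK m); apply: le_trans (ler_normD _ _) _; lra.
  move=> h2; rewrite -[leLHS]real_normK ?num_real// (_ : 4 * A ^+ 2 = (2 * A) ^+ 2); last by ring.
  by rewrite lerXn2r ?nnegrE// mulr_ge0.
have thermal (x : R) : x ^+ 2 <= 4 * A ^+ 2 ->
    (gamma1 * tnth xi k * x) ^+ 2 / (gamma * enorm xi ^+ 2) <= 4 * (gamma1 ^+ 2 / gamma) * A ^+ 2.
  move=> h; have gr : 0 < gamma * enorm xi ^+ 2 by rewrite (mulr_gt0 gamma0)// exprn_gt0.
  rewrite ler_pdivrMr//.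
  have -> : 4 * (gamma1 ^+ 2 / gamma) * A ^+ 2 * (gamma * enorm xi ^+ 2) = gamma1 ^+ 2 * enorm xi ^+ 2 * (4 * A ^+ 2).
    rewrite [LHS](_ : _ = gamma1 ^+ 2 * enorm xi ^+ 2 * (4 * A ^+ 2) * (gamma / gamma)); last by ring.
    by rewrite divff ?mulr1// gt_eqF.
  rewrite !exprMn; apply: ler_pM => //; rewrite ?sqr_ge0//; first by rewrite mulr_ge0 ?sqr_ge0.
  by rewrite ler_wpM2l ?sqr_ge0// lerXn2r ?nnegrE// ltW.
have wave (x : R) : enorm xi * `|x| <= lower_eps * A -> b ^+ 2 * enorm xi ^+ 2 * x ^+ 2 <= b ^+ 2 * A ^+ 2.
  move=> h; rewrite -mulrA ler_wpM2l ?sqr_ge0// -exprMn A2// normrM (gtr0_norm r0).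
  exact: le_trans h epsA.
have A4 : A ^+ 2 <= 4 * A ^+ 2 by have := sqr_ge0 A; lra.
have ER : energy b gamma (enorm xi) (complex.Re (uh 0 k)) (complex.Re (vh 0 k))
    (- (gamma1 * tnth xi k * complex.Im (th 0))) <= M * A ^+ 2.
  rewrite /energy sqrrN /M 2!mulrDl; apply: lerD; last first.
    by apply: thermal; apply: le_trans A4; apply: A2; exact: le_trans epsA.
  by apply: lerD; [exact: near2 m1A|exact: wave].
have EI : energy b gamma (enorm xi) (complex.Im (uh 0 k)) (complex.Im (vh 0 k))
    (gamma1 * tnth xi k * complex.Re (th 0)) <= M * A ^+ 2.
  rewrite /energy /M 2!mulrDl; apply: lerD; last first.
    by apply: thermal; exact: near2 m2A.
  apply: lerD; last exact: wave.
  by apply: le_trans A4; apply: A2; exact: le_trans epsA.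
have GR : `|- (gamma1 * tnth xi k * complex.Im (th 0))| <= gamma' * enorm xi * (lower_eps * A).
  rewrite normrN !normrM (ger0_norm xk0) ler_pM// ?mulr_ge0//.
  by rewrite ler_wpM2l.
have GI : gamma' * enorm xi * ((`|m2| - lower_eps * A) / 4) <= `|gamma1 * tnth xi k * complex.Re (th 0)|.
  rewrite !normrM (ger0_norm xk0).
  have h : `|m2| - lower_eps * A <= `|complex.Re (th 0)|.
    have := ler_normB (complex.Re (th 0)) (complex.Re (th 0) - m2); rewrite opprB addrC subrK => h.
    by rewrite lerBlDr; exact: le_trans h (lerD (lexx _) hRt).
  apply: le_trans (_ : gamma' * enorm xi * (`|complex.Re (th 0)| / 4) <= _).
    by rewrite ler_wpM2l ?mulr_ge0 ?(ltW r0)// ler_wpM2r.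
  have -> : gamma' * enorm xi * (`|complex.Re (th 0)| / 4) = gamma' * (enorm xi / 4) * `|complex.Re (th 0)| by ring.
  by rewrite ler_wpM2r// ler_wpM2l//; lra.
have hR := velocity_lower b0 kappa0 gamma0 M0 r0 t0 oR A0 e0 rt ER hR0 hR1 GR hs.
have hI := temperature_lower b0 kappa0 gamma0 gamma'0 M0 r0 t0 oI A0 e0 rt EI hI0 hI1 GI hc.
have amp0 : 0 <= lower_amplitude * A by rewrite mulr_ge0// ltW// lower_amplitude_gt0.
have sq_le (x : R) : lower_amplitude * A <= enorm xi * `|x| -> (lower_amplitude * A) ^+ 2 <= enorm xi ^+ 2 * x ^+ 2.
  move=> h; rewrite -[x ^+ 2]real_normK ?num_real// -exprMn lerXn2r ?nnegrE//.
  by rewrite mulr_ge0// ltW.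
rewrite /sqnormC mulrDr.
have [h|h] := leP (A / 2) `|m1|.
  apply: le_trans (sq_le _ (amplitude A0 h hR)) _.
  by rewrite lerDl mulr_ge0 ?sqr_ge0.
have h' : A / 2 <= `|m2|.
  have : A ^+ 2 <= (`|m1| + `|m2|) ^+ 2.
    rewrite AE -[m1 ^+ 2]real_normK ?num_real// -[m2 ^+ 2]real_normK ?num_real//.
    by have := mulr_ge0 (normr_ge0 m1) (normr_ge0 m2); lra.
  by rewrite ler_pXn2r ?nnegrE ?addr_ge0//; lra.
apply: le_trans (sq_le _ (amplitude A0 h' hI)) _.
by rewrite lerDr mulr_ge0 ?sqr_ge0.
Qed.

End fourier_lower.

(** * Volumes of balls and shells in a cone, by scaling *)

Section cone.
Context {R : realType}.
Local Notation mu := (@lebesgue_measure R).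
Local Notation leb n := (lebesgue_Rn R n).

Definition scale_Rn n (l : R) (x : Rn R n) : Rn R n := [tuple l * tnth x i | i < n].

Lemma tnth_scale n l (x : Rn R n) i : tnth (scale_Rn l x) i = l * tnth x i.
Proof. by rewrite tnth_mktuple. Qed.

Lemma scale_cons n l x (y : Rn R n) : scale_Rn l (cons_Rn (x, y)) = cons_Rn (l * x, scale_Rn l y).
Proof.
apply: eq_from_tnth => i; rewrite tnth_scale.
by case: (unliftP ord0 i) => [j ->|->]; rewrite ?tnthS ?tnth_scale.
Qed.

Lemma enorm_scale n l (x : Rn R n) : 0 <= l -> enorm (scale_Rn l x) = l * enorm x.
Proof.
move=> l0; rewrite /enorm /dotp.
under eq_bigr do rewrite tnth_scale -expr2 exprMn.
rewrite -mulr_sumr sqrtrM ?sqr_ge0// sqrtr_sqr ger0_norm//.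
Qed.

Lemma measurable_scale n l : measurable_fun setT (@scale_Rn n l).
Proof.
apply/measurable_fun_tnthP => i.
rewrite (_ : _ \o _ = fun x => l * tnth x i); last by apply/funext => x; rewrite /= tnth_scale.
by apply: measurable_funM => //; exact: measurable_tnth.
Qed.

Lemma integral_scale n (l : R) (F : Rn R n -> \bar R) : 0 < l -> measurable_fun setT F ->
  (forall x, 0 <= F x)%E ->
  (\int[leb n]_x F (scale_Rn l x) = (l ^- n)%:E * \int[leb n]_x F x)%E.
Proof.
move=> l0; elim: n F => [|n IH] F mF F0.
  rewrite !integral_Rn0//; last by apply: measurableT_comp => //; exact: measurable_scale.
  by rewrite expr0 invr1 mul1e (tuple0 (scale_Rn _ _)).
have mFc x : measurable_fun setT (fun y : Rn R n => F (cons_Rn (x, y))).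
  apply: measurableT_comp => //.
  by apply: (measurableT_comp (@measurable_cons_Rn R n)); exact: pair1_measurable.
rewrite ge0_integral_RnS//; last by apply: measurableT_comp => //; exact: measurable_scale.
under eq_integral => x _ do under eq_integral => y _ do rewrite scale_cons.
under eq_integral => x _ do rewrite (IH (fun y => F (cons_Rn (l * x, y))))//.
pose H (x : measurableTypeR R) := (\int[leb n]_y F (cons_Rn (x, y)))%E.
have H0 x : (0 <= H x)%E by apply: integral_ge0.
have mH : measurable_fun setT H.
  apply: (measurable_fun_fubini_tonelli_F (m2 := leb n) (F \o @cons_Rn R n)) => //.
    by apply: measurableT_comp => //; exact: measurable_cons_Rn.
  by move=> z; exact: F0.
have aff : (\int[mu]_x H (l * x)%R = (l^-1)%:E * \int[mu]_x H x)%E.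
  by rewrite -(ge0_integral_affine 0 l0 mH H0); apply: eq_integral => x _; rewrite addr0.
have mHl : measurable_fun setT (fun x : measurableTypeR R => H (l * x)).
  apply: (measurableT_comp mH); exact: (@measurable_funM _ (measurableTypeR R)).
transitivity (\int[mu]_x ((l ^- n)%:E * H (l * x)%R))%E; first by [].
rewrite ge0_integralZl//; last by rewrite lee_fin invr_ge0 exprn_ge0// ltW.
by rewrite aff [in RHS]ge0_integral_RnS// muleA -EFinM exprS invfM mulrC.
Qed.

(* In this cone every coordinate of x is comparable to enorm x, so that one
   region serves all the components of u. *)
Definition cone_ball n (l : R) (x : Rn R n) : R :=
  \prod_(i < n) (if enorm x <= 4 * tnth x i then 1 else 0) * (if enorm x <= l then 1 else 0).

Lemma cone_ball_ge0 n l (x : Rn R n) : 0 <= cone_ball l x.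
Proof. by apply: mulr_ge0; [apply: prodr_ge0 => i _|]; case: ifP. Qed.

Lemma measurable_cone_ball n l : measurable_fun setT (@cone_ball n l).
Proof.
apply: measurable_funM; last first.
  by apply: measurable_fun_if => //; apply: measurable_fun_ler => //; exact: measurable_enorm.
apply: measurable_prod => i _; apply: measurable_fun_if => //.
apply: measurable_fun_ler; first exact: measurable_enorm.
by apply: measurable_funM => //; exact: measurable_tnth.
Qed.

Lemma cone_ball_scale n l (x : Rn R n) : 0 < l -> cone_ball l x = cone_ball 1 (scale_Rn l^-1 x).
Proof.
move=> l0; have l'0 : 0 < l^-1 by rewrite invr_gt0.
rewrite /cone_ball enorm_scale ?(ltW l'0)// ler_pdivrMl// mulr1; congr (_ * _).
by apply: eq_bigr => i _; rewrite tnth_scale mulrCA ler_pM2l.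
Qed.

Definition cone_volume n : R := \int[leb n]_x cone_ball 1 x.

Lemma integrable_cone_ball1 n : (leb n).-integrable setT (EFin \o @cone_ball n 1).
Proof.
apply: (integrable_bandnM (C := 1) (M := 1)); first exact: measurable_cone_ball.
move=> x; rewrite mul1r ger0_norm ?cone_ball_ge0//.
have [h|h] := leP (enorm x) 1; last first.
  by rewrite /cone_ball [enorm x <= 1]leNgt h /= mulr0 bandn_ge0.
rewrite /bandn big1 => [|i _]; last by apply: band1; apply: le_trans h; exact: normr_tnth_le_enorm.
rewrite /cone_ball h mulr1; apply: prodr_ile1 => i _; by case: ifP; rewrite ?ler01 ?lexx.
Qed.

Lemma integral_cone_ball n (l : R) : 0 < l ->
  (\int[leb n]_x (cone_ball l x)%:E = (cone_volume n * l ^+ n)%:E)%E.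
Proof.
move=> l0; under eq_integral do rewrite cone_ball_scale//.
have -> : (\int[leb n]_x (cone_ball 1 (scale_Rn l^-1 x))%:E =
    (l^-1 ^- n)%:E * \int[leb n]_x (cone_ball 1 x)%:E)%E.
  apply: (@integral_scale n l^-1 (EFin \o cone_ball 1)); first by rewrite invr_gt0.
    by apply/measurable_EFinP; exact: measurable_cone_ball.
  by move=> x; rewrite lee_fin cone_ball_ge0.
rewrite -EFin_Rintegral; last exact: integrable_cone_ball1.
by rewrite -EFinM exprVn invrK mulrC.
Qed.

(** The cube [1/4, 1/2]^n lies in the cone: its points satisfy |x| <= sqrt n / 2 <= 1 <= 4 x_i. *)
Lemma cone_volume_gt0 n : (n <= 3)%N -> 0 < cone_volume n.
Proof.
move=> n3; apply: (@lt_le_trans _ _ (4^-1 ^+ n)); first by rewrite exprn_gt0// invr_gt0.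
rewrite -lee_fin EFin_Rintegral; last exact: integrable_cone_ball1.
pose g (x : R) : R := if 4^-1 <= x <= 2^-1 then 1 else 0.
have mg : measurable_fun setT g.
  by apply: measurable_fun_if => //; apply: measurable_and; exact: measurable_fun_ler.
have g0 x : 0 <= g x by rewrite /g; case: ifP.
have gc : (\int[mu]_x (g x)%:E = (4^-1)%:E)%E.
  rewrite (_ : (4^-1)%:E = mu (`[4^-1, 2^-1]%classic : set R)); last first.
    rewrite lebesgue_measure_itv /= lte_fin ifT; last by lra.
    by rewrite -EFinD; congr (_%:E); lra.
  rewrite -[mu _]mul1e -integral_cst//.
  rewrite [in RHS]integral_mkcond; apply: eq_integral => x _.
  rewrite patchE /g; case: ifPn => h; first by rewrite mem_set//= in_itv.
  by rewrite memNset//= in_itv /=; exact/negP.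
rewrite -(integral_prod_Rn n mg g0 gc); apply: ge0_le_integral => //.
- by move=> x _; rewrite lee_fin; apply: prodr_ge0.
- apply/measurable_EFinP; apply: measurable_prod => i _; apply: (measurableT_comp mg); exact: measurable_tnth.
- by apply/measurable_EFinP; exact: measurable_cone_ball.
move=> x _; rewrite lee_fin.
have [/forallP h|] := boolP [forall i : 'I_n, 4^-1 <= tnth x i <= 2^-1]; last first.
  rewrite negb_forall => /existsP[i hi]; rewrite (bigD1 i)//= {1}/g (negbTE hi) mul0r.
  exact: cone_ball_ge0.
have e1 : enorm x <= 1.
  rewrite -[1]sqrtr1 /enorm ler_sqrt// /dotp.
  apply: le_trans (_ : \sum_(i < n) (2^-1 * 2^-1 : R) <= _).
    by apply: ler_sum => i _; have /andP[h1 h2] := h i; rewrite ler_pM//; lra.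
  rewrite sumr_const card_ord -[_ *+ _]mulr_natr.
  have : n%:R <= 3 :> R by rewrite ler_nat.
  lra.
rewrite [leRHS](_ : _ = 1); last first.
  rewrite /cone_ball e1 mulr1 big1// => i _; case: ifPn => //.
  by have /andP[h1 h2] := h i; rewrite -ltNge; lra.
by apply: prodr_ile1 => i _; rewrite g0 /g; case: ifP; rewrite ?ler01 ?lexx.
Qed.

Lemma cone_ball_shell n (l l' : R) (x : Rn R n) : 0 < l -> l <= l' ->
  cone_ball l' x - cone_ball l x =
  \prod_(i < n) (if enorm x <= 4 * tnth x i then 1 else 0) * (if l < enorm x <= l' then 1 else 0).
Proof.
move=> l0 ll; rewrite /cone_ball -mulrBr; congr (_ * _).
case: (leP (enorm x) l) => h /=; last by rewrite subr0.
by rewrite (le_trans h ll) subrr.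
Qed.

Lemma integral_cone_shell n (l l' : R) : 0 < l -> l <= l' ->
  (\int[leb n]_x (cone_ball l' x - cone_ball l x)%:E = (cone_volume n * (l' ^+ n - l ^+ n))%:E)%E.
Proof.
move=> l0 ll; have l'0 : 0 < l' by exact: lt_le_trans ll.
have s0 (x : Rn R n) : 0 <= cone_ball l' x - cone_ball l x.
  rewrite cone_ball_shell//; apply: mulr_ge0; [apply: prodr_ge0 => i _|]; by case: ifP.
have ms : measurable_fun setT (fun x : Rn R n => cone_ball l' x - cone_ball l x).
  by apply: measurable_funB; exact: measurable_cone_ball.
have := integral_cone_ball n l'0.
have -> : (\int[leb n]_x (cone_ball l' x)%:E =
   \int[leb n]_x (cone_ball l' x - cone_ball l x)%:E + \int[leb n]_x (cone_ball l x)%:E)%E.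
  rewrite -ge0_integralD//.
  - by apply: eq_integral => x _; rewrite -EFinD subrK.
  - by move=> x _; rewrite lee_fin.
  - exact/measurable_EFinP.
  - by move=> x _; rewrite lee_fin cone_ball_ge0.
  - by apply/measurable_EFinP; exact: measurable_cone_ball.
rewrite integral_cone_ball// => h.
by rewrite mulrBr EFinB -h addeK.
Qed.

End cone.

(** * Transforms of integrable functions near frequency 0 *)

Section fourier_at_zero.
Context {R : realType} (n : nat).
Local Notation leb := (lebesgue_Rn R n).

Lemma normr_sin_le (y : R) : `|sin y| <= `|y|.
Proof.
wlog y0 : y / 0 <= y.
  by move=> h; case: (leP 0 y) => [/h//|/ltW y0]; rewrite -normrN -sinN -[`|y|]normrN h// oppr_ge0.
have := @le_derive_halfline R sin cos y 1 y0.
rewrite sin0 subr0 mul1r (ger0_norm y0); apply.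
- by apply: continuous_subspaceT; exact: continuous_sin.
- by move=> s _; rewrite ler_norml cos_geN1 cos_le1.
Qed.

Lemma normr_cosB1_le (y : R) : `|cos y - 1| <= `|y|.
Proof.
wlog y0 : y / 0 <= y.
  by move=> h; case: (leP 0 y) => [/h//|/ltW y0]; rewrite -cosN -[`|y|]normrN h// oppr_ge0.
have := @le_derive_halfline R cos (fun s => - sin s) y 1 y0.
rewrite cos0 mul1r (ger0_norm y0); apply.
- by apply: continuous_subspaceT; exact: continuous_cos.
- by move=> s _; rewrite normrN ler_norml sin_geN1 sin_le1.
Qed.

Lemma normr_dotp_le (x y : Rn R n) : `|dotp x y| <= (\sum_(i < n) `|tnth x i|) * enorm y.
Proof.
rewrite /dotp mulr_suml; apply: le_trans (ler_norm_sum _ _ _) _; apply: ler_sum => i _.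
by rewrite normrM ler_wpM2l// normr_tnth_le_enorm.
Qed.

Lemma fourier_near0 (f : Rn R n -> R) (e : R) : leb.-integrable setT (EFin \o f) -> 0 < e ->
  exists2 rho : R, 0 < rho & forall xi, enorm xi <= rho ->
    `|cosT f xi - moment f| <= e /\ `|sinT f xi| <= e.
Proof.
move=> fi e0; have /measurable_EFinP mf := measurable_int _ fi.
pose h (m : nat) (x : Rn R n) := `|f x| * Num.min 2 ((\sum_(i < n) `|tnth x i|) / m.+1%:R).
have S0 (x : Rn R n) : 0 <= \sum_(i < n) `|tnth x i| by apply: sumr_ge0.
have h0 m x : 0 <= h m x by rewrite mulr_ge0// le_min ler0n divr_ge0.
have mh m : measurable_fun setT (h m).
  apply: measurable_funM; first exact: measurableT_comp.
  apply: measurable_minr => //; apply: measurable_funM => //.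
  apply: measurable_sum => i; apply: measurableT_comp => //; exact: measurable_tnth.
have hle m x : h m x <= 2 * `|f x| by rewrite mulrC ler_wpM2l// ge_min lexx.
have i2 : leb.-integrable setT (EFin \o (fun x => 2 * `|f x|)).
  by apply: (integrable_scale 2 (f := fun x => `|f x|)); exact: integrable_norm.
have hn m x : `|h m x| <= 2 * `|f x| by rewrite ger0_norm.
have cv : (fun m => \int[leb]_x h m x) @ \oo --> \int[leb]_x (0 : R).
  apply: cvg_Rintegral mh _ _ i2 hn => // x.
  apply: (@squeeze_cvgr _ _ _ _ (cst 0) (fun m => `|f x| * (\sum_(i < n) `|tnth x i|) * m.+1%:R^-1)).
  - by apply: nearW => m; rewrite h0 /= -mulrA ler_wpM2l// ge_min lexx orbT.
  - exact: cvg_cst.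
  - set K := _ * (\sum_(i < n) _).
    have : (fun m => K * @harmonic R m) @ \oo --> K * 0 by apply: cvgM (@cvg_harmonic R); exact: cvg_cst.
    by rewrite mulr0.
rewrite Rintegral_cst// mul0r in cv.
move/cvgrPdist_le : cv => /(_ e e0)[m _ /(_ m (leqnn m))].
rewrite sub0r normrN ger0_norm; last by apply: Rintegral_ge0.
move=> he; exists m.+1%:R^-1 => [|xi hxi]; first by rewrite invr_gt0 ltr0n.
have bnd x : `|dotp x xi| <= (\sum_(i < n) `|tnth x i|) / m.+1%:R.
  by apply: le_trans (normr_dotp_le x xi) _; rewrite ler_wpM2l.
have fint (c : R -> R) : measurable_fun setT (fun x : Rn R n => c (dotp x xi)) ->
    (forall y, `|c y| <= 2) -> (forall y, `|c y| <= `|y|) -> `|\int[leb]_x (f x * c (dotp x xi))| <= e.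
  move=> mc c2 cy; apply: le_trans he; apply: le_Rintegral_dom.
  - exact: measurable_funM.
  - exact: (integrable_dominated (mh m) i2 (hn m)).
  - by move=> x; rewrite normrM ler_wpM2l// le_min c2/=; apply: le_trans (cy _) (bnd x).
split.
  have -> : cosT f xi - moment f = \int[leb]_x (f x * (cos (dotp x xi) - 1)).
    rewrite /cosT /moment -RintegralB//.
      by apply: eq_Rintegral => x _; rewrite mulrBr mulr1.
    apply: integrable_trig => //; first exact: measurable_cosdot.
    by move=> x; rewrite ler_norml cos_geN1 cos_le1.
  apply: (fint (fun y => cos y - 1)).
  - by apply: measurable_funB => //; exact: measurable_cosdot.
  - by move=> y; rewrite ler_norml; have := cos_geN1 y; have := cos_le1 y; lra.
  - exact: normr_cosB1_le.
apply: (fint sin).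
- exact: measurable_sindot.
- by move=> y; rewrite ler_norml; have := sin_geN1 y; have := sin_le1 y; lra.
- exact: normr_sin_le.
Qed.

End fourier_at_zero.

(** * Shells of favourable phase *)

Section shells.
Context {R : realType}.

(** As 2 x is at most pi / 2, cos (2 x) >= 0, so that cos^2 x >= 1/2. *)
Lemma cos_window (x : R) : 0 <= x -> x <= pi / 4 -> 2^-1 <= cos x.
Proof.
move=> x0 x4; have p0 := pi_gt0 R.
have c0 : 0 <= cos x by apply: cos_ge0_pihalf; apply/andP; split; lra.
have : 0 <= cos (x *+ 2) by apply: cos_ge0_pihalf; rewrite [x *+ 2]mulr2n; apply/andP; split; lra.
rewrite cos_mulr2n [_ *+ 2]mulr2n => h.
rewrite -(@ler_pXn2r _ 2) ?nnegrE// ?invr_ge0//.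
rewrite exprVn (_ : 2 ^+ 2 = 4 :> R); [lra|by ring].
Qed.

Variables (beta : R).
Hypothesis beta0 : 0 < beta.

Definition shell_inner (t : R) (j : nat) : R := (2 * pi * j%:R + pi / 2) / (beta * t).
Definition shell_outer (t : R) (j : nat) : R := (2 * pi * j%:R + 3 / 4 * pi) / (beta * t).

Lemma shell_window (t r : R) j : 0 < t -> shell_inner t j < r <= shell_outer t j ->
  2^-1 <= sin (beta * r * t) /\ cos (beta * r * t) <= 0.
Proof.
move=> t0 /andP[h1 h2]; have bt : 0 < beta * t by rewrite mulr_gt0.
have p0 := pi_gt0 R.
rewrite ltr_pdivrMr// in h1; rewrite ler_pdivlMr// in h2.
rewrite mulrAC mulrC; set y := r * (beta * t) in h1 h2 *.
have -> : y = (y - 2 * pi * j%:R - pi / 2) + pi / 2 + (pi *+ 2) *+ j.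
  by rewrite -mulr_natr -[pi *+ 2]mulr_natr; ring.
rewrite (periodicn (@sinD2pi R)) (periodicn (@cosD2pi R)) sinDpihalf cosDpihalf oppr_le0.
split; first by apply: cos_window; lra.
by apply: sin_ge0_pi; apply/andP; split; lra.
Qed.

Lemma shell_inner_gt0 t j : 0 < t -> 0 < shell_inner t j.
Proof.
move=> t0; have p0 := pi_gt0 R.
rewrite divr_gt0 ?mulr_gt0// ltr_wpDl ?divr_gt0//.
by rewrite mulr_ge0// mulr_ge0// ltW.
Qed.

Lemma shell_width t j : shell_outer t j - shell_inner t j = pi / 4 / (beta * t).
Proof. by rewrite /shell_outer /shell_inner -mulrBl; congr (_ / _); lra. Qed.

Lemma shell_le t j : 0 < t -> shell_inner t j <= shell_outer t j.
Proof.
by move=> t0; rewrite -subr_ge0 shell_width !divr_ge0 ?pi_ge0// mulr_ge0 ?ltW.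
Qed.

Lemma shell_outer_gt0 t j : 0 < t -> 0 < shell_outer t j.
Proof. by move=> t0; exact: lt_le_trans (shell_inner_gt0 j t0) (shell_le j t0). Qed.

Lemma shell_outer_lt t j : 0 < t -> shell_outer t j <= 2 * pi * j.+1%:R / (beta * t).
Proof.
move=> t0; have p0 := pi_gt0 R; rewrite ler_wpM2r ?invr_ge0 ?mulr_ge0 ?(ltW t0) ?(ltW beta0)//.
have -> : 2 * pi * j.+1%:R = 2 * pi * j%:R + 2 * pi :> R by rewrite -(natr1 j); ring.
lra.
Qed.

Lemma shell_disjoint t i j : 0 < t -> (i < j)%N -> shell_outer t i <= shell_inner t j.
Proof.
move=> t0 ij; apply: le_trans (shell_outer_lt i t0) _; have p0 := pi_gt0 R.
rewrite ler_wpM2r ?invr_ge0 ?mulr_ge0 ?(ltW t0) ?(ltW beta0)//.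
apply: le_trans (_ : 2 * pi * j%:R <= _); last by lra.
by rewrite ler_wpM2l ?ler_nat// mulr_ge0// ltW.
Qed.

(** Up to the volume of the cone, a minorant of the integral of |xi|^-2 over the shells, obtained by
    taking the value of the integrand at the outer radius. *)
Definition shell_sum n (t : R) m : R :=
  \sum_(j < m) (shell_outer t j ^+ n - shell_inner t j ^+ n) / shell_outer t j ^+ 2.

Let harmonic_ln m : ln (m.+1%:R : R) <= \sum_(j < m) j.+1%:R^-1.
Proof.
elim: m => [|m IH]; first by rewrite big_ord0 ln1.
rewrite big_ord_recr/=; apply: le_trans (lerD IH (lexx _)).
have m0 : 0 < m.+1%:R :> R by rewrite ltr0n.
have -> : m.+2%:R = m.+1%:R * (1 + m.+1%:R^-1) :> R.
  by rewrite mulrDr mulr1 divff ?gt_eqF// natr1.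
have i0 : 0 < m.+1%:R^-1 :> R by rewrite invr_gt0.
have p1 : 0 < 1 + m.+1%:R^-1 :> R by rewrite addr_gt0.
rewrite lnM ?posrE// lerD2l le_ln1Dx//.
by rewrite (lt_trans _ i0)// oppr_lt0.
Qed.

(** The three arguments of the minimum are the constants for n = 1, 2, 3. *)
Definition shell_const (mu : R) : R :=
  Num.min (beta / (9 * pi)) (Num.min 32^-1 (pi * mu / (8 * beta))).

Lemma shell_const_gt0 mu : 0 < mu -> 0 < shell_const mu.
Proof.
move=> mu0; have p0 := pi_gt0 R.
have p9 : 0 < 9 * pi :> R by exact: mulr_gt0.
have b8 : 0 < 8 * beta by exact: mulr_gt0.
have pm : 0 < pi * mu by exact: mulr_gt0.
by rewrite /shell_const !lt_min divr_gt0// invr_gt0 ltr0n divr_gt0.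
Qed.

(** Shell j has width of order 1 / t at radius of order (j + 1) / t. For n = 1 the first shell alone
    gives t; for n = 2 shell j gives at least 1 / (8 (j + 1)), a harmonic sum; for n = 3 about sqrt
    t shells give at least a multiple of 1 / t each. Here mu^-2 <= t provides at least one shell,
    and mu^-4 <= t makes the logarithm of their number at least ln t / 4. *)
Lemma shell_sum_ge n (t mu : R) : (1 <= n <= 3)%N -> 0 < mu -> 2 + mu ^- 2 + mu ^- 4 <= t ->
  shell_const mu * growth n t ^+ 2 <= shell_sum n t (Num.truncn (mu * Num.sqrt t)).
Proof.
move=> n13 mu0 tmu; have p0 := pi_gt0 R.
have i2 : 0 < mu ^- 2 by rewrite invr_gt0 exprn_gt0.
have i4 : 0 < mu ^- 4 by rewrite invr_gt0 exprn_gt0.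
have t0 : 0 < t by lra.
have bt : 0 < beta * t by rewrite mulr_gt0.
have st0 : 0 < Num.sqrt t by rewrite sqrtr_gt0.
have st2 : Num.sqrt t ^+ 2 = t by rewrite sqr_sqrtr// ltW.
set x := mu * Num.sqrt t.
have x1 : 1 <= x.
  rewrite -(@ler_pXn2r _ 2) ?nnegrE ?mulr_ge0 ?(ltW mu0) ?(ltW st0)// expr1n exprMn st2.
  by rewrite -ler_pdivrMl ?exprn_gt0// mulr1; lra.
have x0 : 0 <= x by lra.
have /andP[m1 m2] := truncn_itv x0.
have m0 : (0 < Num.truncn x)%N by rewrite truncn_gt0.
move: m1 m2 m0; set m := Num.truncn x => m1 m2 m0.
have term k j : (shell_outer t j - shell_inner t j) * shell_outer t j ^+ k <=
    shell_outer t j ^+ k.+1 - shell_inner t j ^+ k.+1.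
  have o0 := shell_outer_gt0 j t0; have i0 := shell_inner_gt0 j t0.
  rewrite mulrBl -!exprS lerD2l lerN2 exprS ler_wpM2l ?(ltW i0)//.
  by rewrite lerXn2r ?nnegrE ?(ltW i0) ?(ltW o0)// shell_le.
have term0 k j : 0 <= (shell_outer t j ^+ k - shell_inner t j ^+ k) / shell_outer t j ^+ 2.
  rewrite divr_ge0 ?sqr_ge0// subr_ge0 lerXn2r ?nnegrE ?shell_le//; apply: ltW.
    exact: shell_inner_gt0.
  exact: shell_outer_gt0.
case: n n13 => [|[|[|[|n]]]]// _.
- rewrite growth1_sqr ?(ltW t0)//.
  apply: le_trans (_ : beta / (9 * pi) * t <= _).
    by rewrite ler_wpM2r ?(ltW t0)// /shell_const ge_min lexx.
  rewrite /shell_sum -(prednK m0) big_ord_recl.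
  apply: (@le_trans _ _ ((shell_outer t 0 ^+ 1 - shell_inner t 0 ^+ 1) / shell_outer t 0 ^+ 2)); last first.
    by rewrite lerDl; apply: sumr_ge0.
  rewrite !expr1 shell_width /shell_outer mulr0 add0r.
  have -> : pi / 4 / (beta * t) / (3 / 4 * pi / (beta * t)) ^+ 2 = 4 * (beta / (9 * pi) * t) :> R.
    by move: {+}p0; move: (pi : R) => q q0; field; rewrite !gt_eqF.
  have p9 : 0 < 9 * pi :> R by exact: mulr_gt0.
  have : 0 < beta / (9 * pi) * t by exact: mulr_gt0 (divr_gt0 beta0 p9) t0.
  lra.
- rewrite growth2_sqr; last by lra.
  have lnt : - ln mu * 4 <= ln t.
    have -> : - ln mu * 4 = ln (mu ^- 4).
      by rewrite lnV ?posrE ?exprn_gt0// lnXn// -mulr_natr; ring.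
    by rewrite ler_ln ?posrE//; lra.
  have lnx : ln x = ln mu + ln t / 2.
    by rewrite lnM ?posrE// -[in RHS]st2 lnXn// mulr2n; lra.
  apply: le_trans (_ : 32^-1 * ln t <= _).
    by rewrite ler_wpM2r ?ln_ge0 /shell_const ?ge_min ?lexx ?orbT//; lra.
  apply: le_trans (_ : 8^-1 * ln m.+1%:R <= _).
    have : ln x <= ln m.+1%:R by rewrite ler_ln ?posrE//; [exact: ltW|lra].
    by rewrite lnx; lra.
  apply: le_trans (ler_wpM2l _ (harmonic_ln m)) _; first by rewrite invr_ge0.
  rewrite mulr_sumr; apply: ler_sum => j _.
  have o0 := shell_outer_gt0 j t0.
  apply: le_trans (_ : (shell_outer t j - shell_inner t j) * shell_outer t j ^+ 1 / shell_outer t j ^+ 2 <= _); last first.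
    by rewrite ler_wpM2r ?invr_ge0 ?sqr_ge0// term.
  have E (d o : R) : 0 < o -> d * o ^+ 1 / o ^+ 2 = d / o by move=> h; field; rewrite gt_eqF.
  rewrite E// shell_width.
  rewrite ler_pdivlMr//; apply: le_trans (ler_wpM2l _ (shell_outer_lt j t0)) _.
    by rewrite mulr_ge0 ?invr_ge0.
  rewrite le_eqVlt; apply/orP; left; apply/eqP.
  have j0 : 0 < j.+1%:R :> R by rewrite ltr0n.
  by move: {+}p0 {+}j0; move: (pi : R) (j.+1%:R : R) => q y q0 y0; field; rewrite !gt_eqF.
- rewrite growth3_sqr ?(ltW t0)//.
  apply: le_trans (_ : (pi * mu / (8 * beta)) * (Num.sqrt t)^-1 <= _).
    by rewrite ler_wpM2r ?invr_ge0 ?(ltW st0)// /shell_const !ge_min lexx !orbT.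
  apply: le_trans (_ : \sum_(j < m) (pi / 4 / (beta * t)) <= _).
    rewrite sumr_const card_ord -[leRHS]mulr_natl.
    have hm : mu * Num.sqrt t / 2 <= m%:R.
      have : 1 <= m%:R :> R by rewrite ler1n.
      by rewrite -(natr1 m) in m2; rewrite -/x; lra.
    apply: le_trans (ler_wpM2r _ hm); last by rewrite !divr_ge0 ?(ltW p0) ?(ltW bt).
    rewrite -[X in _ / (beta * X)]st2 le_eqVlt; apply/orP; left; apply/eqP.
    by move: {+}p0 {+}st0; move: (pi : R) (Num.sqrt t) => q y q0 y0; field; rewrite !gt_eqF.
  apply: ler_sum => j _; have o0 := shell_outer_gt0 j t0.
  apply: le_trans (_ : (shell_outer t j - shell_inner t j) * shell_outer t j ^+ 2 / shell_outer t j ^+ 2 <= _); last first.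
    by rewrite ler_wpM2r ?invr_ge0 ?sqr_ge0// term.
  by rewrite shell_width mulfK// gt_eqF// exprn_gt0.
Qed.

End shells.

(** * Integration of the pointwise lower bound *)

Section lower_bound.
Context {R : realType} (n : nat).
Local Notation leb := (lebesgue_Rn R n).
Variables (b kappa gamma1 gamma2 : R).
Hypotheses (b0 : 0 < b) (kappa0 : 0 < kappa) (gamma0 : 0 < gamma1 * gamma2).
Variables (u0 u1 : 'I_n -> Rn R n -> R) (theta0 : Rn R n -> R).
Hypothesis data : admissible_data u0 u1 theta0.

Local Notation beta := (wave_speed b (gamma1 * gamma2)).
Local Notation eta := (lower_eta b kappa gamma1 gamma2).
Local Notation eps := (lower_eps b gamma1 gamma2).
Local Notation amp := (lower_amplitude b gamma1 gamma2).

(** For j + 1 <= [shell_rate] sqrt t the outer radius of shell j is at most sqrt (eta / t), so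
    |xi|^2 t <= eta on all shells retained. *)
Definition shell_rate : R := beta * Num.sqrt eta / (2 * pi).
Local Notation mu := shell_rate.

Let beta0 : 0 < beta. Proof. exact: wave_speed_gt0. Qed.
Let eta0 : 0 < eta. Proof. exact: lower_eta_gt0. Qed.

Lemma shell_rate_gt0 : 0 < mu.
Proof.
have tp : 0 < 2 * pi :> R by rewrite mulr_gt0 ?pi_gt0.
have se : 0 < Num.sqrt eta by rewrite sqrtr_gt0.
exact: divr_gt0 (mulr_gt0 beta0 se) tp.
Qed.

Definition close_to_moments (k : 'I_n) (A : R) (xi : Rn R n) : Prop :=
  [/\ `|cosT (u1 k) xi - moment (u1 k)| <= eps * A /\ `|sinT (u1 k) xi| <= eps * A,
      `|cosT theta0 xi - moment theta0| <= eps * A /\ `|sinT theta0 xi| <= eps * A &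
      enorm xi * `|cosT (u0 k) xi| <= eps * A /\ enorm xi * `|sinT (u0 k) xi| <= eps * A].

Lemma data_near0 (k : 'I_n) (A : R) : 0 < A ->
  exists2 rho : R, 0 < rho & forall xi, enorm xi <= rho -> close_to_moments k A xi.
Proof.
move=> A0; have eA : 0 < eps * A by rewrite mulr_gt0// lower_eps_gt0.
have [r1 r10 h1] := fourier_near0 (L12_integrable (data_u1 data k)) eA.
have [r2 r20 h2] := fourier_near0 (L12_integrable (data_theta0 data)) eA.
have [r0 r00 h0] := fourier_near0 (L12_integrable (data_u0 data k)) ltr01.
(* For u0 a bound near 0 is enough, because the factor |xi| supplies the smallness. *)
pose K := `|moment (u0 k)| + 1.
have K0 : 0 < K by rewrite ltr_wpDl.
exists (Num.min (Num.min r1 r2) (Num.min r0 (eps * A / K))).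
  by rewrite !lt_min r10 r20 r00 divr_gt0.
move=> xi; rewrite !le_min => /andP[/andP[/h1 c1 /h2 c2] /andP[/h0 [c0 s0] hx]].
have x0 : 0 <= enorm xi by exact: sqrtr_ge0.
have hK (z : R) : `|z| <= K -> enorm xi * `|z| <= eps * A.
  by move=> hz; apply: le_trans (ler_pM x0 (normr_ge0 z) hx hz) _; rewrite divfK ?gt_eqF.
split=> //; split; apply: hK; rewrite /K.
  by rewrite -[cosT _ _](subrK (moment (u0 k))); apply: le_trans (ler_normD _ _) _; lra.
by apply: le_trans s0 _; rewrite lerDr.
Qed.

Variables (uh : R -> 'I_n -> Rn R n -> R[i]) (th : R -> Rn R n -> R[i]).
Hypothesis ode : forall xi, fourier_ode b kappa gamma1 gamma2 xi
        (fun j => fourier (u0 j) xi) (fun j => fourier (u1 j) xi)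
        (fourier theta0 xi) (fun t j => uh t j xi) (fun t => th t xi).

Variables (k : 'I_n) (rho t A : R).
Hypotheses (rho0 : 0 < rho) (A0 : 0 < A).
Hypothesis AE : A ^+ 2 = moment (u1 k) ^+ 2 + moment theta0 ^+ 2.
Hypothesis near0 : forall xi, enorm xi <= rho -> close_to_moments k A xi.
Hypothesis tT : 2 + mu ^- 2 + mu ^- 4 + eta / rho ^+ 2 <= t.
Local Notation m := (Num.truncn (mu * Num.sqrt t)).
Local Notation inner := (shell_inner beta t).
Local Notation outer := (shell_outer beta t).

Let t0 : 0 < t.
Proof.
have i2 : 0 < mu ^- 2 by rewrite invr_gt0 exprn_gt0// shell_rate_gt0.
have i4 : 0 < mu ^- 4 by rewrite invr_gt0 exprn_gt0// shell_rate_gt0.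
have i1 : 0 < eta / rho ^+ 2 by exact: divr_gt0 eta0 (exprn_gt0 2 rho0).
by apply: lt_le_trans tT; rewrite (addr_gt0 _ i1)// (addr_gt0 _ i4)// (addr_gt0 _ i2).
Qed.

Let outer_le j : (j < m)%N -> outer j <= Num.sqrt eta / Num.sqrt t.
Proof.
move=> jm; apply: le_trans (shell_outer_lt beta0 j t0) _.
have st0 : 0 < Num.sqrt t by rewrite sqrtr_gt0.
have tp : 0 < 2 * pi :> R by rewrite mulr_gt0 ?pi_gt0.
have x0 : 0 <= mu * Num.sqrt t by exact: mulr_ge0 (ltW shell_rate_gt0) (ltW st0).
have /andP[m1 _] := truncn_itv x0.
have jx : j.+1%:R <= mu * Num.sqrt t by apply: le_trans m1; rewrite ler_nat.
rewrite ler_pdivrMr ?mulr_gt0//; apply: le_trans (ler_wpM2l (ltW tp) jx) _.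
rewrite /shell_rate -[X in _ <= _ * (_ * X)](sqr_sqrtr (ltW t0)) le_eqVlt; apply/orP; left; apply/eqP.
by move: {+}st0 {+}tp; move: (2 * pi : R) (Num.sqrt t) => q y y0 q0; field; rewrite !gt_eqF.
Qed.

(** The term eta / rho^2 of the threshold pushes sqrt (eta / t) below rho, where the data are close
    to their moments; through rho the threshold depends on the data. *)
Let outer_rho j : (j < m)%N -> outer j <= rho.
Proof.
move=> jm; apply: le_trans (outer_le jm) _.
have st0 : 0 < Num.sqrt t by rewrite sqrtr_gt0.
rewrite ler_pdivrMr// -(@ler_pXn2r _ 2) ?nnegrE ?mulr_ge0 ?sqrtr_ge0 ?(ltW rho0)//.
rewrite exprMn !sqr_sqrtr ?(ltW eta0) ?(ltW t0)// -ler_pdivrMl ?exprn_gt0// mulrC.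
have i2 : 0 < mu ^- 2 by rewrite invr_gt0 exprn_gt0// shell_rate_gt0.
have i4 : 0 < mu ^- 4 by rewrite invr_gt0 exprn_gt0// shell_rate_gt0.
by apply: le_trans tT; rewrite lerDr (ltW (addr_gt0 (addr_gt0 _ i2) i4)).
Qed.

Let outer_eta j : (j < m)%N -> outer j ^+ 2 * t <= eta.
Proof.
move=> jm; have st0 : 0 < Num.sqrt t by rewrite sqrtr_gt0.
have o0 := shell_outer_gt0 beta0 j t0.
have : outer j ^+ 2 <= (Num.sqrt eta / Num.sqrt t) ^+ 2.
  by rewrite lerXn2r ?nnegrE ?(ltW o0) ?outer_le// divr_ge0 ?sqrtr_ge0.
rewrite [(Num.sqrt eta / _) ^+ 2]expr_div_n !sqr_sqrtr ?(ltW eta0) ?(ltW t0)// => h.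
by rewrite -ler_pdivlMr.
Qed.

Let shell_lower j xi : (j < m)%N ->
  (amp * A) ^+ 2 / outer j ^+ 2 * (cone_ball (outer j) xi - cone_ball (inner j) xi) <= sqnormC (uh t k xi).
Proof.
move=> jm; have o0 := shell_outer_gt0 beta0 j t0.
rewrite cone_ball_shell ?shell_le ?shell_inner_gt0//.
have [/forallP hc|] := boolP [forall i : 'I_n, enorm xi <= 4 * tnth xi i]; last first.
  rewrite negb_forall => /existsP[i hi].
  by rewrite (bigD1 i)//= (negbTE hi) !mul0r mulr0 sqnormC_ge0.
have [hr|_] := boolP (inner j < enorm xi <= outer j); last first.
  by rewrite !mulr0 sqnormC_ge0.
rewrite big1 ?mulr1 => [|i _]; last by rewrite hc.
have [hs hcos] := shell_window beta0 t0 hr; have /andP[hin hout] := hr.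
have r0 : 0 < enorm xi by apply: lt_trans hin; exact: shell_inner_gt0.
have [[c1 s1] [c2 s2] [c0 s0]] := near0 (le_trans hout (outer_rho jm)).
have r2 : enorm xi ^+ 2 <= outer j ^+ 2 by rewrite lerXn2r ?nnegrE ?(ltW r0) ?(ltW o0).
have rt : enorm xi ^+ 2 * t <= eta by apply: le_trans (outer_eta jm); rewrite ler_wpM2r// ltW.
rewrite ler_pdivrMr ?exprn_gt0// [leRHS]mulrC.
have := fourier_ode_lower b0 kappa0 gamma0 (k := k) (m1 := moment (u1 k)) (m2 := moment theta0) (ode xi)
  (fourier_parallel xi (fun k => L12_integrable (data_u0 data k)) (data_rot_u0 data))
  (fourier_parallel xi (fun k => L12_integrable (data_u1 data k)) (data_rot_u1 data))
  (ltW A0) AE c1 _ c2 _ c0 _ r0 (hc k) (ltW t0) rt hs hcos.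
rewrite /= !normrN => /(_ s1 s2 s0) h; apply: (le_trans h).
by rewrite ler_wpM2r// sqnormC_ge0.
Qed.

(** The shells are disjoint, so at most one term of the sum is nonzero at a given xi. *)
Let shells_lower xi :
  \sum_(j < m) (amp * A) ^+ 2 / outer j ^+ 2 * (cone_ball (outer j) xi - cone_ball (inner j) xi) <=
  sqnormC (uh t k xi).
Proof.
have zero (j : 'I_m) : ~~ (inner j < enorm xi <= outer j) ->
    (amp * A) ^+ 2 / outer j ^+ 2 * (cone_ball (outer j) xi - cone_ball (inner j) xi) = 0.
  by move=> /negbTE h; rewrite cone_ball_shell ?shell_le ?shell_inner_gt0// h !mulr0.
have [/existsP[i hi]|] := boolP [exists j : 'I_m, inner j < enorm xi <= outer j]; last first.
  rewrite negb_exists => /forallP h; rewrite big1 ?sqnormC_ge0// => j _; exact: zero.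
rewrite (bigD1 i)//= big1 ?addr0; first exact: shell_lower.
move=> j ji; apply: zero; apply/negP => /andP[h1 h2]; have /andP[h3 h4] := hi.
have [ij|ij|/val_inj ij] := ltngtP i j.
- by have := shell_disjoint beta0 t0 ij; lra.
- by have := shell_disjoint beta0 t0 ij; lra.
- by rewrite ij eqxx in ji.
Qed.

Lemma fourier_integral_lower : measurable_fun setT (fun xi => sqnormC (uh t k xi)) ->
  (((amp * A) ^+ 2 * cone_volume n * shell_sum beta n t m)%:E <= \int[leb]_xi (sqnormC (uh t k xi))%:E)%E.
Proof.
move=> msq.
pose F (j : nat) (xi : Rn R n) := (amp * A) ^+ 2 / outer j ^+ 2 * (cone_ball (outer j) xi - cone_ball (inner j) xi).
have F0 j xi : 0 <= F j xi.
  rewrite /F cone_ball_shell ?shell_le ?shell_inner_gt0//.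
  apply: mulr_ge0; first by rewrite divr_ge0 ?sqr_ge0.
  apply: mulr_ge0; [apply: prodr_ge0 => i _|]; by case: ifP.
have mC j : measurable_fun setT (fun xi : Rn R n => cone_ball (outer j) xi - cone_ball (inner j) xi).
  by apply: measurable_funB; exact: measurable_cone_ball.
have mF j : measurable_fun setT (F j) by apply: measurable_funM.
have -> : ((amp * A) ^+ 2 * cone_volume n * shell_sum beta n t m)%:E =
   (\int[leb]_xi \sum_(j < m) (F j xi)%:E)%E.
  rewrite ge0_integral_sum//; last 2 first.
  - by move=> j; exact/measurable_EFinP.
  - by move=> j xi _; rewrite lee_fin.
  rewrite /shell_sum mulr_sumr -sumEFin; apply: eq_bigr => j _.
  under eq_integral do rewrite EFinM.
  rewrite ge0_integralZl//; last 3 first.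
  - exact/measurable_EFinP.
  - move=> xi _; rewrite lee_fin cone_ball_shell ?shell_le ?shell_inner_gt0//.
    apply: mulr_ge0; [apply: prodr_ge0 => i _|]; by case: ifP.
  - by rewrite lee_fin divr_ge0 ?sqr_ge0.
  rewrite integral_cone_shell ?shell_le ?shell_inner_gt0// -EFinM; congr (_%:E); ring.
apply: ge0_le_integral => //.
- by move=> xi _; apply: sume_ge0 => j _; rewrite lee_fin.
- by apply: emeasurable_sum => j; exact/measurable_EFinP.
- exact/measurable_EFinP.
- by move=> xi _; rewrite sumEFin lee_fin; exact: shells_lower.
Qed.

End lower_bound.

Section solution_lower.
Context {R : realType} (n : nat).
Local Notation leb := (lebesgue_Rn R n).
Variables (b kappa gamma1 gamma2 : R).
Hypotheses (b0 : 0 < b) (kappa0 : 0 < kappa) (gamma0 : 0 < gamma1 * gamma2).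
Hypothesis n13 : (1 <= n <= 3)%N.
Local Notation beta := (wave_speed b (gamma1 * gamma2)).
Local Notation amp := (lower_amplitude b gamma1 gamma2).
Local Notation mu := (shell_rate b kappa gamma1 gamma2).

(** The denominator is the constant of [fourier_L2_lower]; amplitude, cone volume and shell sum make
    up the numerator. *)
Definition lower_const_sqr : R :=
  (amp ^+ 2 * cone_volume n * shell_const beta mu) / (2 * (2 * pi) ^+ n).

Lemma lower_const_sqr_gt0 : 0 < lower_const_sqr.
Proof.
have n3 : (n <= 3)%N by case/andP: n13.
have mu0 : 0 < mu by exact: shell_rate_gt0.
have s0 := shell_const_gt0 (wave_speed_gt0 b gamma0) mu0.
have a0 := lower_amplitude_gt0 b gamma0.
have V0 := @cone_volume_gt0 R n n3.
have p0 : 0 < 2 * (2 * pi : R) ^+ n by exact: mulr_gt0 (twopiXn_gt0 n).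
exact: divr_gt0 (mulr_gt0 (mulr_gt0 (exprn_gt0 2 a0) V0) s0) p0.
Qed.

Definition lower_const : R := Num.sqrt lower_const_sqr.

Lemma lower_const_gt0 : 0 < lower_const.
Proof. by rewrite sqrtr_gt0 lower_const_sqr_gt0. Qed.

Lemma L2norm_solution_ge (u0 u1 : 'I_n -> Rn R n -> R) (theta0 : Rn R n -> R) (k : 'I_n) :
  admissible_data u0 u1 theta0 ->
  exists T : R, forall (u : R -> 'I_n -> Rn R n -> R) (theta : R -> Rn R n -> R),
        fourier_solution b kappa gamma1 gamma2 u0 u1 theta0 u theta ->
        forall t : R, T <= t ->
        ((lower_const * growth n t * `|AA (u1 k) theta0|)%:E <= L2norm (u t k))%E.
Proof.
move=> data; set A := AA (u1 k) theta0.
have Age0 : 0 <= A by exact: sqrtr_ge0.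
rewrite (ger0_norm Age0); move: Age0; rewrite le_eqVlt => /orP[/eqP<-|A0].
  by exists 0 => u theta _ t _; rewrite mulr0 L2norm_ge0.
have AE : A ^+ 2 = moment (u1 k) ^+ 2 + moment theta0 ^+ 2.
  by rewrite /A /AA sqr_sqrtr ?addr_ge0 ?sqr_ge0// !real_normK ?num_real.
have [rho rho0 near0] := data_near0 b gamma0 data k A0.
have mu0 : 0 < mu by exact: shell_rate_gt0.
exists (2 + mu ^- 2 + mu ^- 4 + lower_eta b kappa gamma1 gamma2 / rho ^+ 2).
move=> u theta [uh [th [ode uhF _]]] t tT.
have eta0 : 0 < lower_eta b kappa gamma1 gamma2 / rho ^+ 2.
  by rewrite divr_gt0 ?exprn_gt0// lower_eta_gt0.
have tT' : 2 + mu ^- 2 + mu ^- 4 <= t by apply: le_trans tT; rewrite lerDl ltW.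
have t0 : 0 <= t.
  by apply: le_trans tT'; rewrite !addr_ge0 ?invr_ge0 ?exprn_ge0 ?(ltW mu0).
have fg := uhF t k t0; have [uL2 m1 m2 _] := fg.
have msq : measurable_fun setT (fun xi => sqnormC (uh t k xi)).
  by apply: measurable_funD; exact: measurable_funX.
have h1 := fourier_integral_lower b0 kappa0 gamma0 data ode rho0 A0 AE near0 tT msq.
have h2 := fourier_L2_lower uL2 fg.
have h3 := shell_sum_ge (wave_speed_gt0 b gamma0) n13 mu0 tT'.
have G0 := growth_ge0 n t.
have p0 : 0 < 2 * (2 * pi : R) ^+ n by exact: mulr_gt0 (twopiXn_gt0 n).
have n3 : (n <= 3)%N by case/andP: n13.
have V0 := @cone_volume_gt0 R n n3.
apply: L2norm_ge.
  exact: mulr_ge0 (mulr_ge0 (ltW lower_const_gt0) G0) (ltW A0).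
rewrite 2!exprMn sqr_sqrtr ?(ltW lower_const_sqr_gt0)//.
have -> : lower_const_sqr * growth n t ^+ 2 * A ^+ 2 = (2 * (2 * pi) ^+ n)^-1 *
  ((amp * A) ^+ 2 * cone_volume n * (shell_const beta mu * growth n t ^+ 2)).
  by rewrite /lower_const_sqr; ring.
rewrite EFinM lee_pdivrMl//; apply: le_trans h2; apply: le_trans h1.
rewrite lee_fin; apply: ler_wpM2l h3.
by rewrite mulr_ge0 ?sqr_ge0// ltW.
Qed.

End solution_lower.

Theorem theorem2p1 (R : realType) (n : nat) (b kappa gamma1 gamma2 : R)
    (n_ge1 : (1 <= n)%N) (n_le3 : (n <= 3)%N)
    (b_gt0 : 0 < b) (kappa_gt0 : 0 < kappa) (gamma_gt0 : 0 < gamma1 * gamma2) :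
  [/\ exists C T : R, [/\ 0 < C, 1 < T &
        forall (u0 u1 : 'I_n -> Rn R n -> R) (theta0 : Rn R n -> R),
        admissible_data u0 u1 theta0 ->
        forall (u : R -> 'I_n -> Rn R n -> R) (theta : R -> Rn R n -> R),
        fourier_solution b kappa gamma1 gamma2 u0 u1 theta0 u theta ->
        forall (k : 'I_n) (t : R), T <= t ->
        (L2norm (u t k) <= (C * growth n t)%:E *
           (L12norm (u0 k) + L12norm (u1 k) + L12norm theta0))%E],
      exists c : R, 0 < c /\
        forall (u0 u1 : 'I_n -> Rn R n -> R) (theta0 : Rn R n -> R),
        admissible_data u0 u1 theta0 ->
        exists T : R, 1 < T /\
        forall (u : R -> 'I_n -> Rn R n -> R) (theta : R -> Rn R n -> R),
        fourier_solution b kappa gamma1 gamma2 u0 u1 theta0 u theta ->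
        forall (k : 'I_n) (t : R), T <= t ->
        ((c * growth n t * `|AA (u1 k) theta0|)%:E <= L2norm (u t k))%E &
      forall (u0 u1 : 'I_n -> Rn R n -> R) (theta0 : Rn R n -> R) (k : 'I_n),
        admissible_data u0 u1 theta0 -> `|AA (u1 k) theta0| != 0 ->
        exists c C T : R, [/\ 0 < c, 0 < C, 1 < T &
        forall (u : R -> 'I_n -> Rn R n -> R) (theta : R -> Rn R n -> R),
        fourier_solution b kappa gamma1 gamma2 u0 u1 theta0 u theta ->
        forall t : R, T <= t ->
        ((c * growth n t)%:E <= L2norm (u t k))%E /\
        (L2norm (u t k) <= (C * growth n t)%:E)%E]].
Proof.
have n13 : (1 <= n <= 3)%N by rewrite n_ge1.
have lower : exists c : R, 0 < c /\
    forall (u0 u1 : 'I_n -> Rn R n -> R) (theta0 : Rn R n -> R),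
    admissible_data u0 u1 theta0 ->
    exists T : R, 1 < T /\
    forall (u : R -> 'I_n -> Rn R n -> R) (theta : R -> Rn R n -> R),
    fourier_solution b kappa gamma1 gamma2 u0 u1 theta0 u theta ->
    forall (k : 'I_n) (t : R), T <= t ->
    ((c * growth n t * `|AA (u1 k) theta0|)%:E <= L2norm (u t k))%E.
  exists (lower_const n b kappa gamma1 gamma2); split; first exact: lower_const_gt0.
  move=> u0 u1 theta0 data.
  have /choice[T hT] := fun k => L2norm_solution_ge b_gt0 kappa_gt0 gamma_gt0 n13 k data.
  (* The sum dominates the thresholds of all components, so one time serves every k. *)
  exists (2 + \sum_k `|T k|); split.
    by rewrite (@lt_le_trans _ _ 2) ?ltr1n// lerDl sumr_ge0.
  move=> u theta sol k t tT; apply: (hT k _ _ sol t); apply: le_trans tT.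
  rewrite (bigD1 k)//= addrCA; apply: le_trans (ler_norm _) _.
  by rewrite lerDl addr_ge0// sumr_ge0.
have upper : exists C T : R, [/\ 0 < C, 1 < T &
    forall (u0 u1 : 'I_n -> Rn R n -> R) (theta0 : Rn R n -> R),
    admissible_data u0 u1 theta0 ->
    forall (u : R -> 'I_n -> Rn R n -> R) (theta : R -> Rn R n -> R),
    fourier_solution b kappa gamma1 gamma2 u0 u1 theta0 u theta ->
    forall (k : 'I_n) (t : R), T <= t ->
    (L2norm (u t k) <= (C * growth n t)%:E *
       (L12norm (u0 k) + L12norm (u1 k) + L12norm theta0))%E].
  (* A square root is only known to be nonnegative; adding 1 makes the constant positive. *)
  exists (upper_const n b kappa gamma1 gamma2 + 1), 2; split.
  - by rewrite ltr_wpDl ?sqrtr_ge0.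
  - by rewrite ltr1n.
  move=> u0 u1 theta0 data u theta sol k t t2.
  apply: le_trans (L2norm_solution_le b_gt0 kappa_gt0 gamma_gt0 data sol k n13 t2) _.
  apply: lee_wpmul2r; first by rewrite !adde_ge0 ?Lnorm_ge0.
  by rewrite lee_fin ler_wpM2r ?growth_ge0// lerDl.
split=> // u0 u1 theta0 k data A0.
have [C [T [C0 T1 hC]]] := upper.
have [c [c0 /(_ _ _ _ data)[T' [T'1 hc]]]] := lower.
have [a0 [a00 _ e0]] := L12norm_EFin (data_u0 data k).
have [a1 [a10 _ e1]] := L12norm_EFin (data_u1 data k).
have [a2 [a20 _ e2]] := L12norm_EFin (data_theta0 data).
pose S := a0 + L1norm (u0 k) + (a1 + L1norm (u1 k)) + (a2 + L1norm theta0).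
have S0 : 0 <= S by rewrite !addr_ge0 ?L1norm_ge0.
(* Here the constants may depend on the data: the lower one contains the moments, the upper one the
   norm [S] of the data, again increased by 1 for positivity. *)
exists (c * `|AA (u1 k) theta0|), (C * (S + 1)), (Num.max T T'); split.
- by rewrite mulr_gt0// lt_neqAle eq_sym A0/=.
- by rewrite mulr_gt0// ltr_wpDl.
- by rewrite lt_max T1.
move=> u theta sol t; rewrite ge_max => /andP[tT tT']; split.
  by rewrite mulrAC; exact: hc sol k t tT'.
apply: le_trans (hC _ _ _ data _ _ sol k t tT) _.
rewrite e0 e1 e2 -!EFinD -EFinM lee_fin -/S mulrAC ler_wpM2r ?growth_ge0//.
by rewrite ler_wpM2l ?lerDl// ltW.
Qed.
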